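(* Let $0<\lambda\le1\le\Lambda$, let $\omega$ be as in the context, and let $\Omega\subset\mathbb H^n$ be open with finite Lebesgue measure $|\Omega|<\infty$. There exist constants $C,K$ depending only on $\lambda,\Lambda,Q,\omega,|\Omega|$ such that for every symplectic $A\in M_n(\lambda,\Lambda,\Omega)\cap C(\Omega,\omega)$ and every $u\in C^2(\Omega)$ satisfying $u\ge0$ and $\mathcal L_Au=0$ in $B_{Kr}(z_0)\subset\Omega$ (for some $z_0\in\Omega$, $r>0$), one has $$\sup_{B_r(z_0)}u\le C\inf_{B_r(z_0)}u.$$
   Context: Points $z=(x,t)\in\mathbb R^{2n+1}$; $J=\begin{pmatrix}0&-\mathbb I_n\\ \mathbb I_n&0\end{pmatrix}$, $Q=2n+2$. $\mathbb H^n$: $(x,t)\circ(\xi,\tau)=(x+\xi,t+\tau+2\langle Jx,\xi\rangle)$, $(x,t)^{-1}=(-x,-t)$; $\rho(x,t)=(|x|^4+t^2)^{1/4}$, $d(z,\zeta)=\rho(z^{-1}\circ\zeta)$, $B_R(z)=\{\zeta:d(z,\zeta)<R\}$. $X_i=\partial_{x_i}+2(Jx)_i\partial_t$, $D^2_{\mathbb H}u=(\tfrac12(X_iX_j+X_jX_i)u)_{i,j=1}^{2n}$, $\mathcal L_Au(z)=\mathrm{tr}(A(z)D^2_{\mathbb H}u(z))$. $M_n(\lambda,\Lambda,\Omega)$: symmetric matrix functions on $\Omega$ with $\det A(z)=1$ and $\lambda\mathbb I\le A(z)\le\Lambda\mathbb I$; symplectic means $A(z)^{-1}=J^tA(z)J$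 for all $z$. $\omega:[0,1)\to[0,1)$ nondecreasing with $\omega(0)=\lim_{s\to0^+}\omega(s)=0$; $C(\Omega,\omega)$: continuous $A$ with $\sup_{z\in B_\epsilon(z_0)\cap\Omega}\|A(z)-A(z_0)\|\le\omega(\epsilon)$ for all $z_0\in\Omega$, $0<\epsilon<1$. *)

(* Defs.v *)
From Stdlib Require Import Reals Lra Lia Arith.
Open Scope R_scope.

(* A point z = (x,t) of H^n = R^(2n+1).  x is stored as a function nat -> R,
   only the coordinates 0..2n-1 are meaningful; genuine points of H^n are the
   "canonical" ones whose coordinates >= 2n vanish (see [inH]). *)
Definition Point := ((nat -> R) * R)%type.

Definition inH (n : nat) (z : Point) : Prop :=
  forall i, (2 * n <= i)%nat -> fst z i = 0.

Fixpoint sumR (N : nat) (f : nat -> R) : R :=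
  match N with
  | O => 0
  | S k => sumR k f + f k
  end.

(* entries of J = [[0, -I_n],[I_n, 0]] (indices < 2n) *)
Definition Jm (n i k : nat) : R :=
  if (i <? n)%nat then (if (k =? i + n)%nat then -1 else 0)
  else if (i <? 2 * n)%nat then (if (k + n =? i)%nat then 1 else 0)
  else 0.

Definition Jx (n : nat) (x : nat -> R) (i : nat) : R :=
  sumR (2 * n) (fun k => Jm n i k * x k).

Definition dotR (n : nat) (x y : nat -> R) : R :=
  sumR (2 * n) (fun i => x i * y i).

Definition hmul (n : nat) (z w : Point) : Point :=
  (fun i => fst z i + fst w i, snd z + snd w + 2 * dotR n (Jx n (fst z)) (fst w)).
Definition hinv (z : Point) : Point := (fun i => - fst z i, - snd z).

Definition rho (n : nat) (z : Point) : R :=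
  sqrt (sqrt ((dotR n (fst z) (fst z)) ^ 2 + (snd z) ^ 2)).

Definition dH (n : nat) (z w : Point) : R := rho n (hmul n (hinv z) w).

Definition ballH (n : nat) (z : Point) (Rad : R) (w : Point) : Prop :=
  inH n w /\ dH n z w < Rad.

Definition euclid (n : nat) (z w : Point) : R :=
  sqrt (sumR (2 * n) (fun i => (fst z i - fst w i) ^ 2) + (snd z - snd w) ^ 2).

Definition open_H (n : nat) (Om : Point -> Prop) : Prop :=
  (forall z, Om z -> inH n z) /\
  forall z, Om z -> exists eps, 0 < eps /\
    forall w, inH n w -> euclid n z w < eps -> Om w.

(* k-th coordinate of a point, k <= 2n (k = 2n is the t coordinate) *)
Definition coord (n : nat) (z : Point) (k : nat) : R :=
  if (k <? 2 * n)%nat then fst z k else snd z.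

Definition shift (n : nat) (z : Point) (k : nat) (h : R) : Point :=
  if (k <? 2 * n)%nat then ((fun i => if (i =? k)%nat then fst z i + h else fst z i), snd z)
  else (fst z, snd z + h).

Definition partial_is (n : nat) (f : Point -> R) (z : Point) (k : nat) (l : R) : Prop :=
  derivable_pt_lim (fun h => f (shift n z k h)) 0 l.

Definition continuous_on (n : nat) (Om : Point -> Prop) (f : Point -> R) : Prop :=
  forall z, Om z -> forall eps, 0 < eps -> exists del, 0 < del /\
    forall w, Om w -> euclid n z w < del -> Rabs (f w - f z) < eps.

Definition C2_on (n : nat) (Om : Point -> Prop) (u : Point -> R)
  (Du : nat -> Point -> R) (D2u : nat -> nat -> Point -> R) : Prop :=
  (forall z, Om z -> forall k, (k <= 2 * n)%nat -> partial_is n u z k (Du k z)) /\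
  (forall z, Om z -> forall k l, (k <= 2 * n)%nat -> (l <= 2 * n)%nat ->
      partial_is n (Du k) z l (D2u k l z)) /\
  continuous_on n Om u /\
  (forall k, (k <= 2 * n)%nat -> continuous_on n Om (Du k)) /\
  (forall k l, (k <= 2 * n)%nat -> (l <= 2 * n)%nat -> continuous_on n Om (D2u k l)).

(* X_i f = partial_{x_i} f + 2 (Jx)_i partial_t f, given the partials Df of f *)
Definition Xop (n : nat) (Df : nat -> Point -> R) (i : nat) (z : Point) : R :=
  Df i z + 2 * Jx n (fst z) i * Df (2 * n)%nat z.

Definition XDeriv_on (n : nat) (Om : Point -> Prop) (Du : nat -> Point -> R)
  (P : nat -> nat -> Point -> R) : Prop :=
  forall z, Om z -> forall j k, (j < 2 * n)%nat -> (k <= 2 * n)%nat ->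
    partial_is n (Xop n Du j) z k (P j k z).

(* X_i X_j u (z) = X_i applied to X_j u, whose partials are P j _ *)
Definition XXu (n : nat) (P : nat -> nat -> Point -> R) (i j : nat) (z : Point) : R :=
  Xop n (P j) i z.

(* (D^2_H u)_{ij} = (X_i X_j u + X_j X_i u)/2 ;  L_A u = tr(A D^2_H u) *)
Definition LA (n : nat) (A : Point -> nat -> nat -> R) (P : nat -> nat -> Point -> R)
  (z : Point) : R :=
  sumR (2 * n) (fun i => sumR (2 * n) (fun j =>
    A z i j * ((XXu n P j i z + XXu n P i j z) / 2))).

Definition minor (M : nat -> nat -> R) (j : nat) : nat -> nat -> R :=
  fun a b => M (S a) (if (b <? j)%nat then b else S b).

Fixpoint detk (k : nat) (M : nat -> nat -> R) : R :=
  match k with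
  | O => 1
  | S k' => sumR (S k') (fun j => (-1) ^ j * M O j * detk k' (minor M j))
  end.

Definition normv (n : nat) (x : nat -> R) : R := sqrt (dotR n x x).
Definition matvec (n : nat) (M : nat -> nat -> R) (x : nat -> R) : nat -> R :=
  fun i => sumR (2 * n) (fun k => M i k * x k).

Definition in_Mn (n : nat) (lam Lam : R) (Om : Point -> Prop)
  (A : Point -> nat -> nat -> R) : Prop :=
  forall z, Om z ->
    (forall i j, (i < 2 * n)%nat -> (j < 2 * n)%nat -> A z i j = A z j i) /\
    detk (2 * n) (A z) = 1 /\
    (forall xi : nat -> R,
       lam * dotR n xi xi <= dotR n xi (matvec n (A z) xi) /\
       dotR n xi (matvec n (A z) xi) <= Lam * dotR n xi xi).

(* A(z)^{-1} = J^t A(z) J, i.e. A(z) (J^t A(z) J) = I *)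
Definition symplectic (n : nat) (Om : Point -> Prop) (A : Point -> nat -> nat -> R) : Prop :=
  forall z, Om z -> forall i j, (i < 2 * n)%nat -> (j < 2 * n)%nat ->
    sumR (2 * n) (fun k => A z i k *
      sumR (2 * n) (fun a => sumR (2 * n) (fun b => Jm n a k * A z a b * Jm n b j)))
    = if (i =? j)%nat then 1 else 0.

Definition modulus (om : R -> R) : Prop :=
  (forall s, 0 <= s < 1 -> 0 <= om s < 1) /\
  (forall s s', 0 <= s -> s <= s' -> s' < 1 -> om s <= om s') /\
  om 0 = 0 /\
  (forall eps, 0 < eps -> exists del, 0 < del /\ forall s, 0 < s < del -> s < 1 -> om s < eps).

(* A in C(Om, om): sup_{z in B_eps(z0) cap Om} ||A(z) - A(z0)|| <= om(eps),
   with ||.|| the operator norm *)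
Definition in_C (n : nat) (Om : Point -> Prop) (om : R -> R)
  (A : Point -> nat -> nat -> R) : Prop :=
  forall z0, Om z0 -> forall eps, 0 < eps < 1 -> forall z, ballH n z0 eps z -> Om z ->
    forall xi : nat -> R,
      normv n (matvec n (fun i j => A z i j - A z0 i j) xi) <= om eps * normv n xi.

Definition box_vol (n : nat) (a b : nat -> R) : R :=
  (fix prodv (N : nat) : R :=
     match N with O => 1 | S k => prodv k * (b k - a k) end) (S (2 * n)).

Definition box_cover (n : nat) (E : Point -> Prop) (a b : nat -> nat -> R) : Prop :=
  (forall j k, (k <= 2 * n)%nat -> a j k <= b j k) /\
  forall z, E z -> exists j, forall k, (k <= 2 * n)%nat ->
    a j k <= coord n z k <= b j k.

Definition lebesgue_measure_is (n : nat) (E : Point -> Prop) (m : R) : Prop :=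
  let S := fun s => exists a b, box_cover n E a b /\
             infinite_sum (fun j => box_vol n (a j) (b j)) s in
  (forall s, S s -> m <= s) /\ (forall m', (forall s, S s -> m' <= s) -> m' <= m).

(* Main.v *)
Require Import Defs.
From Stdlib Require Import Reals Lra Lia Arith List FunctionalExtensionality Classical ClassicalChoice.
Open Scope R_scope.

(** Landis' method with an explicit barrier.  The Koranyi gauge is a metric and homogeneous of dimension
    Q = 2n+2.  For a constant symplectic A0 with B = A0^-1 = J^t A0 J put phi = <Bx,x>^2 + t^2; then
    phi^(-s/4), translated to any pole, is a subsolution of L_A0 off the pole when s > Q-2, with a margin that
    has the same degeneracy <Bx,x> as the perturbation tr((A-A0) D^2 phi^(-s/4)); hence it stays a
    subsolution of L_A when A is close to A0.  For s = Q-1 < Q the potential of a normalised counting measure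
    on a fine grid is bounded, so comparing u >= 0 with the potential of (the grid points in) {u >= l}
    bounds u below by c l |{u >= l}|, linearly in the measure.  The Harnack inequality follows by applying
    this to u and, near a point z1 maximising (2r - d(z0,.))^Q u, to (1+eta) u(z1) - u.
    Closeness of A to A(z0) is free: |B_{Kr}| <= |Omega| forces K r to be bounded, so r is as small as we
    like once K is large. *)

(** * Finite sums and the matrix J *)

(** The obstacle is degeneracy: L_{A0} phi^(-s/4) carries the factor q = <Bx,x>, which vanishes on
    the whole vertical line through the pole, so a perturbation that did not vanish there could not
    be absorbed. Symplecticity helps: A0 B = 1 and B = J^t A0 J give <A0 Bx,Bx> = <A0 Jx,Jx> = q and
    <A0 Bx,Jx> = 0, so the vectors entering the Hessian have squared length at most q/lam, and so
    the errors degenerate too. The exponent lies between Q-2 (subsolution) and Q (bounded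
    potential); Q-1 leaves the margin 4.

    Linearity in the measure closes the argument. With delta = 2r - d(z0,z1), the set {u >= u(z1)/2}
    fills a fixed proportion of a ball of radius comparable to delta, hence a proportion of order
    (delta/r)^Q of the ball of radius 2r. Growth then bounds u below by a constant times
    u(z1)(delta/r)^Q, and this is at least u(z) because z1 maximises with the weight of the same
    power Q.

    Counting grid points replaces the measure of level sets by finite sums; uniform continuity of u
    carries a bound from a grid point to its h-ball. *)

Lemma Rabs_le_inv a b : Rabs a <= b -> - b <= a <= b.
Proof. unfold Rabs. destruct (Rcase_abs a); lra. Qed.

Lemma sumR_ext N f g : (forall i, (i < N)%nat -> f i = g i) -> sumR N f = sumR N g.
Proof.
  induction N as [|N IH]; intros H; [reflexivity|]. simpl.
  rewrite IH by (intros; apply H; lia). rewrite H by lia. reflexivity.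
Qed.

Lemma sumR_plus N f g : sumR N (fun i => f i + g i) = sumR N f + sumR N g.
Proof. induction N as [|N IH]; simpl; [ring|]. rewrite IH; ring. Qed.

Lemma sumR_scal N c f : sumR N (fun i => c * f i) = c * sumR N f.
Proof. induction N as [|N IH]; simpl; [ring|]. rewrite IH; ring. Qed.

Lemma sumR_scal_r N c f : sumR N (fun i => f i * c) = sumR N f * c.
Proof. induction N as [|N IH]; simpl; [ring|]. rewrite IH; ring. Qed.

Lemma sumR_opp N f : sumR N (fun i => - f i) = - sumR N f.
Proof. induction N as [|N IH]; simpl; [ring|]. rewrite IH; ring. Qed.

Lemma sumR_const N c : sumR N (fun _ => c) = INR N * c.
Proof. induction N as [|N IH]; [simpl; ring|]. rewrite S_INR; simpl sumR. rewrite IH; ring. Qed.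

Lemma sumR_zero N f : (forall i, (i < N)%nat -> f i = 0) -> sumR N f = 0.
Proof. intros H. rewrite (sumR_ext N f (fun _ => 0) H), sumR_const. ring. Qed.

Lemma sumR_le N f g : (forall i, (i < N)%nat -> f i <= g i) -> sumR N f <= sumR N g.
Proof.
  induction N as [|N IH]; intros H; simpl; [lra|].
  assert (sumR N f <= sumR N g) by (apply IH; intros; apply H; lia).
  specialize (H N ltac:(lia)). lra.
Qed.

Lemma sumR_nonneg N f : (forall i, (i < N)%nat -> 0 <= f i) -> 0 <= sumR N f.
Proof.
  intros H. rewrite <- (sumR_zero N (fun _ => 0)) by auto. now apply sumR_le.
Qed.

Lemma sumR_abs N f : Rabs (sumR N f) <= sumR N (fun i => Rabs (f i)).
Proof.
  induction N as [|N IH]; simpl; [rewrite Rabs_R0; lra|].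
  eapply Rle_trans; [apply Rabs_triang|]. lra.
Qed.

Lemma sumR_term_le N f k : (forall i, (i < N)%nat -> 0 <= f i) -> (k < N)%nat -> f k <= sumR N f.
Proof.
  induction N as [|N IH]; intros H Hk; [lia|]. simpl.
  assert (0 <= sumR N f) by (apply sumR_nonneg; intros; apply H; lia).
  destruct (Nat.eq_dec k N) as [->|E]; [lra|].
  assert (f k <= sumR N f) by (apply IH; [intros; apply H|]; lia).
  specialize (H N ltac:(lia)). lra.
Qed.

Lemma sumR_swap N M f :
  sumR N (fun i => sumR M (fun j => f i j)) = sumR M (fun j => sumR N (fun i => f i j)).
Proof.
  induction N as [|N IH]; simpl.
  - symmetry; apply sumR_zero; auto.
  - rewrite IH, <- sumR_plus. reflexivity.
Qed.

Lemma sumR_delta N k f : (k < N)%nat ->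
  sumR N (fun i => (if (i =? k)%nat then 1 else 0) * f i) = f k.
Proof.
  induction N as [|N IH]; intros Hk; [lia|]. simpl.
  destruct (Nat.eq_dec k N) as [->|E].
  - rewrite Nat.eqb_refl, sumR_zero; [ring|].
    intros i Hi. destruct (Nat.eqb_spec i N); [lia|ring].
  - rewrite IH by lia. destruct (Nat.eqb_spec N k); [lia|ring].
Qed.

Lemma sumR_split N M f : sumR (N + M) f = sumR N f + sumR M (fun i => f (N + i)%nat).
Proof.
  induction M as [|M IH]; simpl; [rewrite Nat.add_0_r; ring|].
  rewrite Nat.add_succ_r; simpl. rewrite IH; ring.
Qed.

Lemma dotR_halves n x y :
  dotR n x y = sumR n (fun i => x i * y i + x (n + i)%nat * y (n + i)%nat).
Proof.
  unfold dotR. replace (2 * n)%nat with (n + n)%nat by lia.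
  now rewrite sumR_split, sumR_plus.
Qed.

Lemma Jx_lo n x i : (i < n)%nat -> Jx n x i = - x (n + i)%nat.
Proof.
  intros Hi. unfold Jx.
  rewrite (sumR_ext _ _ (fun k => (if (k =? n + i)%nat then 1 else 0) * (- x k))).
  - apply (sumR_delta (2 * n) (n + i) (fun k => - x k)); lia.
  - intros k _. unfold Jm. rewrite (proj2 (Nat.ltb_lt i n) Hi).
    rewrite (Nat.add_comm i n). destruct (k =? n + i)%nat; ring.
Qed.

Lemma Jx_hi n x i : (i < n)%nat -> Jx n x (n + i)%nat = x i.
Proof.
  intros Hi. unfold Jx.
  rewrite (sumR_ext _ _ (fun k => (if (k =? i)%nat then 1 else 0) * x k)).
  - apply (sumR_delta (2 * n) i x); lia.
  - intros k _. unfold Jm.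
    destruct (Nat.ltb_spec (n + i) n); [lia|].
    destruct (Nat.ltb_spec (n + i) (2 * n)); [|lia].
    destruct (Nat.eqb_spec (k + n) (n + i)); destruct (Nat.eqb_spec k i); try lia; ring.
Qed.

Lemma dot_Jx_halves n x y :
  dotR n (Jx n x) y = sumR n (fun i => - x (n + i)%nat * y i + x i * y (n + i)%nat).
Proof.
  rewrite dotR_halves. apply sumR_ext. intros i Hi. now rewrite Jx_lo, Jx_hi.
Qed.

Lemma dotR_comm n x y : dotR n x y = dotR n y x.
Proof. apply sumR_ext; intros; ring. Qed.

Lemma dotR_plus_l n x y w : dotR n (fun i => x i + y i) w = dotR n x w + dotR n y w.
Proof. unfold dotR. rewrite <- sumR_plus. apply sumR_ext; intros; ring. Qed.

Lemma dotR_plus_r n x y w : dotR n w (fun i => x i + y i) = dotR n w x + dotR n w y.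
Proof. unfold dotR. rewrite <- sumR_plus. apply sumR_ext; intros; ring. Qed.

Lemma dotR_scal_l n c x w : dotR n (fun i => c * x i) w = c * dotR n x w.
Proof. unfold dotR. rewrite <- sumR_scal. apply sumR_ext; intros; ring. Qed.

Lemma dotR_scal_r n c x w : dotR n w (fun i => c * x i) = c * dotR n w x.
Proof. unfold dotR. rewrite <- sumR_scal. apply sumR_ext; intros; ring. Qed.

Lemma dotR_opp_l n x w : dotR n (fun i => - x i) w = - dotR n x w.
Proof. unfold dotR. rewrite <- sumR_opp. apply sumR_ext; intros; ring. Qed.

Lemma dotR_ext n x y x' y' : (forall i, (i < 2 * n)%nat -> x i = x' i) ->
  (forall i, (i < 2 * n)%nat -> y i = y' i) -> dotR n x y = dotR n x' y'.
Proof. intros H H'. apply sumR_ext. intros. rewrite H, H'; auto. Qed.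

Lemma dotR_self_nonneg n x : 0 <= dotR n x x.
Proof. apply sumR_nonneg. intros. nra. Qed.

Lemma Jx_plus n x y : Jx n (fun i => x i + y i) = fun i => Jx n x i + Jx n y i.
Proof.
  extensionality i. unfold Jx. rewrite <- sumR_plus. apply sumR_ext; intros; ring.
Qed.

Lemma Jx_scal n c x : Jx n (fun i => c * x i) = fun i => c * Jx n x i.
Proof.
  extensionality i. unfold Jx. rewrite <- sumR_scal. apply sumR_ext; intros; ring.
Qed.

Lemma Jx_opp n x : Jx n (fun i => - x i) = fun i => - Jx n x i.
Proof.
  extensionality i. unfold Jx. rewrite <- sumR_opp. apply sumR_ext; intros; ring.
Qed.

Lemma dot_Jx_self n x : dotR n (Jx n x) x = 0.
Proof. rewrite dot_Jx_halves. apply sumR_zero. intros; ring. Qed.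

Lemma dot_Jx_anti n x y : dotR n (Jx n x) y = - dotR n (Jx n y) x.
Proof. rewrite !dot_Jx_halves, <- sumR_opp. apply sumR_ext. intros; ring. Qed.

Lemma dot_Jx_Jx n x y : dotR n (Jx n x) (Jx n y) = dotR n x y.
Proof.
  rewrite dot_Jx_halves, dotR_halves. apply sumR_ext. intros i Hi.
  rewrite Jx_lo, Jx_hi by auto. ring.
Qed.

Lemma CS_dot n x y : (dotR n x y) ^ 2 <= dotR n x x * dotR n y y.
Proof.
  set (a := dotR n x x). set (b := dotR n x y). set (c := dotR n y y).
  assert (H : forall s, 0 <= a + 2 * s * b + s * s * c).
  { intros s. pose proof (dotR_self_nonneg n (fun i => x i + s * y i)) as H.
    rewrite dotR_plus_l, !dotR_plus_r, !dotR_scal_l, !dotR_scal_r in H.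
    rewrite (dotR_comm n y x) in H. fold a b c in H. lra. }
  assert (Ha : 0 <= a) by apply dotR_self_nonneg.
  assert (Hc : 0 <= c) by apply dotR_self_nonneg.
  destruct (Req_dec c 0) as [E|E].
  - rewrite E in *. destruct (Req_dec b 0) as [E'|E']; [rewrite E'; nra|].
    (* With c = 0 the quadratic is affine in s, and this s gives it the value -1. *)
    specialize (H (- (a + 1) / (2 * b))).
    replace (a + 2 * (- (a + 1) / (2 * b)) * b + _) with (-1) in H by (field; auto). lra.
  - assert (0 < c) by lra. specialize (H (- b / c)).
    replace (a + 2 * (- b / c) * b + - b / c * (- b / c) * c) with ((a * c - b ^ 2) / c) in H
      by (field; auto).
    apply (Rmult_le_compat_r c) in H; [|lra]. unfold Rdiv in H.
    rewrite Rmult_assoc, Rinv_l, Rmult_0_l in H by auto. lra.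
Qed.

(* Bessel's inequality for the orthogonal pair x, Jx of equal lengths. *)
Lemma dot_bessel n x y :
  (dotR n x y) ^ 2 + (dotR n (Jx n x) y) ^ 2 <= dotR n x x * dotR n y y.
Proof.
  set (a := dotR n x y). set (b := dotR n (Jx n x) y).
  pose proof (CS_dot n (fun i => a * x i + b * Jx n x i) y) as H.
  rewrite !dotR_plus_l, !dotR_plus_r, !dotR_scal_l, !dotR_scal_r, dot_Jx_Jx, dot_Jx_self in H.
  rewrite (dotR_comm n x (Jx n x)), dot_Jx_self in H. fold a b in H.
  pose proof (dotR_self_nonneg n x). pose proof (dotR_self_nonneg n y).
  destruct (Req_dec (a ^ 2 + b ^ 2) 0) as [E|E]; [rewrite E; nra|].
  assert (0 < a ^ 2 + b ^ 2) by nra.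
  apply (Rmult_le_reg_l (a ^ 2 + b ^ 2)); [auto|]. nra.
Qed.

(** * The Koranyi metric *)

Lemma pow4_le a b : 0 <= b -> a ^ 4 <= b ^ 4 -> a <= b.
Proof.
  intros Hb H. destruct (Rle_or_lt a b) as [|C]; [auto|].
  assert (b ^ 2 < a ^ 2) by nra. nra.
Qed.

Lemma pow4_lt a b : 0 <= b -> a ^ 4 < b ^ 4 -> a < b.
Proof.
  intros Hb H. destruct (Rlt_or_le a b) as [|C]; [auto|].
  assert (b ^ 2 <= a ^ 2) by nra. nra.
Qed.

Lemma rho_nonneg n z : 0 <= rho n z.
Proof. apply sqrt_pos. Qed.

Lemma rho_pow4 n z : rho n z ^ 4 = (dotR n (fst z) (fst z)) ^ 2 + snd z ^ 2.
Proof.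
  unfold rho. set (a := dotR n _ _ ^ 2 + _).
  assert (0 <= a) by (unfold a; nra).
  replace (sqrt (sqrt a) ^ 4) with ((sqrt (sqrt a) * sqrt (sqrt a)) * (sqrt (sqrt a) * sqrt (sqrt a))) by ring.
  rewrite sqrt_sqrt by apply sqrt_pos. now apply sqrt_sqrt.
Qed.

Lemma dot_le_rho n z : dotR n (fst z) (fst z) <= rho n z ^ 2.
Proof.
  pose proof (rho_pow4 n z). pose proof (dotR_self_nonneg n (fst z)).
  pose proof (rho_nonneg n z).
  replace (rho n z ^ 4) with ((rho n z ^ 2) * (rho n z ^ 2)) in H by ring.
  nra.
Qed.

Lemma snd_le_rho n z : Rabs (snd z) <= rho n z ^ 2.
Proof.
  pose proof (rho_pow4 n z). pose proof (rho_nonneg n z).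
  apply Rsqr_incr_0_var; [|nra]. rewrite <- Rsqr_abs. unfold Rsqr.
  replace (rho n z ^ 4) with ((rho n z ^ 2) * (rho n z ^ 2)) in H by ring.
  nra.
Qed.

(** The real part of a product of two complex numbers, one conjugated, of modulus at most P and Q.
    Three instances give [rho_mul]. *)
Lemma cs2 x1 x2 y1 y2 P Q : 0 <= P -> 0 <= Q ->
  x1 ^ 2 + x2 ^ 2 <= P ^ 2 -> y1 ^ 2 + y2 ^ 2 <= Q ^ 2 -> x1 * y1 + x2 * y2 <= P * Q.
Proof.
  intros HP HQ H1 H2.
  assert ((x1 * y1 + x2 * y2) ^ 2 <= (P * Q) ^ 2).
  { replace ((P * Q) ^ 2) with (P ^ 2 * Q ^ 2) by ring.
    apply Rle_trans with ((x1 ^ 2 + x2 ^ 2) * (y1 ^ 2 + y2 ^ 2)).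
    - pose proof (Rle_0_sqr (x1 * y2 - x2 * y1)) as S. unfold Rsqr in S. nra.
    - apply Rmult_le_compat; nra. }
  assert (0 <= P * Q) by nra. nra.
Qed.

(* Cygan's argument: rho^2 is the modulus of |x|^2 + i t, and the cross term has modulus at most 2|x||xi|. *)
Lemma rho_mul n z w : rho n (hmul n z w) <= rho n z + rho n w.
Proof.
  pose proof (rho_nonneg n z) as Hs. pose proof (rho_nonneg n w) as Hm.
  apply pow4_le; [lra|]. rewrite rho_pow4. destruct z as [x t], w as [xi tau].
  pose proof (rho_pow4 n (x, t)) as E1. pose proof (rho_pow4 n (xi, tau)) as E2.
  pose proof (dot_le_rho n (x, t)) as L1. pose proof (dot_le_rho n (xi, tau)) as L2.
  unfold hmul. simpl fst in *; simpl snd in *.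
  rewrite !dotR_plus_l, !dotR_plus_r, (dotR_comm n xi x).
  pose proof (dot_bessel n x xi) as B.
  pose proof (dotR_self_nonneg n x) as Pa. pose proof (dotR_self_nonneg n xi) as Pb.
  set (s := rho n (x, t)) in *. set (m := rho n (xi, tau)) in *.
  set (a := dotR n x x) in *. set (b := dotR n xi xi) in *.
  set (c := dotR n x xi) in *. set (d := dotR n (Jx n x) xi) in *.
  assert (U : c ^ 2 + d ^ 2 <= (s * m) ^ 2).
  { apply Rle_trans with (a * b); [exact B|].
    replace ((s * m) ^ 2) with (s ^ 2 * m ^ 2) by ring. apply Rmult_le_compat; auto. }
  assert (V : a ^ 2 + t ^ 2 <= (s ^ 2) ^ 2) by (rewrite <- E1; apply Req_le; ring).
  assert (W : b ^ 2 + tau ^ 2 <= (m ^ 2) ^ 2) by (rewrite <- E2; apply Req_le; ring).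
  assert (0 <= s * m) by nra.
  pose proof (cs2 a t b tau (s ^ 2) (m ^ 2) ltac:(nra) ltac:(nra) V W) as C1.
  pose proof (cs2 a t c d (s ^ 2) (s * m) ltac:(nra) ltac:(nra) V U) as C2.
  pose proof (cs2 b tau c d (m ^ 2) (s * m) ltac:(nra) ltac:(nra) W U) as C3.
  replace ((s + m) ^ 4) with
    ((s^2)^2 + (m^2)^2 + 4 * (s * m)^2 + 2 * (s^2 * m^2) + 4 * (s^2 * (s * m)) + 4 * (m^2 * (s*m))) by ring.
  nra.
Qed.

Lemma rho_inv n z : rho n (hinv z) = rho n z.
Proof.
  unfold rho, hinv; simpl fst; simpl snd. f_equal. f_equal.
  f_equal; [|ring]. f_equal. apply sumR_ext; intros; ring.
Qed.

Lemma point_ext (z w : Point) : (forall i, fst z i = fst w i) -> snd z = snd w -> z = w.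
Proof.
  destruct z as [x t], w as [y s]; simpl; intros H ->. f_equal. now extensionality i.
Qed.

Lemma hmul_assoc n a b c : hmul n (hmul n a b) c = hmul n a (hmul n b c).
Proof.
  apply point_ext; unfold hmul; simpl; [intros; ring|].
  rewrite Jx_plus, dotR_plus_l, dotR_plus_r. ring.
Qed.

Definition hone : Point := (fun _ => 0, 0).

Lemma hmul_one_l n a : hmul n hone a = a.
Proof.
  apply point_ext; unfold hmul, hone; simpl; [intros; ring|].
  unfold dotR. rewrite (sumR_zero (2 * n)); [ring|]. intros. unfold Jx. rewrite sumR_zero; [ring|]. intros; ring.
Qed.

Lemma hmul_inv_l n a : hmul n (hinv a) a = hone.
Proof.
  apply point_ext; unfold hmul, hone, hinv; simpl; [intros; ring|].
  rewrite Jx_opp, dotR_opp_l, dot_Jx_self. ring.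
Qed.

Lemma hmul_inv_r n a : hmul n a (hinv a) = hone.
Proof.
  apply point_ext; unfold hmul, hone, hinv; simpl; [intros; ring|].
  rewrite dotR_comm, dotR_opp_l, dotR_comm, dot_Jx_self. ring.
Qed.

Lemma hinv_mul n a b : hinv (hmul n a b) = hmul n (hinv b) (hinv a).
Proof.
  apply point_ext; unfold hmul, hinv; simpl; [intros; ring|].
  rewrite Jx_opp, dotR_opp_l, (dotR_comm n (Jx n (fst b))), dotR_opp_l, (dotR_comm n _ (Jx n (fst b))).
  rewrite (dot_Jx_anti n (fst b)). ring.
Qed.

Lemma hinv_inv z : hinv (hinv z) = z.
Proof. apply point_ext; unfold hinv; simpl; intros; ring. Qed.

Lemma dH_nonneg n z w : 0 <= dH n z w.
Proof. apply rho_nonneg. Qed.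

Lemma dH_sym n z w : dH n z w = dH n w z.
Proof. unfold dH. rewrite <- rho_inv, hinv_mul, hinv_inv. reflexivity. Qed.

Lemma dH_tri n a b c : dH n a c <= dH n a b + dH n b c.
Proof.
  unfold dH.
  replace (hmul n (hinv a) c) with (hmul n (hmul n (hinv a) b) (hmul n (hinv b) c)).
  - apply rho_mul.
  - rewrite hmul_assoc, <- (hmul_assoc n b), hmul_inv_r, hmul_one_l. reflexivity.
Qed.

Lemma dH_left n p a b : dH n (hmul n p a) (hmul n p b) = dH n a b.
Proof.
  unfold dH. f_equal. rewrite hinv_mul, hmul_assoc, <- (hmul_assoc n (hinv p)), hmul_inv_l, hmul_one_l.
  reflexivity.
Qed.

Lemma dH_mul_r n z w : dH n z (hmul n z w) = rho n w.
Proof. unfold dH. now rewrite <- hmul_assoc, hmul_inv_l, hmul_one_l. Qed.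

Lemma dH_refl n z : dH n z z = 0.
Proof.
  unfold dH. rewrite hmul_inv_l. unfold rho, hone; simpl fst; simpl snd.
  unfold dotR. rewrite (sumR_zero (2 * n)) by (intros; ring).
  replace (0 ^ 2 + 0 ^ 2) with 0 by ring. rewrite !sqrt_0. reflexivity.
Qed.

Lemma inH_mul n z w : inH n z -> inH n w -> inH n (hmul n z w).
Proof. intros H1 H2 i Hi. unfold hmul; simpl. rewrite H1, H2 by auto. ring. Qed.

Lemma dH_coord n z w : dH n z w ^ 4 =
  (sumR (2 * n) (fun i => (fst w i - fst z i) ^ 2)) ^ 2
  + (snd w - snd z - 2 * dotR n (Jx n (fst z)) (fst w)) ^ 2.
Proof.
  unfold dH. rewrite rho_pow4. unfold hmul, hinv; simpl fst; simpl snd.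
  f_equal; [f_equal|].
  - apply sumR_ext; intros; ring.
  - rewrite Jx_opp, dotR_opp_l. f_equal. ring.
Qed.

(** The integral curve through z of the left-invariant field sum xi_i X_i. Second derivatives along
    these curves read off the symmetrised horizontal Hessian. *)
Definition hline (n : nat) (z : Point) (xi : nat -> R) (s : R) : Point :=
  hmul n z (fun i => s * xi i, 0).

Lemma hline_eq n z xi s :
  hline n z xi s = (fun i => fst z i + s * xi i, snd z + s * (2 * dotR n (Jx n (fst z)) xi)).
Proof.
  unfold hline, hmul; simpl. f_equal. rewrite dotR_scal_r. ring.
Qed.

Lemma hline_0 n z xi : hline n z xi 0 = z.
Proof. rewrite hline_eq. apply point_ext; simpl; intros; ring. Qed.

Lemma hline_add n z xi s s' : hline n z xi (s + s') = hline n (hline n z xi s) xi s'.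
Proof.
  rewrite !hline_eq. apply point_ext; simpl; intros; [ring|].
  rewrite Jx_plus, dotR_plus_l, Jx_scal, dotR_scal_l, dot_Jx_self. ring.
Qed.

Lemma hline_inH n z xi s : inH n z -> (forall i, (2 * n <= i)%nat -> xi i = 0) -> inH n (hline n z xi s).
Proof. intros H H' i Hi. rewrite hline_eq; simpl. rewrite H, H' by auto. ring. Qed.

Lemma hline_dist n z xi s : dH n z (hline n z xi s) ^ 2 = s ^ 2 * dotR n xi xi.
Proof.
  unfold hline. rewrite dH_mul_r. unfold rho. simpl fst; simpl snd.
  rewrite dotR_scal_l, dotR_scal_r.
  pose proof (dotR_self_nonneg n xi).
  replace ((s * (s * dotR n xi xi)) ^ 2 + 0 ^ 2) with (Rsqr (s ^ 2 * dotR n xi xi)) by (unfold Rsqr; ring).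
  rewrite sqrt_Rsqr by nra. rewrite pow2_sqrt by nra. reflexivity.
Qed.

(** * Symplectic matrices and the barrier form *)

Definition quadf (N : nat) (M : nat -> nat -> R) (xi : nat -> R) : R :=
  sumR N (fun i => xi i * sumR N (fun j => M i j * xi j)).

Lemma quadf_ext N M M' xi xi' : (forall i j, (i < N)%nat -> (j < N)%nat -> M i j = M' i j) ->
  (forall i, (i < N)%nat -> xi i = xi' i) -> quadf N M xi = quadf N M' xi'.
Proof.
  intros H H'. apply sumR_ext. intros i Hi. rewrite H' by auto. f_equal.
  apply sumR_ext. intros j Hj. rewrite H, H' by auto. reflexivity.
Qed.

Lemma quadf_S N M xi : (forall i, (i < N)%nat -> M N i = M i N) ->
  quadf (S N) M xi = quadf N M xi + 2 * xi N * sumR N (fun i => M i N * xi i) + M N N * xi N ^ 2.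
Proof.
  intros Hs. unfold quadf at 1. simpl.
  rewrite (sumR_ext N _ (fun i => xi i * sumR N (fun j => M i j * xi j) + xi N * (M i N * xi i)))
    by (intros; ring).
  rewrite sumR_plus, sumR_scal. fold (quadf N M xi).
  rewrite (sumR_ext N (fun j => M N j * xi j) (fun j => M j N * xi j)).
  - ring.
  - intros i Hi. now rewrite Hs.
Qed.

(** Induction through the Schur complement of the last diagonal entry. The rows [L k] are required
    to vanish from index N on, so that they are admissible directions for [hline]. *)
Lemma cholesky N : forall M lam, 0 < lam ->
  (forall i j, (i < N)%nat -> (j < N)%nat -> M i j = M j i) ->
  (forall xi, lam * sumR N (fun i => xi i ^ 2) <= quadf N M xi) ->
  exists L : nat -> nat -> R, (forall k i, (N <= i)%nat -> L k i = 0) /\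
    forall i j, (i < N)%nat -> (j < N)%nat -> M i j = sumR N (fun k => L k i * L k j).
Proof.
  induction N as [|N IH]; intros M lam Hlam Hsym Hpos.
  { exists (fun _ _ => 0). split; [auto|]. intros; lia. }
  set (p := M N N).
  assert (Hp : 0 < p).
  { pose proof (Hpos (fun i => if (i =? N)%nat then 1 else 0)) as H.
    rewrite quadf_S in H by (intros; apply Hsym; lia). fold p in H.
    rewrite Nat.eqb_refl in H. cbn [sumR] in H. rewrite Nat.eqb_refl in H.
    assert (Z : forall i, (i < N)%nat -> (if (i =? N)%nat then 1 else 0) = 0)
      by (intros i Hi; destruct (Nat.eqb_spec i N); [lia|auto]).
    rewrite (sumR_zero N (fun i => (if (i =? N)%nat then 1 else 0) ^ 2)) in H
      by (intros i Hi; rewrite Z by auto; ring).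
    rewrite (sumR_zero N (fun i => M i N * _)) in H by (intros i Hi; rewrite Z by auto; ring).
    unfold quadf in H. rewrite (sumR_zero N) in H by (intros i Hi; rewrite Z by auto; ring). lra. }
  destruct (IH (fun i j => M i j - M i N * M j N / p) lam Hlam) as [L [HL0 HL]].
  { intros i j Hi Hj. rewrite (Hsym i j) by lia. unfold Rdiv. ring. }
  (* [xi'] extends xi by the value that minimises the form in its last variable; the minimum is the
     form of the Schur complement. *)
  { intros xi. set (beta := sumR N (fun i => M i N * xi i)).
    set (xi' := fun i => if (i =? N)%nat then - beta / p else xi i).
    assert (Z : forall i, (i < N)%nat -> xi' i = xi i)
      by (intros i Hi; unfold xi'; destruct (Nat.eqb_spec i N); [lia|auto]).
    assert (ZN : xi' N = - beta / p) by (unfold xi'; now rewrite Nat.eqb_refl).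
    pose proof (Hpos xi') as H. rewrite quadf_S in H by (intros; apply Hsym; lia).
    cbn [sumR] in H. rewrite ZN in H. fold p in H.
    rewrite (quadf_ext N M M xi' xi) in H by auto.
    rewrite (sumR_ext N (fun i => M i N * xi' i) (fun i => M i N * xi i)) in H
      by (intros; rewrite Z; auto). fold beta in H.
    rewrite (sumR_ext N (fun i => xi' i ^ 2) (fun i => xi i ^ 2)) in H
      by (intros; rewrite Z; auto).
    assert (E : quadf N (fun i j => M i j - M i N * M j N / p) xi = quadf N M xi - beta ^ 2 / p).
    { unfold quadf. transitivity (sumR N (fun i => xi i * sumR N (fun j => M i j * xi j)
         + (- beta / p) * (M i N * xi i))).
      - apply sumR_ext. intros i Hi.
        rewrite (sumR_ext N _ (fun j => M i j * xi j + (- M i N / p) * (M j N * xi j)))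
          by (intros; unfold Rdiv; ring).
        rewrite sumR_plus, sumR_scal. fold beta. unfold Rdiv. ring.
      - rewrite sumR_plus, sumR_scal. fold beta. unfold Rdiv. ring. }
    rewrite E.
    assert (lam * (- beta / p) ^ 2 >= 0) by (pose proof (pow2_ge_0 (- beta / p)); nra).
    replace (quadf N M xi + 2 * (- beta / p) * beta + p * (- beta / p) ^ 2)
      with (quadf N M xi - beta ^ 2 / p) in H by (field; lra).
    lra. }
  pose proof (sqrt_lt_R0 p Hp) as Hq. set (q := sqrt p) in *.
  assert (Eq : q * q = p) by (apply sqrt_sqrt; lra).
  (* The new row is the last column of M divided by the root of its pivot; the earlier rows vanish
     at index N, so they leave the last row and column of the product alone. *)
  exists (fun k i => if (k =? N)%nat then (if (i <? S N)%nat then M i N / q else 0) else L k i).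
  split.
  - intros k i Hi. destruct (k =? N)%nat; [|apply HL0; lia].
    destruct (Nat.ltb_spec i (S N)); [lia|auto].
  - intros i j Hi Hj. cbn [sumR]. rewrite Nat.eqb_refl.
    rewrite (sumR_ext N _ (fun k => L k i * L k j))
      by (intros k Hk; destruct (Nat.eqb_spec k N); [lia|auto]).
    rewrite (proj2 (Nat.ltb_lt i (S N)) Hi), (proj2 (Nat.ltb_lt j (S N)) Hj).
    replace (M i N / q * (M j N / q)) with (M i N * M j N / p) by (rewrite <- Eq; field; lra).
    destruct (Nat.eq_dec i N) as [->|Ei].
    { rewrite sumR_zero by (intros; rewrite (HL0 i N) by lia; ring).
      rewrite (Hsym N j) by lia. fold p. field; lra. }
    destruct (Nat.eq_dec j N) as [->|Ej].
    { rewrite sumR_zero by (intros k Hk; rewrite (HL0 k N) by lia; ring).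
      fold p. field; lra. }
    rewrite <- HL by lia. ring.
Qed.

Lemma matvec_plus n M x y i : matvec n M (fun j => x j + y j) i = matvec n M x i + matvec n M y i.
Proof. unfold matvec. rewrite <- sumR_plus. apply sumR_ext; intros; ring. Qed.

Lemma matvec_scal n M c x i : matvec n M (fun j => c * x j) i = c * matvec n M x i.
Proof. unfold matvec. rewrite <- sumR_scal. apply sumR_ext; intros; ring. Qed.

Definition symm (n : nat) (M : nat -> nat -> R) : Prop :=
  forall i j, (i < 2 * n)%nat -> (j < 2 * n)%nat -> M i j = M j i.

Lemma matvec_symm n M x y : symm n M -> dotR n x (matvec n M y) = dotR n (matvec n M x) y.
Proof.
  intros H. unfold dotR, matvec.
  rewrite (sumR_ext (2 * n) _ (fun i => sumR (2 * n) (fun j => x i * M i j * y j)))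
    by (intros; rewrite <- sumR_scal; apply sumR_ext; intros; ring).
  rewrite sumR_swap. apply sumR_ext. intros j Hj. rewrite <- sumR_scal_r.
  apply sumR_ext. intros i Hi. rewrite (H i j) by auto. ring.
Qed.

Lemma quadf_dot n M x : quadf (2 * n) M x = dotR n x (matvec n M x).
Proof. reflexivity. Qed.

Definition frob (n : nat) (M H : nat -> nat -> R) : R :=
  sumR (2 * n) (fun i => sumR (2 * n) (fun j => M i j * H i j)).

(** With the rows supplied by [cholesky], this turns tr(A H) into a sum of second derivatives along
    2n horizontal lines. *)
Lemma frob_rank_one n M H (L : nat -> nat -> R) :
  (forall i j, (i < 2 * n)%nat -> (j < 2 * n)%nat -> M i j = sumR (2 * n) (fun k => L k i * L k j)) ->
  frob n M H = sumR (2 * n) (fun k => quadf (2 * n) H (L k)).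
Proof.
  intros E. unfold frob.
  rewrite (sumR_ext (2 * n) (fun k => quadf (2 * n) H (L k))
    (fun k => sumR (2 * n) (fun i => sumR (2 * n) (fun j => L k i * L k j * H i j)))).
  - symmetry. rewrite sumR_swap. apply sumR_ext. intros i Hi. rewrite sumR_swap.
    apply sumR_ext. intros j Hj. rewrite E by auto. rewrite <- sumR_scal_r. reflexivity.
  - intros k _. unfold quadf. apply sumR_ext. intros i Hi. rewrite <- sumR_scal.
    apply sumR_ext. intros; ring.
Qed.

Lemma quad_rank_one n M (L : nat -> nat -> R) v :
  (forall i j, (i < 2 * n)%nat -> (j < 2 * n)%nat -> M i j = sumR (2 * n) (fun k => L k i * L k j)) ->
  sumR (2 * n) (fun k => dotR n v (L k) ^ 2) = dotR n v (matvec n M v).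
Proof.
  intros E. transitivity (frob n M (fun i j => v i * v j)).
  - rewrite (frob_rank_one n M _ L E). apply sumR_ext. intros k _. unfold quadf, dotR.
    rewrite <- Rsqr_pow2. unfold Rsqr. rewrite <- sumR_scal_r. apply sumR_ext. intros i _.
    rewrite (Rmult_comm (v i)), Rmult_assoc, <- sumR_scal. f_equal.
    apply sumR_ext; intros; ring.
  - unfold frob, dotR, matvec. apply sumR_ext. intros i _. rewrite <- sumR_scal.
    apply sumR_ext. intros; ring.
Qed.

Definition JtAJ (n : nat) (A : nat -> nat -> R) (k j : nat) : R :=
  sumR (2 * n) (fun a => sumR (2 * n) (fun b => Jm n a k * A a b * Jm n b j)).

Record sympl_spd (n : nat) (lam Lam : R) (A : nat -> nat -> R) : Prop := {
  spd_sym : symm n A;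
  spd_lo : forall x, lam * dotR n x x <= dotR n x (matvec n A x);
  spd_hi : forall x, dotR n x (matvec n A x) <= Lam * dotR n x x;
  spd_inv : forall i j, (i < 2 * n)%nat -> (j < 2 * n)%nat ->
    sumR (2 * n) (fun k => A i k * JtAJ n A k j) = if (i =? j)%nat then 1 else 0 }.

Lemma JtAJ_matvec n A x k :
  matvec n (JtAJ n A) x k = sumR (2 * n) (fun a => Jm n a k * matvec n A (Jx n x) a).
Proof.
  unfold matvec, JtAJ.
  rewrite (sumR_ext (2 * n) _ (fun j => sumR (2 * n) (fun a => Jm n a k * sumR (2 * n) (fun b => A a b * Jm n b j * x j)))).
  - rewrite sumR_swap. apply sumR_ext. intros a _. rewrite sumR_scal. f_equal.
    rewrite sumR_swap. apply sumR_ext. intros b _. unfold Jx. rewrite <- sumR_scal.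
    apply sumR_ext; intros; ring.
  - intros j _. rewrite <- sumR_scal_r. apply sumR_ext. intros a _.
    rewrite <- sumR_scal_r, <- sumR_scal. apply sumR_ext; intros; ring.
Qed.

(** Through this identity B inherits the bounds lam and Lam of A0 themselves, J being orthogonal,
    and <A0 Jx,Jx> equals <Bx,x>. *)
Lemma JtAJ_form n A x y :
  dotR n x (matvec n (JtAJ n A) y) = dotR n (Jx n x) (matvec n A (Jx n y)).
Proof.
  unfold dotR at 1.
  rewrite (sumR_ext (2 * n) _ (fun k => sumR (2 * n) (fun a => Jm n a k * x k * matvec n A (Jx n y) a))).
  - rewrite sumR_swap. apply sumR_ext. intros a _. unfold Jx at 3. rewrite sumR_scal_r. reflexivity.
  - intros k _. rewrite JtAJ_matvec, <- sumR_scal. apply sumR_ext; intros; ring.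
Qed.

(** * The inverse of a symplectic matrix, and the sign of the barrier expression under
    perturbation *)

Section SymplecticInverse.
Variables (n : nat) (lam Lam : R) (A0 : nat -> nat -> R).
Hypothesis Hlam : 0 < lam.
Hypothesis HA : sympl_spd n lam Lam A0.
Let B := JtAJ n A0.

Lemma B_symm : symm n B.
Proof.
  intros i j Hi Hj. unfold B, JtAJ. rewrite sumR_swap.
  apply sumR_ext. intros a Ha. apply sumR_ext. intros b Hb.
  rewrite (spd_sym _ _ _ _ HA a b) by auto. ring.
Qed.

Lemma A0B_id x i : (i < 2 * n)%nat -> matvec n A0 (matvec n B x) i = x i.
Proof.
  intros Hi. unfold matvec.
  rewrite (sumR_ext (2 * n) _ (fun k => sumR (2 * n) (fun j => A0 i k * B k j * x j)))
    by (intros; rewrite <- sumR_scal; apply sumR_ext; intros; ring).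
  rewrite sumR_swap.
  rewrite (sumR_ext (2 * n) _ (fun j => (if (j =? i)%nat then 1 else 0) * x j)).
  - now apply sumR_delta.
  - intros j Hj. rewrite sumR_scal_r. f_equal. unfold B.
    rewrite (spd_inv _ _ _ _ HA) by auto. now rewrite Nat.eqb_sym.
Qed.

Lemma B_lo x : lam * dotR n x x <= dotR n x (matvec n B x).
Proof. unfold B. rewrite JtAJ_form, <- (dot_Jx_Jx n x x). apply (spd_lo _ _ _ _ HA). Qed.

Lemma B_hi x : dotR n x (matvec n B x) <= Lam * dotR n x x.
Proof. unfold B. rewrite JtAJ_form, <- (dot_Jx_Jx n x x). apply (spd_hi _ _ _ _ HA). Qed.

Lemma frob_A0B : frob n A0 B = 2 * INR n.
Proof.
  unfold frob. rewrite (sumR_ext (2 * n) _ (fun _ => 1)).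
  - rewrite sumR_const, mult_INR. simpl. ring.
  - intros i Hi. pose proof (spd_inv _ _ _ _ HA i i Hi Hi) as E. rewrite Nat.eqb_refl in E.
    rewrite <- E. apply sumR_ext. intros k Hk. now rewrite B_symm.
Qed.

Lemma A0_dot_B x y : dotR n (matvec n B x) (matvec n A0 y) = dotR n x y.
Proof.
  rewrite matvec_symm by apply (spd_sym _ _ _ _ HA). apply dotR_ext; [|auto].
  intros i Hi. now apply A0B_id.
Qed.

Variables (A : nat -> nat -> R) (eps : R).
Hypothesis Heps : 0 <= eps.
Hypothesis HE : forall v, Rabs (dotR n v (matvec n A v) - dotR n v (matvec n A0 v)) <= eps * dotR n v v.

(** Here B is factorised, since A - A0 is controlled only as a quadratic form: tr((A - A0)B) is the
    sum of its values on the rows of the factor, at most eps times the sum of their squared lengths,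
    which is tr B <= 2n Lam. *)
Lemma frob_AB_le : frob n A B <= 2 * INR n + eps * (2 * INR n * Lam).
Proof.
  assert (Hsym : forall i j, (i < 2 * n)%nat -> (j < 2 * n)%nat -> B i j = B j i)
    by (intros; now apply B_symm).
  destruct (cholesky (2 * n) B lam Hlam Hsym) as [L [_ HL]].
  { intros xi. rewrite quadf_dot. eapply Rle_trans; [|apply B_lo].
    apply Rmult_le_compat_l; [lra|]. apply Req_le, sumR_ext. intros; ring. }
  assert (F : forall M, frob n M B = sumR (2 * n) (fun k => quadf (2 * n) M (L k))).
  { intros M. rewrite <- (frob_rank_one n B M L HL). apply sumR_ext. intros.
    apply sumR_ext. intros. ring. }
  assert (T : sumR (2 * n) (fun k => dotR n (L k) (L k)) <= 2 * INR n * Lam).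
  { unfold dotR at 1. rewrite sumR_swap.
    replace (2 * INR n * Lam) with (sumR (2 * n) (fun _ => Lam))
      by (rewrite sumR_const, mult_INR; simpl; ring).
    apply sumR_le. intros i Hi. rewrite <- HL by auto.
    pose proof (B_hi (fun j => if (j =? i)%nat then 1 else 0)) as H.
    unfold dotR, matvec in H. rewrite !sumR_delta in H by auto. rewrite Nat.eqb_refl in H.
    rewrite (sumR_ext _ _ (fun k => (if (k =? i)%nat then 1 else 0) * B i k)) in H by (intros; ring).
    rewrite sumR_delta in H by auto. lra. }
  pose proof frob_A0B as F0. rewrite F in F0. rewrite F, <- F0.
  apply Rle_trans with (sumR (2 * n) (fun k => quadf (2 * n) A0 (L k) + eps * dotR n (L k) (L k))).
  - apply sumR_le. intros k _. rewrite !quadf_dot. specialize (HE (L k)).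
    apply Rabs_le_inv in HE. lra.
  - rewrite sumR_plus, sumR_scal, F0. apply Rplus_le_compat_l. apply Rmult_le_compat_l; auto.
Qed.

(* For f = phi^{-alpha} with phi = q^2 + t^2, q = <Bx,x>, this is L_A f up to a positive factor; with
   A = A0 it equals 4 q phi, because alpha = (Q-1)/4 lies above the critical exponent (Q-2)/4. *)
Lemma barrier_form_nonneg alpha x t :
  alpha = (2 * INR n + 1) / 4 ->
  eps * (16 * (alpha + 1) / lam + 16 / lam + 8 * INR n * Lam) <= 4 ->
  let q := dotR n x (matvec n B x) in
  let phi := q ^ 2 + t ^ 2 in
  let eta := fun i => q * matvec n B x i + t * Jx n x i in
  0 <= 16 * (alpha + 1) * dotR n eta (matvec n A eta)
       - phi * (8 * dotR n (matvec n B x) (matvec n A (matvec n B x)) + 4 * q * frob n A B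
                + 8 * dotR n (Jx n x) (matvec n A (Jx n x))).
Proof.
  intros Ha Hsmall q phi eta.
  pose proof (HE eta) as E1. pose proof (HE (matvec n B x)) as E2. pose proof (HE (Jx n x)) as E3.
  apply Rabs_le_inv in E1. apply Rabs_le_inv in E2. apply Rabs_le_inv in E3.
  assert (Q1 : dotR n (matvec n B x) (matvec n A0 (matvec n B x)) = q)
    by (rewrite A0_dot_B; reflexivity).
  assert (Q2 : dotR n (Jx n x) (matvec n A0 (Jx n x)) = q) by (unfold q, B; now rewrite JtAJ_form).
  (* The cross term is <A0 Bx,Jx> = <x,Jx> = 0, so the gradient term is exactly q phi. *)
  assert (Q3 : dotR n eta (matvec n A0 eta) = q * phi).
  { unfold eta. set (bx := matvec n B x) in *. set (j := Jx n x) in *.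
    rewrite (dotR_ext n _ _ (fun i => q * bx i + t * j i)
      (fun i => q * matvec n A0 bx i + t * matvec n A0 j i)); auto.
    2:{ intros i Hi. now rewrite matvec_plus, !matvec_scal. }
    rewrite !dotR_plus_l, !dotR_plus_r, !dotR_scal_l, !dotR_scal_r, Q1, Q2.
    rewrite (matvec_symm n A0 j bx) by apply (spd_sym _ _ _ _ HA).
    rewrite (dotR_comm n _ bx). unfold bx at 1 2. rewrite !A0_dot_B.
    unfold j. rewrite dotR_comm, dot_Jx_self. unfold phi. ring. }
  pose proof (spd_lo _ _ _ _ HA eta) as S1. rewrite Q3 in S1.
  pose proof (spd_lo _ _ _ _ HA (matvec n B x)) as S2. rewrite Q1 in S2.
  pose proof (spd_lo _ _ _ _ HA (Jx n x)) as S3. rewrite Q2 in S3.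
  rewrite Q3 in E1. rewrite Q1 in E2. rewrite Q2 in E3.
  pose proof frob_AB_le as F.
  assert (Hq : 0 <= q).
  { pose proof (B_lo x). pose proof (dotR_self_nonneg n x). fold q in H. nra. }
  assert (Hphi : 0 <= phi) by (unfold phi; nra).
  assert (Halpha : 0 < alpha) by (pose proof (pos_INR n); lra).
  assert (D : forall a b, lam * a <= b -> a <= b / lam).
  { intros a b H. apply (Rmult_le_reg_l lam); auto. replace (lam * (b / lam)) with b by (field; lra). auto. }
  (* Ellipticity of A0 bounds |eta|^2 by q phi/lam and |Bx|^2, |Jx|^2 by q/lam. All errors thereby
     acquire the factor q of the main term. *)
  apply D in S1. apply D in S2. apply D in S3.
  assert (T1 : q * phi - eps * (q * phi / lam) <= dotR n eta (matvec n A eta)).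
  { assert (eps * dotR n eta eta <= eps * (q * phi / lam)) by (apply Rmult_le_compat_l; auto). lra. }
  assert (T2 : dotR n (matvec n B x) (matvec n A (matvec n B x)) <= q + eps * (q / lam)).
  { assert (eps * dotR n (matvec n B x) (matvec n B x) <= eps * (q / lam))
      by (apply Rmult_le_compat_l; auto). lra. }
  assert (T3 : dotR n (Jx n x) (matvec n A (Jx n x)) <= q + eps * (q / lam)).
  { assert (eps * dotR n (Jx n x) (Jx n x) <= eps * (q / lam)) by (apply Rmult_le_compat_l; auto). lra. }
  apply Rle_trans with (16 * (alpha + 1) * (q * phi - eps * (q * phi / lam)) -
    phi * (8 * (q + eps * (q / lam)) + 4 * q * (2 * INR n + eps * (2 * INR n * Lam)) + 8 * (q + eps * (q / lam)))).
  (* After factoring out q phi, the main part is 16 alpha - 8n = 4, from which the smallness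
     hypothesis subtracts at most 4. *)
  - replace (16 * (alpha + 1) * (q * phi - eps * (q * phi / lam)) -
    phi * (8 * (q + eps * (q / lam)) + 4 * q * (2 * INR n + eps * (2 * INR n * Lam)) + 8 * (q + eps * (q / lam))))
    with (q * phi * (16 * (alpha + 1) - 16 - 8 * INR n -
      eps * (16 * (alpha + 1) / lam + 16 / lam + 8 * INR n * Lam))) by (field; lra).
    apply Rmult_le_pos; [nra|]. lra.
  - assert (4 * q * frob n A B <= 4 * q * (2 * INR n + eps * (2 * INR n * Lam)))
      by (apply Rmult_le_compat_l; lra).
    assert (M1 : 16 * (alpha + 1) * (q * phi - eps * (q * phi / lam)) <=
      16 * (alpha + 1) * dotR n eta (matvec n A eta)) by (apply Rmult_le_compat_l; lra).
    match goal with |- _ - phi * ?X <= _ - phi * ?Y =>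
      assert (M2 : phi * Y <= phi * X) by (apply Rmult_le_compat_l; lra) end.
    lra.
Qed.
End SymplecticInverse.

(** * Sequential compactness *)

Definition conv (n : nat) (zs : nat -> Point) (z : Point) : Prop :=
  forall k, (k <= 2 * n)%nat -> Un_cv (fun m => coord n (zs m) k) (coord n z k).

Definition seq_cont (n : nat) (K : Point -> Prop) (f : Point -> R) : Prop :=
  forall zs z, (forall m, K (zs m)) -> K z -> conv n zs z -> Un_cv (fun m => f (zs m)) (f z).

(** Subsequences are encoded by m <= sg m: the index map tends to infinity but need not increase.
    This suffices for limits and survives composition. *)
Lemma Un_cv_subseq u l (sg : nat -> nat) :
  (forall m, (m <= sg m)%nat) -> Un_cv u l -> Un_cv (fun m => u (sg m)) l.
Proof.
  intros Hs H e He. destruct (H e He) as [N HN]. exists N. intros m Hm. apply HN.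
  specialize (Hs m). lia.
Qed.

Lemma Un_cv_const c : Un_cv (fun _ => c) c.
Proof.
  intros e He. exists 0%nat. intros. unfold Rdist. rewrite Rminus_diag, Rabs_R0. auto.
Qed.

Lemma Un_cv_sumR N (u : nat -> nat -> R) l : (forall i, (i < N)%nat -> Un_cv (fun m => u m i) (l i)) ->
  Un_cv (fun m => sumR N (u m)) (sumR N l).
Proof.
  induction N as [|N IH]; intros H; simpl; [apply Un_cv_const|].
  apply (CV_plus (fun m => sumR N (u m)) (fun m => u m N)); [apply IH; intros; apply H; lia|apply H; lia].
Qed.

Lemma Un_cv_inv_INR : Un_cv (fun m => / (INR m + 1)) 0.
Proof.
  intros e He. destruct (archimed_cor1 e He) as [N [H1 H2]]. exists N. intros m Hm.
  unfold Rdist. rewrite Rminus_0_r.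
  assert (0 < INR N) by (apply lt_0_INR; lia).
  assert (INR N <= INR m) by (apply le_INR; lia).
  rewrite Rabs_pos_eq by (left; apply Rinv_0_lt_compat; lra).
  eapply Rle_lt_trans; [|exact H1]. apply Rinv_le_contravar; lra.
Qed.

Lemma Un_cv_limit_le u l c : Un_cv u l -> (forall m, u m <= c) -> l <= c.
Proof.
  intros H Hu. destruct (Rle_or_lt l c) as [|C]; auto.
  destruct (H (l - c) ltac:(lra)) as [N HN]. specialize (HN N (le_n N)). specialize (Hu N).
  unfold Rdist in HN. apply Rabs_def2 in HN. lra.
Qed.

Lemma Un_cv_limit_ge u l c : Un_cv u l -> (forall m, c <= u m) -> c <= l.
Proof.
  intros H Hu. destruct (Rle_or_lt c l) as [|C]; auto.
  destruct (H (c - l) ltac:(lra)) as [N HN]. specialize (HN N (le_n N)). specialize (Hu N).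
  unfold Rdist in HN. apply Rabs_def2 in HN. lra.
Qed.

Lemma bounded_subseq (u : nat -> R) b : (forall m, Rabs (u m) <= b) ->
  exists (sg : nat -> nat) l, (forall m, (m <= sg m)%nat) /\ Un_cv (fun m => u (sg m)) l.
Proof.
  intros Hb.
  destruct (Bolzano_Weierstrass u (fun c => - b <= c <= b) (compact_P3 (- b) b)) as [l Hl].
  { intros m. now apply Rabs_le_inv. }

  assert (H : forall m, exists p, (m <= p)%nat /\ Rabs (u p - l) < / (INR m + 1)).
  { intros m. assert (P : 0 < / (INR m + 1)) by (apply Rinv_0_lt_compat; pose proof (pos_INR m); lra).
    destruct (Hl (disc l (mkposreal _ P)) m) as [p [H1 H2]].
    - exists (mkposreal _ P). intros x Hx. exact Hx.
    - exists p. split; auto. }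
  destruct (choice _ H) as [sg Hsg]. exists sg, l. split; [intros; apply Hsg|].
  intros e He. destruct (Un_cv_inv_INR e He) as [N HN]. exists N. intros m Hm.
  unfold Rdist. eapply Rlt_trans; [apply Hsg|].
  specialize (HN m Hm). unfold Rdist in HN. rewrite Rminus_0_r in HN. now apply Rabs_def2 in HN.
Qed.

Lemma bounded_subseq_finite N (u : nat -> nat -> R) b : (forall m k, (k < N)%nat -> Rabs (u m k) <= b) ->
  exists (sg : nat -> nat) (l : nat -> R), (forall m, (m <= sg m)%nat) /\
    forall k, (k < N)%nat -> Un_cv (fun m => u (sg m) k) (l k).
Proof.
  induction N as [|N IH]; intros Hb.
  - exists (fun m => m), (fun _ => 0). split; [auto|intros; lia].
  - destruct IH as [sg [l [H1 H2]]]; [intros; apply Hb; lia|].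
    destruct (bounded_subseq (fun m => u (sg m) N) b) as [tau [a [H3 H4]]]; [intros; apply Hb; lia|].
    exists (fun m => sg (tau m)), (fun k => if (k =? N)%nat then a else l k). split.
    + intros m. specialize (H3 m). specialize (H1 (tau m)). lia.
    + intros k Hk. destruct (Nat.eqb_spec k N) as [->|E]; [exact H4|].
      apply (Un_cv_subseq (fun m => u (sg m) k)); [auto|apply H2; lia].
Qed.

Lemma coord_lo n z k : (k < 2 * n)%nat -> coord n z k = fst z k.
Proof. intros H. unfold coord. apply Nat.ltb_lt in H. now rewrite H. Qed.

Lemma coord_t n z : coord n z (2 * n) = snd z.
Proof. unfold coord. now rewrite Nat.ltb_irrefl. Qed.

Lemma point_subseq n (zs : nat -> Point) b :
  (forall m k, (k <= 2 * n)%nat -> Rabs (coord n (zs m) k) <= b) ->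
  exists (sg : nat -> nat) z, (forall m, (m <= sg m)%nat) /\ inH n z /\ conv n (fun m => zs (sg m)) z.
Proof.
  intros Hb.
  destruct (bounded_subseq_finite (S (2 * n)) (fun m k => coord n (zs m) k) b) as [sg [l [H1 H2]]].
  { intros; apply Hb; lia. }
  exists sg, (fun k => if (k <? 2 * n)%nat then l k else 0, l (2 * n)%nat).
  split; [auto|]. split.
  - intros i Hi. cbn [fst]. destruct (Nat.ltb_spec i (2 * n)); [lia|auto].
  - intros k Hk. replace (coord n _ k) with (l k); [apply H2; lia|].
    destruct (Nat.eq_dec k (2 * n)) as [->|E]; [now rewrite coord_t|].
    rewrite coord_lo by lia. cbn [fst]. destruct (Nat.ltb_spec k (2 * n)); [auto|lia].
Qed.

Lemma conv_subseq n zs z sg : (forall m, (m <= sg m)%nat) -> conv n zs z -> conv n (fun m => zs (sg m)) z.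
Proof. intros Hs H k Hk. apply (Un_cv_subseq (fun m => coord n (zs m) k)); auto. Qed.

(** Closedness is asked only of canonical limits, because [conv] does not see the coordinates from
    2n on. *)
Definition compactH (n : nat) (K : Point -> Prop) : Prop :=
  (exists b, forall z k, K z -> (k <= 2 * n)%nat -> Rabs (coord n z k) <= b) /\
  (forall zs z, (forall m, K (zs m)) -> inH n z -> conv n zs z -> K z).

Lemma compact_subseq n K zs : compactH n K -> (forall m, K (zs m)) ->
  exists (sg : nat -> nat) z, (forall m, (m <= sg m)%nat) /\ K z /\ conv n (fun m => zs (sg m)) z.
Proof.
  intros [[b Hb] Hc] Hz. destruct (point_subseq n zs b) as [sg [z [H1 [H2 H3]]]]; [auto|].
  exists sg, z. repeat split; auto. apply (Hc (fun m => zs (sg m))); auto.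
Qed.

Lemma min_attained n K F z0 : compactH n K -> seq_cont n K F -> K z0 ->
  exists z, K z /\ forall w, K w -> F z <= F w.
Proof.
  intros HK HF Hz0.
  destruct (classic (exists b, forall z, K z -> b <= F z)) as [[b Hb]|Hn].
  - destruct (completeness (fun y => exists z, K z /\ y = - F z)) as [l [Hl1 Hl2]].
    { exists (- b). intros y [z [Hz ->]]. specialize (Hb z Hz). lra. }
    { exists (- F z0), z0. auto. }
    assert (H : forall m : nat, exists z, K z /\ - l <= F z <= - l + / (INR m + 1)).
    { intros m. assert (P : 0 < / (INR m + 1)) by (apply Rinv_0_lt_compat; pose proof (pos_INR m); lra).
      apply NNPP. intros C. assert (l <= l - / (INR m + 1)); [|lra].
      apply Hl2. intros y [z [Hz ->]]. destruct (Rle_or_lt (- F z) (l - / (INR m + 1))); auto.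
      exfalso. apply C. exists z. split; auto. split; [|lra].
      assert (- F z <= l) by (apply Hl1; exists z; auto). lra. }
    destruct (choice _ H) as [zs Hzs].
    destruct (compact_subseq n K zs HK) as [sg [z [H1 [H2 H3]]]]; [intros; apply Hzs|].
    exists z. split; auto. intros w Hw.
    assert (F z <= - l); [|assert (- F w <= l) by (apply Hl1; exists w; auto); lra].
    assert (C1 : Un_cv (fun m => F (zs (sg m))) (F z)) by (apply HF; auto; intros; apply Hzs).
    assert (C2 : Un_cv (fun m => F (zs (sg m)) - / (INR (sg m) + 1)) (F z - 0)).
    { apply CV_minus; auto. apply (Un_cv_subseq (fun m => / (INR m + 1))); auto. apply Un_cv_inv_INR. }
    rewrite Rminus_0_r in C2. apply (Un_cv_limit_le _ _ _ C2). intros m. destruct (Hzs (sg m)). lra.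
  - assert (H : forall m : nat, exists z, K z /\ F z < - INR m).
    { intros m. apply NNPP. intros C. apply Hn. exists (- INR m). intros z Hz.
      destruct (Rle_or_lt (- INR m) (F z)); auto. exfalso. apply C. eauto. }
    destruct (choice _ H) as [zs Hzs].
    destruct (compact_subseq n K zs HK) as [sg [z [H1 [H2 H3]]]]; [intros; apply Hzs|].
    assert (C1 : Un_cv (fun m => F (zs (sg m))) (F z)) by (apply HF; auto; intros; apply Hzs).
    destruct (C1 1 ltac:(lra)) as [N HN]. destruct (INR_unbounded (Rabs (F z) + 1)) as [M HM].
    specialize (HN (max N M) ltac:(lia)). unfold Rdist in HN. apply Rabs_def2 in HN.
    destruct (Hzs (sg (max N M))) as [_ H4]. specialize (H1 (max N M)).
    assert (INR M <= INR (sg (max N M))) by (apply le_INR; lia).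
    pose proof (Rle_abs (- F z)) as A. rewrite Rabs_Ropp in A. lra.
Qed.

Lemma max_attained n K F z0 : compactH n K -> seq_cont n K F -> K z0 ->
  exists z, K z /\ forall w, K w -> F w <= F z.
Proof.
  intros HK HF Hz0. destruct (min_attained n K (fun z => - F z) z0) as [z [H1 H2]]; auto.
  - intros zs z H1 H2 H3. apply (CV_opp (fun m => F (zs m))). now apply HF.
  - exists z. split; auto. intros w Hw. specialize (H2 w Hw). lra.
Qed.

Lemma seq_cont_const n K c : seq_cont n K (fun _ => c).
Proof. intros zs z _ _ _. apply Un_cv_const. Qed.

Lemma seq_cont_plus n K f g : seq_cont n K f -> seq_cont n K g -> seq_cont n K (fun z => f z + g z).
Proof. intros H1 H2 zs z Hz Hz' C. apply (CV_plus (fun m => f (zs m)) (fun m => g (zs m))); auto. Qed.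

Lemma seq_cont_mult n K f g : seq_cont n K f -> seq_cont n K g -> seq_cont n K (fun z => f z * g z).
Proof. intros H1 H2 zs z Hz Hz' C. apply (CV_mult (fun m => f (zs m)) (fun m => g (zs m))); auto. Qed.

Lemma seq_cont_minus n K f g : seq_cont n K f -> seq_cont n K g -> seq_cont n K (fun z => f z - g z).
Proof. intros H1 H2 zs z Hz Hz' C. apply (CV_minus (fun m => f (zs m)) (fun m => g (zs m))); auto. Qed.

Lemma seq_cont_pow n K f k : seq_cont n K f -> seq_cont n K (fun z => f z ^ k).
Proof.
  intros H. induction k as [|k IH]; simpl; [apply seq_cont_const|now apply seq_cont_mult].
Qed.

Lemma seq_cont_sumR n K N (f : nat -> Point -> R) : (forall i, (i < N)%nat -> seq_cont n K (f i)) ->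
  seq_cont n K (fun z => sumR N (fun i => f i z)).
Proof.
  intros H zs z Hz Hz' C. apply (Un_cv_sumR N (fun m i => f i (zs m))). intros i Hi. now apply H.
Qed.

Lemma seq_cont_x n K i : (i < 2 * n)%nat -> seq_cont n K (fun z => fst z i).
Proof.
  intros Hi zs z Hz Hz' C. specialize (C i ltac:(lia)). rewrite coord_lo in C by auto.
  intros e He. destruct (C e He) as [N HN]. exists N. intros m Hm. specialize (HN m Hm).
  now rewrite coord_lo in HN.
Qed.

Lemma seq_cont_t n K : seq_cont n K (fun z => snd z).
Proof.
  intros zs z Hz Hz' C. specialize (C (2 * n)%nat (le_n _)). rewrite coord_t in C.
  intros e He. destruct (C e He) as [N HN]. exists N. intros m Hm. specialize (HN m Hm).
  now rewrite coord_t in HN.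
Qed.

Lemma seq_cont_comp n K (g : R -> R) f : seq_cont n K f -> (forall z, K z -> continuity_pt g (f z)) ->
  seq_cont n K (fun z => g (f z)).
Proof.
  intros H Hg zs z Hz Hz' C. apply (continuity_seq g (fun m => f (zs m))); auto.
Qed.

Lemma seq_cont_ext n K f g : (forall z, K z -> f z = g z) -> seq_cont n K f -> seq_cont n K g.
Proof.
  intros E H zs z Hz Hz' C. rewrite <- E by auto. intros e He.
  destruct (H zs z Hz Hz' C e He) as [N HN]. exists N. intros m Hm. rewrite <- E by auto. auto.
Qed.

Lemma seq_cont_Jdot n K p : seq_cont n K (fun z => dotR n (Jx n p) (fst z)).
Proof.
  unfold dotR. apply seq_cont_sumR. intros i Hi.
  apply seq_cont_mult; [apply seq_cont_const|apply seq_cont_x; auto].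
Qed.

Lemma seq_cont_dH n K p : seq_cont n K (fun z => dH n p z).
Proof.
  apply seq_cont_ext with (fun z => sqrt (sqrt ((sumR (2 * n) (fun i => (fst z i - fst p i) ^ 2)) ^ 2
  + (snd z - snd p - 2 * dotR n (Jx n (fst p)) (fst z)) ^ 2))).
  - intros z _. rewrite <- dH_coord. pose proof (dH_nonneg n p z).
    replace (dH n p z ^ 4) with (Rsqr (Rsqr (dH n p z))) by (unfold Rsqr; ring).
    rewrite sqrt_Rsqr by apply Rle_0_sqr. now apply sqrt_Rsqr.
  - apply (seq_cont_comp n K sqrt).
    2:{ intros. apply continuity_pt_sqrt, sqrt_pos. }
    apply (seq_cont_comp n K sqrt).
    2:{ intros. apply continuity_pt_sqrt. apply Rplus_le_le_0_compat; apply pow2_ge_0. }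
    apply seq_cont_plus; apply seq_cont_pow.
    + apply seq_cont_sumR. intros i Hi. apply seq_cont_pow, seq_cont_minus;
      [apply seq_cont_x; auto|apply seq_cont_const].
    + apply seq_cont_minus; [apply seq_cont_minus; [apply seq_cont_t|apply seq_cont_const]|].
      apply seq_cont_mult; [apply seq_cont_const|apply seq_cont_Jdot].
Qed.

Lemma conv_euclid n zs z : conv n zs z -> Un_cv (fun m => euclid n z (zs m)) 0.
Proof.
  intros C. rewrite <- sqrt_0.
  apply (continuity_seq sqrt (fun m => sumR (2 * n) (fun i => (fst z i - fst (zs m) i) ^ 2)
     + (snd z - snd (zs m)) ^ 2)); [apply continuity_pt_sqrt; lra|].
  replace 0 with (sumR (2 * n) (fun i => (fst z i - fst z i) ^ 2) + (snd z - snd z) ^ 2)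
    by (rewrite sumR_zero; intros; ring).
  apply (seq_cont_plus n (fun _ => True)
    (fun w => sumR (2 * n) (fun i => (fst z i - fst w i) ^ 2)) (fun w => (snd z - snd w) ^ 2)); auto.
  - apply seq_cont_sumR. intros i Hi. apply seq_cont_pow, seq_cont_minus;
      [apply seq_cont_const|apply seq_cont_x; auto].
  - apply seq_cont_pow, seq_cont_minus; [apply seq_cont_const|apply seq_cont_t].
Qed.

Lemma continuous_on_seq_cont n Om K f : continuous_on n Om f -> (forall z, K z -> Om z) -> seq_cont n K f.
Proof.
  intros H HK zs z Hz Hz' C e He. destruct (H z (HK z Hz') e He) as [del [Hd Hdel]].
  destruct (conv_euclid n zs z C del Hd) as [N HN]. exists N. intros m Hm. apply Hdel; auto.
  specialize (HN m Hm). unfold Rdist in HN. rewrite Rminus_0_r in HN. now apply Rabs_def2 in HN.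
Qed.

Lemma dH_conv n zs z : conv n zs z -> Un_cv (fun m => dH n z (zs m)) 0.
Proof.
  intros C. rewrite <- (dH_refl n z). apply (seq_cont_dH n (fun _ => True) z zs z); auto.
Qed.

Lemma dH_x n z w : sumR (2 * n) (fun i => (fst w i - fst z i) ^ 2) <= dH n z w ^ 2.
Proof.
  eapply Rle_trans; [|apply dot_le_rho]. unfold hmul, hinv; simpl fst.
  apply Req_le, sumR_ext. intros; ring.
Qed.

Lemma dH_t n z w : Rabs (snd w - snd z - 2 * dotR n (Jx n (fst z)) (fst w)) <= dH n z w ^ 2.
Proof.
  eapply Rle_trans; [|apply snd_le_rho]. unfold hmul, hinv; simpl fst; simpl snd.
  rewrite Jx_opp, dotR_opp_l. apply Req_le. f_equal. ring.
Qed.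

Lemma dH_x_coord n z w i : (i < 2 * n)%nat -> Rabs (fst w i - fst z i) <= dH n z w.
Proof.
  intros Hi. apply Rsqr_incr_0_var; [|apply dH_nonneg]. rewrite <- Rsqr_abs, !Rsqr_pow2.
  eapply Rle_trans; [|apply dH_x].
  apply (sumR_term_le (2 * n) (fun i => (fst w i - fst z i) ^ 2)); auto. intros; apply pow2_ge_0.
Qed.

(** Only the t-coordinate takes an argument: in the shear 2<Jc,z>, antisymmetry replaces z by z - c,
    and Cauchy-Schwarz with the arithmetic-geometric mean bounds it by |c|^2 + r^2. *)
Lemma ball_coord_bound n c z r k : dH n c z <= r -> (k <= 2 * n)%nat ->
  Rabs (coord n z k) <= sumR (2 * n) (fun i => Rabs (fst c i)) + Rabs (snd c) + r + 2 * r ^ 2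
    + dotR n (fst c) (fst c).
Proof.
  intros Hr Hk. pose proof (dH_nonneg n c z) as Hd. pose proof (dotR_self_nonneg n (fst c)) as Hc.
  assert (Hs : 0 <= sumR (2 * n) (fun i => Rabs (fst c i))) by (apply sumR_nonneg; intros; apply Rabs_pos).
  pose proof (Rabs_pos (snd c)). assert (Hr2 : dH n c z ^ 2 <= r ^ 2) by (apply pow_incr; lra).
  destruct (Nat.eq_dec k (2 * n)) as [->|E].
  - rewrite coord_t. pose proof (dH_t n c z) as T. pose proof (dH_x n c z) as X.
    assert (D : Rabs (2 * dotR n (Jx n (fst c)) (fst z)) <= dotR n (fst c) (fst c) + r ^ 2).
    { set (y := fun i => fst z i - fst c i).
      replace (dotR n (Jx n (fst c)) (fst z)) with (dotR n (Jx n (fst c)) y).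
      2:{ rewrite <- (Rplus_0_r (dotR n (Jx n (fst c)) y)), <- (dot_Jx_self n (fst c)), <- dotR_plus_r.
          apply dotR_ext; auto. intros; unfold y; ring. }
      assert (Y : dotR n y y <= r ^ 2).
      { eapply Rle_trans; [|eapply Rle_trans; [exact X|exact Hr2]]. apply Req_le, sumR_ext. intros; unfold y; ring. }
      pose proof (CS_dot n (Jx n (fst c)) y) as P. rewrite dot_Jx_Jx in P.
      pose proof (dotR_self_nonneg n y) as Hy.
      set (p := dotR n (Jx n (fst c)) y) in *. set (a := dotR n (fst c) (fst c)) in *.
      set (b := dotR n y y) in *.
      assert (Q : (2 * p) ^ 2 <= (a + b) ^ 2) by (pose proof (pow2_ge_0 (a - b)); nra).
      assert (Rabs (2 * p) <= a + b).
      { apply Rsqr_incr_0_var; [|lra]. rewrite <- Rsqr_abs, !Rsqr_pow2. exact Q. }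
      lra. }
    apply Rabs_le_inv in D. apply Rabs_le_inv in T. pose proof (Rabs_le_inv _ _ (Rle_refl (Rabs (snd c)))).
    apply Rabs_le. lra.
  - rewrite coord_lo by lia. pose proof (dH_x_coord n c z k ltac:(lia)) as X.
    pose proof (sumR_term_le (2 * n) (fun i => Rabs (fst c i)) k) as S.
    cbv beta in S. specialize (S ltac:(intros; apply Rabs_pos) ltac:(lia)).
    apply Rabs_le_inv in X. pose proof (Rabs_le_inv _ _ (Rle_refl (Rabs (fst c k)))).
    apply Rabs_le. nra.
Qed.

Definition cball (n : nat) (c : Point) (r : R) (z : Point) : Prop := inH n z /\ dH n c z <= r.

Lemma compact_cball n c r : compactH n (cball n c r).
Proof.
  split.
  - eexists. intros z k [_ H] Hk. apply (ball_coord_bound n c z r k H Hk).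
  - intros zs z Hz Hi C. split; auto.
    apply (Un_cv_limit_le (fun m => dH n c (zs m)) _ r); [|intros; apply Hz].
    apply (seq_cont_dH n (fun _ => True)); auto.
Qed.

Lemma unif_cont n K f e : compactH n K -> seq_cont n K f -> 0 < e ->
  exists h, 0 < h /\ forall z w, K z -> K w -> dH n z w <= h -> Rabs (f z - f w) < e.
Proof.
  intros HK Hf He. apply NNPP. intros C.
  assert (H : forall m : nat, exists zw : Point * Point, K (fst zw) /\ K (snd zw) /\
    dH n (fst zw) (snd zw) <= / (INR m + 1) /\ e <= Rabs (f (fst zw) - f (snd zw))).
  { intros m. apply NNPP. intros D. apply C. exists (/ (INR m + 1)). split.
    - apply Rinv_0_lt_compat. pose proof (pos_INR m). lra.
    - intros z w Hz Hw Hd. destruct (Rle_or_lt e (Rabs (f z - f w))); auto.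
      exfalso. apply D. exists (z, w). auto. }
  destruct (choice _ H) as [zw Hzw].
  destruct (compact_subseq n K (fun m => fst (zw m)) HK) as [sg [z [S1 [Kz Cz]]]]; [intros; apply Hzw|].
  destruct (compact_subseq n K (fun m => snd (zw (sg m))) HK) as [tau [w [S2 [Kw Cw]]]]; [intros; apply Hzw|].
  set (nu := fun m => sg (tau m)).
  assert (Snu : forall m, (m <= nu m)%nat) by (intros m; unfold nu; specialize (S1 (tau m)); specialize (S2 m); lia).
  assert (Cz' : conv n (fun m => fst (zw (nu m))) z) by (apply (conv_subseq n (fun m => fst (zw (sg m)))); auto).
  assert (Cw' : conv n (fun m => snd (zw (nu m))) w) by exact Cw.
  pose proof (dH_conv n _ _ Cz') as D1. pose proof (dH_conv n _ _ Cw') as D2.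
  assert (E : dH n z w = 0).
  { apply Rle_antisym; [|apply dH_nonneg].
    pose proof (CV_plus _ _ _ _ (CV_plus _ _ _ _ D1 D2)
      (Un_cv_subseq (fun m => / (INR m + 1)) 0 nu Snu Un_cv_inv_INR)) as D3.
    replace (0 + 0 + 0) with 0 in D3 by ring.
    apply (Un_cv_limit_ge _ _ _ D3). intros m. cbv beta.
    destruct (Hzw (nu m)) as [_ [_ [H3 _]]].
    pose proof (dH_tri n z (fst (zw (nu m))) w). pose proof (dH_tri n (fst (zw (nu m))) (snd (zw (nu m))) w).
    rewrite (dH_sym n w) . lra. }
  (* Distance zero forces equality of exactly the coordinates that [conv] sees, so the second
     sequence converges to z as well and one value f z serves for both. *)
  assert (Hcw : conv n (fun m => snd (zw (nu m))) z).
  { intros k Hk. specialize (Cw' k Hk). replace (coord n z k) with (coord n w k); auto.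
    destruct (Nat.eq_dec k (2 * n)) as [->|Ek].
    - rewrite !coord_t. pose proof (dH_t n z w) as T. rewrite E in T.
      replace (0 ^ 2) with 0 in T by ring. apply Rabs_le_inv in T.
      rewrite (dotR_ext n _ (fst w) (Jx n (fst z)) (fst z)) in T; auto; [rewrite dot_Jx_self in T; lra|].
      intros i Hi. pose proof (dH_x_coord n z w i Hi) as X. rewrite E in X. apply Rabs_le_inv in X. lra.
    - rewrite !coord_lo by lia. pose proof (dH_x_coord n z w k ltac:(lia)) as X. rewrite E in X.
      apply Rabs_le_inv in X. lra. }
  pose proof (CV_minus _ _ _ _ (Hf _ z (fun m => proj1 (Hzw (nu m))) Kz Cz')
    (Hf _ z (fun m => proj1 (proj2 (Hzw (nu m)))) Kz Hcw)) as L.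
  rewrite Rminus_diag in L. destruct (L e He) as [N HN]. specialize (HN N (le_n N)).
  unfold Rdist in HN. rewrite Rminus_0_r in HN. destruct (Hzw (nu N)) as [_ [_ [_ H4]]]. lra.
Qed.

(** * Second derivatives along horizontal lines *)

(** Only a first derivative near 0 and its derivative at 0 are asked for: enough for the test at a
    minimum, and stable under linear combinations. *)
Definition der2 (g : R -> R) (l : R) : Prop :=
  exists g' del, 0 < del /\ (forall s, Rabs s < del -> derivable_pt_lim g s (g' s)) /\
    derivable_pt_lim g' 0 l.

Lemma derivable_pt_lim_ext f g x l : (forall y, f y = g y) -> derivable_pt_lim f x l -> derivable_pt_lim g x l.
Proof. intros E H. replace g with f; auto. now extensionality y. Qed.

Lemma der2_ext g h l : (forall s, g s = h s) -> der2 g l -> der2 h l.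
Proof. intros E H. replace h with g; auto. now extensionality s. Qed.

Lemma der2_plus g h l m : der2 g l -> der2 h m -> der2 (fun s => g s + h s) (l + m).
Proof.
  intros [g' [d [Hd [H1 H2]]]] [h' [e [He [H3 H4]]]].
  exists (fun s => g' s + h' s), (Rmin d e). split; [now apply Rmin_glb_lt|]. split.
  - intros s Hs. apply (derivable_pt_lim_plus g h); [apply H1|apply H3];
      eapply Rlt_le_trans; try exact Hs; [apply Rmin_l|apply Rmin_r].
  - now apply (derivable_pt_lim_plus g' h').
Qed.

Lemma der2_scal c g l : der2 g l -> der2 (fun s => c * g s) (c * l).
Proof.
  intros [g' [d [Hd [H1 H2]]]]. exists (fun s => c * g' s), d. split; auto. split.
  - intros s Hs. apply (derivable_pt_lim_scal g). auto.
  - now apply (derivable_pt_lim_scal g').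
Qed.

Lemma der2_const c : der2 (fun _ => c) 0.
Proof.
  exists (fun _ => 0), 1. split; [lra|]. split; intros; apply derivable_pt_lim_const.
Qed.

(** Difference quotients from both sides give g'(0) = 0. If l were negative, g' would be negative
    just to the right of 0, and the mean value theorem would put g below g(0). *)
Lemma der2_min g l : der2 g l -> (exists d, 0 < d /\ forall s, Rabs s < d -> g 0 <= g s) -> 0 <= l.
Proof.
  intros [g' [e [He [H1 H2]]]] [d [Hd Hm]].
  destruct (Rle_or_lt 0 l) as [|Hl]; auto. exfalso.
  assert (Z : g' 0 = 0).
  { destruct (Rtotal_order (g' 0) 0) as [C|[C|C]]; auto; exfalso.
    - destruct (H1 0 ltac:(rewrite Rabs_R0; lra) (- g' 0 / 2) ltac:(lra)) as [[r Hr] Hr'].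
      simpl in Hr'. set (s := Rmin r d / 2).
      assert (0 < Rmin r d) by (apply Rmin_glb_lt; auto).
      assert (Rmin r d <= r) by apply Rmin_l. assert (Rmin r d <= d) by apply Rmin_r.
      assert (Hs : 0 < s) by (unfold s; lra).
      specialize (Hr' s ltac:(lra) ltac:(rewrite Rabs_pos_eq; unfold s; lra)).
      rewrite Rplus_0_l in Hr'. apply Rabs_def2 in Hr'.
      specialize (Hm s ltac:(rewrite Rabs_pos_eq; unfold s; lra)).
      assert (0 <= (g s - g 0) / s) by (apply Rmult_le_pos; [lra|left; now apply Rinv_0_lt_compat]). lra.
    - destruct (H1 0 ltac:(rewrite Rabs_R0; lra) (g' 0 / 2) ltac:(lra)) as [[r Hr] Hr'].
      simpl in Hr'. set (s := Rmin r d / 2).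
      assert (0 < Rmin r d) by (apply Rmin_glb_lt; auto).
      assert (Rmin r d <= r) by apply Rmin_l. assert (Rmin r d <= d) by apply Rmin_r.
      assert (Hs : 0 < s) by (unfold s; lra).
      specialize (Hr' (- s) ltac:(lra) ltac:(rewrite Rabs_Ropp, Rabs_pos_eq; unfold s; lra)).
      rewrite Rplus_0_l in Hr'. apply Rabs_def2 in Hr'.
      specialize (Hm (- s) ltac:(rewrite Rabs_Ropp, Rabs_pos_eq; unfold s; lra)).
      assert (0 <= (g (- s) - g 0) / s) by (apply Rmult_le_pos; [lra|left; now apply Rinv_0_lt_compat]).
      replace ((g (- s) - g 0) / - s) with (- ((g (- s) - g 0) / s)) in Hr' by (field; lra). lra. }
  destruct (H2 (- l / 2) ltac:(lra)) as [[r Hr] Hr']. simpl in Hr'.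
  set (s := Rmin r (Rmin d e) / 2).
  assert (0 < Rmin r (Rmin d e)) by (repeat apply Rmin_glb_lt; auto).
  assert (Rmin r (Rmin d e) <= r) by apply Rmin_l.
  assert (Rmin r (Rmin d e) <= Rmin d e) by apply Rmin_r.
  assert (Rmin d e <= d) by apply Rmin_l. assert (Rmin d e <= e) by apply Rmin_r.
  destruct (MVT_cor2 g g' 0 s ltac:(unfold s; lra)) as [c [E Hc]].
  { intros c Hc. apply H1. rewrite Rabs_pos_eq; unfold s in *; lra. }
  specialize (Hr' c ltac:(lra) ltac:(rewrite Rabs_pos_eq; unfold s in *; lra)).
  rewrite Rplus_0_l, Z, Rminus_0_r in Hr'. apply Rabs_def2 in Hr'.
  specialize (Hm s ltac:(rewrite Rabs_pos_eq; unfold s in *; lra)).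
  assert (g' c / c < 0) by lra.
  assert (g' c < 0).
  { replace (g' c) with (g' c / c * c) by (field; lra). nra. }
  rewrite Rminus_0_r in E. assert (0 < s) by (unfold s; lra). nra.
Qed.

Lemma mvt_between f f' b : (forall h, Rabs h <= Rabs b -> derivable_pt_lim f h (f' h)) ->
  exists c, Rabs c <= Rabs b /\ f b - f 0 = f' c * b.
Proof.
  intros H. destruct (Rtotal_order b 0) as [C|[->|C]].
  - destruct (MVT_cor2 f f' b 0 C) as [c [E Hc]].
    + intros c Hc. apply H. rewrite !Rabs_left1 by lra. lra.
    + exists c. rewrite !Rabs_left1 by lra. split; [lra|]. lra.
  - exists 0. split; [lra|ring].
  - destruct (MVT_cor2 f f' 0 b C) as [c [E Hc]].
    + intros c Hc. apply H. rewrite !Rabs_pos_eq by lra. lra.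
    + exists c. rewrite !Rabs_pos_eq by lra. split; [lra|]. lra.
Qed.

Lemma shift_lo n z k h : (k < 2 * n)%nat ->
  shift n z k h = (fun i => if (i =? k)%nat then fst z i + h else fst z i, snd z).
Proof. intros H. unfold shift. apply Nat.ltb_lt in H. now rewrite H. Qed.

Lemma shift_t n z h : shift n z (2 * n) h = (fst z, snd z + h).
Proof. unfold shift. now rewrite Nat.ltb_irrefl. Qed.

Lemma shift_shift n z k h h' : (k <= 2 * n)%nat -> shift n (shift n z k h) k h' = shift n z k (h + h').
Proof.
  intros Hk. destruct (Nat.eq_dec k (2 * n)) as [->|E].
  - rewrite !shift_t. apply point_ext; simpl; intros; ring.
  - rewrite !shift_lo by lia. apply point_ext; simpl; [|reflexivity]. intros i.
    destruct (i =? k)%nat; ring.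
Qed.

Lemma shift_inH n z k h : inH n z -> inH n (shift n z k h).
Proof.
  intros H i Hi. unfold shift. destruct (Nat.ltb_spec k (2 * n)); cbn [fst]; [|auto].
  destruct (Nat.eqb_spec i k); [lia|auto].
Qed.

(** The point z with its first k coordinates displaced by s e. Consecutive points differ by one
    coordinate shift, so the increment of f telescopes into one-variable increments. *)
Definition partly_moved (n : nat) (z : Point) (e : nat -> R) (k : nat) (s : R) : Point :=
  (fun i => if (i <? 2 * n)%nat then (if (i <? k)%nat then fst z i + s * e i else fst z i) else fst z i,
   if (2 * n <? k)%nat then snd z + s * e (2 * n)%nat else snd z).

Lemma partly_moved_S n z e k s : (k <= 2 * n)%nat ->
  partly_moved n z e (S k) s = shift n (partly_moved n z e k s) k (s * e k).
Proof.
  intros Hk. destruct (Nat.eq_dec k (2 * n)) as [->|E].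
  - rewrite shift_t. apply point_ext; unfold partly_moved; cbn [fst snd].
    + intros i. destruct (Nat.ltb_spec i (2 * n)); auto. destruct (Nat.ltb_spec i (S (2 * n))); [auto|lia].
    + rewrite Nat.ltb_irrefl. destruct (Nat.ltb_spec (2 * n) (S (2 * n))); [auto|lia].
  - rewrite shift_lo by lia. apply point_ext; unfold partly_moved; cbn [fst snd].
    + intros i. destruct (Nat.ltb_spec i (2 * n)); destruct (Nat.ltb_spec i (S k));
        destruct (Nat.ltb_spec i k); destruct (Nat.eqb_spec i k); subst; try lia; auto.
    + destruct (Nat.ltb_spec (2 * n) (S k)); destruct (Nat.ltb_spec (2 * n) k); auto; lia.
Qed.

Lemma partly_moved_0 n z e s : partly_moved n z e 0 s = z.
Proof.
  apply point_ext; unfold partly_moved; cbn [fst snd]; auto.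
  intros i. destruct (i <? 2 * n)%nat; auto.
Qed.

Lemma partly_moved_inH n z e k s : inH n z -> inH n (partly_moved n z e k s).
Proof.
  intros H i Hi. unfold partly_moved; cbn [fst]. destruct (Nat.ltb_spec i (2 * n)); [lia|auto].
Qed.

Lemma partly_moved_euclid n z e k s h : (k <= 2 * n)%nat -> Rabs h <= Rabs (s * e k) ->
  euclid n z (shift n (partly_moved n z e k s) k h) <=
    Rabs s * sqrt (sumR (S (2 * n)) (fun i => e i ^ 2)).
Proof.
  intros Hk Hh. rewrite <- sqrt_Rsqr_abs, <- sqrt_mult_alt by apply Rle_0_sqr.
  unfold euclid. apply sqrt_le_1_alt. rewrite <- sumR_scal. cbn [sumR].
  assert (H2 : h ^ 2 <= Rsqr s * e k ^ 2).
  { replace (Rsqr s * e k ^ 2) with (Rsqr (s * e k)) by (unfold Rsqr; ring).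
    rewrite <- Rsqr_pow2, Rsqr_abs, (Rsqr_abs (s * e k)). apply Rsqr_incr_1; auto; apply Rabs_pos. }
  assert (P : forall i, 0 <= Rsqr s * e i ^ 2)
    by (intros i; apply Rmult_le_pos; [apply Rle_0_sqr|apply pow2_ge_0]).
  apply Rplus_le_compat.
  - apply sumR_le. intros i Hi. destruct (Nat.eq_dec k (2 * n)) as [->|E].
    + rewrite shift_t. unfold partly_moved; cbn [fst].
      destruct (Nat.ltb_spec i (2 * n)); [|lia].
      unfold Rsqr. apply Req_le. ring.
    + rewrite shift_lo by lia. unfold partly_moved; cbn [fst].
      destruct (Nat.ltb_spec i (2 * n)); [|lia].
      destruct (Nat.ltb_spec i k); destruct (Nat.eqb_spec i k); subst; try lia.
      * unfold Rsqr. apply Req_le. ring.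
      * replace (fst z k - (fst z k + h)) with (- h) by ring. replace ((- h) ^ 2) with (h ^ 2) by ring. auto.
      * rewrite Rminus_diag. specialize (P i). lra.
  - destruct (Nat.eq_dec k (2 * n)) as [->|E].
    + rewrite shift_t. unfold partly_moved; cbn [snd]. rewrite Nat.ltb_irrefl.
      replace (snd z - (snd z + h)) with (- h) by ring. replace ((- h) ^ 2) with (h ^ 2) by ring. auto.
    + rewrite shift_lo by lia. unfold partly_moved; cbn [snd].
      destruct (Nat.ltb_spec (2 * n) k); [lia|]. rewrite Rminus_diag. specialize (P (2 * n)%nat). lra.
Qed.

Section ChainRule.
Variables (n : nat) (Om : Point -> Prop) (f : Point -> R) (Df : nat -> Point -> R).
Hypothesis HOm : open_H n Om.
Hypothesis Hpart : forall z, Om z -> forall k, (k <= 2 * n)%nat -> partial_is n f z k (Df k z).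
Hypothesis Hcont : forall k, (k <= 2 * n)%nat -> continuous_on n Om (Df k).

Lemma derivable_shift p k h : (k <= 2 * n)%nat -> Om (shift n p k h) ->
  derivable_pt_lim (fun h => f (shift n p k h)) h (Df k (shift n p k h)).
Proof.
  intros Hk HO. pose proof (Hpart _ HO k Hk) as H. intros e He. destruct (H e He) as [d Hd].
  exists d. intros t Ht Htd. specialize (Hd t Ht Htd). cbv beta in Hd.
  rewrite !shift_shift in Hd by auto. now rewrite Rplus_0_r, Rplus_0_l in Hd.
Qed.

(** Differentiability from continuous partials: each new coordinate contributes a mean value [Df k]
    at a point within |s||e| of z, hence close to [Df k z]. *)
Lemma chain_approx z e : Om z -> forall k, (k <= S (2 * n))%nat -> forall eps, 0 < eps ->
  exists d, 0 < d /\ forall s, Rabs s < d ->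
    Rabs (f (partly_moved n z e k s) - f z - s * sumR k (fun l => e l * Df l z)) <= eps * Rabs s.
Proof.
  intros Hz. induction k as [|k IH]; intros Hk eps He.
  - exists 1. split; [lra|]. intros s _. rewrite partly_moved_0. cbn [sumR].
    replace (f z - f z - s * 0) with 0 by ring. rewrite Rabs_R0.
    apply Rmult_le_pos; [lra|apply Rabs_pos].
  - destruct (IH ltac:(lia) (eps / 2) ltac:(lra)) as [d1 [Hd1 H1]].
    destruct HOm as [HinH Hop]. destruct (Hop z Hz) as [d2 [Hd2 H2]].
    (* The added 1 keeps the quotient defined when e k = 0. *)
    set (c := eps / 2 / (Rabs (e k) + 1)).
    pose proof (Rabs_pos (e k)) as Pe.
    assert (Hc : 0 < c) by (apply Rdiv_lt_0_compat; lra).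
    destruct (Hcont k ltac:(lia) z Hz c Hc) as [d3 [Hd3 H3]].
    set (E := sqrt (sumR (S (2 * n)) (fun i => e i ^ 2))).
    assert (HE : 0 <= E) by apply sqrt_pos.
    set (d4 := Rmin d2 d3 / (E + 1)).
    assert (Hd4 : 0 < d4) by (apply Rdiv_lt_0_compat; [now apply Rmin_glb_lt|lra]).
    exists (Rmin d1 d4). split; [now apply Rmin_glb_lt|]. intros s Hs.
    assert (Hs1 : Rabs s < d1) by (eapply Rlt_le_trans; [exact Hs|apply Rmin_l]).
    assert (Hs4 : Rabs s < d4) by (eapply Rlt_le_trans; [exact Hs|apply Rmin_r]).
    assert (Hdist : forall h, Rabs h <= Rabs (s * e k) ->
      euclid n z (shift n (partly_moved n z e k s) k h) < Rmin d2 d3).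
    { intros h Hh. eapply Rle_lt_trans; [apply partly_moved_euclid; [lia|auto]|]. fold E.
      apply Rle_lt_trans with (Rabs s * (E + 1)); [pose proof (Rabs_pos s); nra|].
      replace (Rmin d2 d3) with (d4 * (E + 1)) by (unfold d4; field; lra).
      apply Rmult_lt_compat_r; lra. }
    assert (HO : forall h, Rabs h <= Rabs (s * e k) -> Om (shift n (partly_moved n z e k s) k h)).
    { intros h Hh. apply H2; [apply shift_inH, partly_moved_inH, HinH; auto|].
      eapply Rlt_le_trans; [apply Hdist; auto|apply Rmin_l]. }
    destruct (mvt_between (fun h => f (shift n (partly_moved n z e k s) k h))
      (fun h => Df k (shift n (partly_moved n z e k s) k h)) (s * e k)) as [h [Hh Eh]].
    { intros h Hh. apply derivable_shift; [lia|auto]. }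
    cbv beta in Eh. rewrite <- partly_moved_S in Eh by lia.
    assert (E0 : shift n (partly_moved n z e k s) k 0 = partly_moved n z e k s).
    { destruct (Nat.eq_dec k (2 * n)) as [->|Ek].
      - rewrite shift_t. apply point_ext; cbn [fst snd]; intros; auto; ring.
      - rewrite shift_lo by lia. apply point_ext; cbn [fst snd]; auto.
        intros i. destruct (i =? k)%nat; ring. }
    rewrite E0 in Eh.
    assert (HD : Rabs (Df k (shift n (partly_moved n z e k s) k h) - Df k z) < c).
    { apply H3; auto. eapply Rlt_le_trans; [apply Hdist; auto|apply Rmin_r]. }
    set (D := Df k (shift n (partly_moved n z e k s) k h)) in *.
    specialize (H1 s Hs1). cbn [sumR].
    replace (f (partly_moved n z e (S k) s) - f z - s * (sumR k (fun l => e l * Df l z) + e k * Df k z))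
      with ((f (partly_moved n z e k s) - f z - s * sumR k (fun l => e l * Df l z))
        + (D - Df k z) * (s * e k)) by lra.
    eapply Rle_trans; [apply Rabs_triang|]. rewrite !Rabs_mult.
    assert (Rabs (D - Df k z) * (Rabs s * Rabs (e k)) <= c * (Rabs s * (Rabs (e k) + 1))).
    { apply Rmult_le_compat; try apply Rabs_pos; try lra.
      - apply Rmult_le_pos; apply Rabs_pos.
      - pose proof (Rabs_pos s). nra. }
    replace (c * (Rabs s * (Rabs (e k) + 1))) with (eps / 2 * Rabs s) in H by (unfold c; field; lra).
    lra.
Qed.

Lemma derivable_hline z xi : Om z -> (forall i, (2 * n <= i)%nat -> xi i = 0) ->
  derivable_pt_lim (fun s => f (hline n z xi s)) 0
    (sumR (2 * n) (fun k => xi k * Df k z) + 2 * dotR n (Jx n (fst z)) xi * Df (2 * n)%nat z).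
Proof.
  intros Hz Hxi.
  set (e := fun k => if (k <? 2 * n)%nat then xi k else 2 * dotR n (Jx n (fst z)) xi).
  assert (Ep : forall s, hline n z xi s = partly_moved n z e (S (2 * n)) s).
  { intros s. rewrite hline_eq. apply point_ext; unfold partly_moved, e; cbn [fst snd].
    - intros i. destruct (Nat.ltb_spec i (2 * n)).
      + destruct (Nat.ltb_spec i (S (2 * n))); [auto|lia].
      + rewrite Hxi by auto. ring.
    - destruct (Nat.ltb_spec (2 * n) (S (2 * n))); [|lia]. now rewrite Nat.ltb_irrefl. }
  replace (sumR (2 * n) (fun k => xi k * Df k z) + 2 * dotR n (Jx n (fst z)) xi * Df (2 * n)%nat z)
    with (sumR (S (2 * n)) (fun l => e l * Df l z)).
  2:{ cbn [sumR]. unfold e at 2. rewrite Nat.ltb_irrefl. f_equal. apply sumR_ext.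
      intros i Hi. unfold e. destruct (Nat.ltb_spec i (2 * n)); [auto|lia]. }
  intros eps He. destruct (chain_approx z e Hz (S (2 * n)) (le_n _) (eps / 2) ltac:(lra)) as [d [Hd H]].
  exists (mkposreal d Hd). intros h Hh Hhd. simpl in Hhd. specialize (H h Hhd).
  rewrite Rplus_0_l, hline_0, Ep.
  set (L := sumR _ _) in *.
  replace ((f (partly_moved n z e (S (2 * n)) h) - f z) / h - L)
    with ((f (partly_moved n z e (S (2 * n)) h) - f z - h * L) / h) by (field; auto).
  unfold Rdiv. rewrite Rabs_mult, Rabs_inv.
  pose proof (Rabs_pos_lt h Hh) as Ph.
  apply Rle_lt_trans with (eps / 2 * Rabs h * / Rabs h).
  - apply Rmult_le_compat_r; auto. left. now apply Rinv_0_lt_compat.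
  - field_simplify; lra.
Qed.

(** The vertical speed 2<Jx,xi> is constant along the line, since <J xi,xi> = 0; the derivative at s
    is therefore the one at 0 for the line restarted at its point of parameter s. *)
Lemma derivable_hline_at z xi s : Om (hline n z xi s) -> (forall i, (2 * n <= i)%nat -> xi i = 0) ->
  derivable_pt_lim (fun s => f (hline n z xi s)) s
    (sumR (2 * n) (fun k => xi k * Df k (hline n z xi s))
     + 2 * dotR n (Jx n (fst z)) xi * Df (2 * n)%nat (hline n z xi s)).
Proof.
  intros Hz Hxi. pose proof (derivable_hline _ xi Hz Hxi) as H.
  replace (dotR n (Jx n (fst (hline n z xi s))) xi) with (dotR n (Jx n (fst z)) xi) in H.
  2:{ rewrite hline_eq. cbn [fst]. rewrite Jx_plus, dotR_plus_l, Jx_scal, dotR_scal_l, dot_Jx_self. ring. }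
  intros e He. destruct (H e He) as [d Hd]. exists d. intros h Hh Hhd. specialize (Hd h Hh Hhd).
  cbv beta in Hd. rewrite Rplus_0_l, hline_0, <- hline_add in Hd. exact Hd.
Qed.
End ChainRule.

Lemma derivable_sumR N (g : nat -> R -> R) l x : (forall i, (i < N)%nat -> derivable_pt_lim (g i) x (l i)) ->
  derivable_pt_lim (fun s => sumR N (fun i => g i s)) x (sumR N l).
Proof.
  induction N as [|N IH]; intros H; cbn [sumR]; [apply derivable_pt_lim_const|].
  apply (derivable_pt_lim_plus (fun s => sumR N (fun i => g i s)) (g N)); [apply IH; intros; apply H; lia|apply H; lia].
Qed.

Lemma hline_small n Om z xi : open_H n Om -> Om z -> (forall i, (2 * n <= i)%nat -> xi i = 0) ->
  exists d, 0 < d /\ forall s, Rabs s < d -> Om (hline n z xi s).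
Proof.
  intros [HinH Hop] Hz Hxi. destruct (Hop z Hz) as [r [Hr H]].
  set (b := sumR (2 * n) (fun i => xi i ^ 2) + (2 * dotR n (Jx n (fst z)) xi) ^ 2).
  assert (Hb : 0 <= b).
  { apply Rplus_le_le_0_compat; [apply sumR_nonneg; intros|]; apply pow2_ge_0. }
  assert (Hq : 0 <= sqrt b) by apply sqrt_pos.
  exists (r / (sqrt b + 1)). split; [apply Rdiv_lt_0_compat; lra|]. intros s Hs.
  apply H; [apply hline_inH; auto|].
  replace (euclid n z (hline n z xi s)) with (Rabs s * sqrt b).
  - apply Rle_lt_trans with (Rabs s * (sqrt b + 1)); [pose proof (Rabs_pos s); nra|].
    apply (Rmult_lt_compat_r (sqrt b + 1)) in Hs; [|lra].
    replace (r / (sqrt b + 1) * (sqrt b + 1)) with r in Hs by (field; lra). auto.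
  - rewrite <- sqrt_Rsqr_abs, <- sqrt_mult_alt by apply Rle_0_sqr. unfold euclid. f_equal.
    rewrite hline_eq. cbn [fst snd]. unfold b. rewrite Rmult_plus_distr_l, <- sumR_scal.
    f_equal; [apply sumR_ext; intros; unfold Rsqr; ring|unfold Rsqr; ring].
Qed.

(** [P] is specified only as the partials of X_j u; uniqueness of derivatives and the product rule
    express it by [D2u] and [Du]. The middle term differentiates the coefficient (Jx)_j, which is
    constant in t. *)
Lemma XDeriv_formula n Om u Du D2u P z j k : C2_on n Om u Du D2u -> XDeriv_on n Om Du P ->
  Om z -> (j < 2 * n)%nat -> (k <= 2 * n)%nat ->
  P j k z = D2u j k z + 2 * (if (k <? 2 * n)%nat then Jm n j k else 0) * Du (2 * n)%nat z
            + 2 * Jx n (fst z) j * D2u (2 * n)%nat k z.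
Proof.
  intros [_ [H2 _]] HP Hz Hj Hk. apply (uniqueness_limite _ _ _ _ (HP z Hz j k Hj Hk)).
  set (m := if (k <? 2 * n)%nat then Jm n j k else 0).
  apply (derivable_pt_lim_ext (fun h => Du j (shift n z k h) +
    (2 * Jx n (fst z) j + 2 * m * h) * Du (2 * n)%nat (shift n z k h))).
  { intros h. unfold Xop. f_equal. f_equal. unfold m.
    destruct (Nat.ltb_spec k (2 * n)) as [C|C].
    - rewrite shift_lo by auto. cbn [fst]. unfold Jx.
      rewrite (sumR_ext (2 * n) (fun k0 => Jm n j k0 * (if (k0 =? k)%nat then fst z k0 + h else fst z k0))
        (fun i => Jm n j i * fst z i + (if (i =? k)%nat then 1 else 0) * (h * Jm n j i))).
      + rewrite sumR_plus, sumR_delta by auto. ring.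
      + intros i _. destruct (i =? k)%nat; ring.
    - replace k with (2 * n)%nat by lia. rewrite shift_t. cbn [fst]. ring. }
  assert (E0 : shift n z k 0 = z).
  { destruct (Nat.eq_dec k (2 * n)) as [->|Ek].
    - rewrite shift_t. apply point_ext; cbn [fst snd]; intros; auto; ring.
    - rewrite shift_lo by lia. apply point_ext; cbn [fst snd]; auto.
      intros i. destruct (i =? k)%nat; ring. }
  replace (D2u j k z + 2 * m * Du (2 * n)%nat z + 2 * Jx n (fst z) j * D2u (2 * n)%nat k z)
    with (D2u j k z + ((2 * m) * Du (2 * n)%nat (shift n z k 0) +
      (2 * Jx n (fst z) j + 2 * m * 0) * D2u (2 * n)%nat k z)) by (rewrite E0; ring).
  apply (derivable_pt_lim_plus (fun h => Du j (shift n z k h))); [apply H2; auto; lia|].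
  apply (derivable_pt_lim_mult (fun h => 2 * Jx n (fst z) j + 2 * m * h)
    (fun h => Du (2 * n)%nat (shift n z k h))); [|apply H2; auto].
  pose proof (derivable_pt_lim_plus (fun _ => 2 * Jx n (fst z) j) (fun h => 2 * m * h) 0 0 (2 * m * 1)
    (derivable_pt_lim_const _ _) (derivable_pt_lim_scal (fun h => h) _ _ _ (derivable_pt_lim_id 0))) as Q.
  rewrite Rplus_0_l, Rmult_1_r in Q. exact Q.
Qed.

Definition symXX (n : nat) (P : nat -> nat -> Point -> R) (z : Point) (i j : nat) : R :=
  (XXu n P j i z + XXu n P i j z) / 2.

(** Link between the operator and the lines: differentiating twice along [hline] gives the quadratic
    form of the X_i X_j u, from which only its symmetric part matters. *)
Lemma C2_der2_hline n Om u Du D2u P z xi : open_H n Om -> C2_on n Om u Du D2u -> XDeriv_on n Om Du P ->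
  Om z -> (forall i, (2 * n <= i)%nat -> xi i = 0) ->
  der2 (fun s => u (hline n z xi s)) (quadf (2 * n) (symXX n P z) xi).
Proof.
  intros HOm HC HP Hz Hxi. pose proof HC as [H1 [H2 [_ [H3 H4]]]].
  destruct (hline_small n Om z xi HOm Hz Hxi) as [d [Hd Hline]].
  set (T := 2 * dotR n (Jx n (fst z)) xi).
  exists (fun s => sumR (2 * n) (fun k => xi k * Du k (hline n z xi s)) + T * Du (2 * n)%nat (hline n z xi s)), d.
  split; auto. split.
  { intros s Hs. apply (derivable_hline_at n Om); auto. }
  assert (HD : forall k, (k <= 2 * n)%nat -> derivable_pt_lim (fun s => Du k (hline n z xi s)) 0
    (sumR (2 * n) (fun l => xi l * D2u k l z) + T * D2u k (2 * n)%nat z)).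
  { intros k Hk. apply (derivable_hline n Om (Du k) (D2u k)); auto. }
  replace (quadf (2 * n) (symXX n P z) xi) with
    (sumR (2 * n) (fun k => xi k * (sumR (2 * n) (fun l => xi l * D2u k l z) + T * D2u k (2 * n)%nat z))
     + T * (sumR (2 * n) (fun l => xi l * D2u (2 * n)%nat l z) + T * D2u (2 * n)%nat (2 * n)%nat z)).
  { apply (derivable_pt_lim_plus (fun s => sumR (2 * n) (fun k => xi k * Du k (hline n z xi s)))
      (fun s => T * Du (2 * n)%nat (hline n z xi s))).
    - apply (derivable_sumR (2 * n) (fun k s => xi k * Du k (hline n z xi s))). intros i Hi.
      apply (derivable_pt_lim_scal (fun s => Du i (hline n z xi s))). apply HD; lia.
    - apply (derivable_pt_lim_scal (fun s => Du (2 * n)%nat (hline n z xi s))). apply HD; lia. }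
  transitivity (sumR (2 * n) (fun i => sumR (2 * n) (fun j => xi i * xi j * XXu n P j i z))).
  2:{ unfold quadf, symXX.
      rewrite (sumR_ext (2 * n) (fun i => xi i * sumR _ _) (fun i =>
        / 2 * sumR (2 * n) (fun j => xi i * xi j * XXu n P j i z) +
        / 2 * sumR (2 * n) (fun j => xi j * xi i * XXu n P i j z))).
      - rewrite sumR_plus, !sumR_scal.
        rewrite (sumR_swap (2 * n) (2 * n) (fun i j => xi j * xi i * XXu n P i j z)). field.
      - intros i _. rewrite <- !sumR_scal, <- sumR_plus. apply sumR_ext. intros j _. field. }
  set (tt := D2u (2 * n)%nat (2 * n)%nat z). set (d0 := Du (2 * n)%nat z).
  rewrite (sumR_ext (2 * n) (fun i => sumR (2 * n) (fun j => xi i * xi j * XXu n P j i z))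
   (fun i => xi i * sumR (2 * n) (fun l => xi l * D2u i l z)
     + 2 * d0 * (xi i * Jx n xi i)
     + 2 * (Jx n (fst z) i * xi i) * sumR (2 * n) (fun l => xi l * D2u (2 * n)%nat l z)
     + xi i * D2u i (2 * n)%nat z * T + (Jx n (fst z) i * xi i) * (2 * T * tt))).
  - rewrite !sumR_plus. rewrite (sumR_scal (2 * n) (2 * d0)).
    (* The first-order terms in the t-derivative, produced by differentiating the coefficients of
       the X_i, cancel because <J xi,xi> = 0. *)
    replace (sumR (2 * n) (fun i => xi i * Jx n xi i)) with 0
      by (rewrite <- (dot_Jx_self n xi), dotR_comm; reflexivity).
    rewrite (sumR_scal_r (2 * n) T (fun i => xi i * D2u i (2 * n)%nat z)).
    rewrite (sumR_scal_r (2 * n) (2 * T * tt) (fun i => Jx n (fst z) i * xi i)).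
    rewrite (sumR_scal_r (2 * n) _ (fun i => 2 * (Jx n (fst z) i * xi i))).
    rewrite (sumR_scal (2 * n) 2 (fun i => Jx n (fst z) i * xi i)).
    replace (sumR (2 * n) (fun i => Jx n (fst z) i * xi i)) with (T / 2)
      by (unfold T; unfold dotR; field).
    rewrite (sumR_ext (2 * n) (fun k => xi k * (_ + _))
      (fun k => xi k * sumR (2 * n) (fun l => xi l * D2u k l z) + xi k * D2u k (2 * n)%nat z * T))
      by (intros; ring).
    rewrite sumR_plus. rewrite (sumR_scal_r (2 * n) T (fun i => xi i * D2u i (2 * n)%nat z)). field.
  - intros i Hi. unfold XXu, Xop.
    assert (EJ : xi i * Jx n xi i = sumR (2 * n) (fun j => xi i * xi j * Jm n i j)).
    { unfold Jx. rewrite <- sumR_scal. apply sumR_ext; intros; ring. }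
    assert (ET : T = sumR (2 * n) (fun j => 2 * (Jx n (fst z) j * xi j)))
      by (unfold T, dotR; rewrite <- sumR_scal; reflexivity).
    replace (xi i * D2u i (2 * n)%nat z * T) with
      (sumR (2 * n) (fun j => xi i * D2u i (2 * n)%nat z * (2 * (Jx n (fst z) j * xi j))))
      by (rewrite sumR_scal, <- ET; ring).
    replace (Jx n (fst z) i * xi i * (2 * T * tt)) with
      (sumR (2 * n) (fun j => Jx n (fst z) i * xi i * 2 * tt * (2 * (Jx n (fst z) j * xi j))))
      by (rewrite sumR_scal, <- ET; ring).
    rewrite EJ, <- !sumR_scal, <- !sumR_plus. apply sumR_ext. intros j Hj.
    rewrite (XDeriv_formula n Om u Du D2u P z i j HC HP Hz) by lia.
    rewrite (XDeriv_formula n Om u Du D2u P z i (2 * n) HC HP Hz) by lia.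
    rewrite Nat.ltb_irrefl. rewrite (proj2 (Nat.ltb_lt j (2 * n)) Hj). fold tt d0. ring.
Qed.

(** * The barrier and the comparison principle *)

Definition sumL {T : Type} (f : T -> R) (l : list T) : R := fold_right (fun p acc => f p + acc) 0 l.

Lemma sumL_le {T : Type} (f g : T -> R) l : (forall p, In p l -> f p <= g p) -> sumL f l <= sumL g l.
Proof.
  induction l as [|p l IH]; intros H; simpl; [lra|].
  assert (sumL f l <= sumL g l) by (apply IH; intros; apply H; now right).
  specialize (H p (or_introl eq_refl)). lra.
Qed.

Lemma sumL_ext {T : Type} (f g : T -> R) l : (forall p, In p l -> f p = g p) -> sumL f l = sumL g l.
Proof. intros H. apply Rle_antisym; apply sumL_le; intros p Hp; rewrite H; auto; lra. Qed.

Lemma sumL_const {T : Type} c (l : list T) : sumL (fun _ : T => c) l = INR (length l) * c.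
Proof.
  induction l as [|p l IH]; [simpl; ring|]. cbn [length]. rewrite S_INR. simpl sumL.
  simpl in IH. rewrite IH. ring.
Qed.

Lemma sumL_nonneg {T : Type} (f : T -> R) l : (forall p, In p l -> 0 <= f p) -> 0 <= sumL f l.
Proof.
  intros H. replace 0 with (sumL (fun _ : T => 0) l); [now apply sumL_le|]. rewrite sumL_const. ring.
Qed.

Lemma sumL_scal {T : Type} c (f : T -> R) l : sumL (fun p => c * f p) l = c * sumL f l.
Proof. induction l as [|p l IH]; simpl; [ring|]. simpl in IH. rewrite IH. ring. Qed.

Lemma sumL_plus {T : Type} (f g : T -> R) l : sumL (fun p => f p + g p) l = sumL f l + sumL g l.
Proof. induction l as [|p l IH]; simpl; [ring|]. simpl in IH. rewrite IH. ring. Qed.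

Lemma sumR_sumL {T : Type} N (f : nat -> T -> R) l : sumR N (fun k => sumL (f k) l) = sumL (fun p => sumR N (fun k => f k p)) l.
Proof.
  induction l as [|p l IH]; simpl; [apply sumR_zero; auto|].
  rewrite sumR_plus. now rewrite IH.
Qed.

Lemma der2_sumL (g : Point -> R -> R) l S : (forall p, In p S -> der2 (g p) (l p)) ->
  der2 (fun s => sumL (fun p => g p s) S) (sumL l S).
Proof.
  induction S as [|p S IH]; intros H; simpl; [apply der2_const|].
  apply (der2_plus (g p) (fun s => sumL (fun p => g p s) S)); [apply H; now left|].
  apply IH. intros; apply H; now right.
Qed.

Lemma seq_cont_sumL n K (f : Point -> Point -> R) S : (forall p, In p S -> seq_cont n K (f p)) ->
  seq_cont n K (fun z => sumL (fun p => f p z) S).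
Proof.
  induction S as [|p S IH]; intros H; simpl; [apply seq_cont_const|].
  apply (seq_cont_plus n K (f p)); [apply H; now left|]. apply IH. intros; apply H; now right.
Qed.

Definition qform (n : nat) (B : nat -> nat -> R) (x : nat -> R) : R := dotR n x (matvec n B x).
Definition phiB (n : nat) (B : nat -> nat -> R) (w : Point) : R := qform n B (fst w) ^ 2 + snd w ^ 2.
(** Comparable to d(p,z)^(1-Q). At the pole [Rpower] returns a default value; every use keeps a
    positive distance from p. *)
Definition barrier (n : nat) (B : nat -> nat -> R) (p z : Point) : R :=
  Rpower (phiB n B (hmul n (hinv p) z)) (- ((2 * INR n + 1) / 4)).

(** The horizontal part uses lam|x|^2 <= q <= Lam|x|^2; lam <= 1 <= Lam lets the same constants
    cover t^2. *)
Lemma phiB_bounds n lam Lam A0 w : 0 < lam <= 1 -> 1 <= Lam -> sympl_spd n lam Lam A0 ->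
  lam ^ 2 * rho n w ^ 4 <= phiB n (JtAJ n A0) w <= Lam ^ 2 * rho n w ^ 4.
Proof.
  intros Hl HL HA. rewrite rho_pow4. unfold phiB, qform.
  pose proof (B_lo n lam Lam A0 HA (fst w)) as H1.
  pose proof (B_hi n lam Lam A0 HA (fst w)) as H2.
  pose proof (dotR_self_nonneg n (fst w)) as H0.
  set (a := dotR n (fst w) (fst w)) in *. set (q := dotR n (fst w) _) in *.
  pose proof (pow2_ge_0 (snd w)).
  assert (0 <= lam * a) by (apply Rmult_le_pos; lra).
  rewrite !Rmult_plus_distr_l. split; apply Rplus_le_compat.
  - replace (lam ^ 2 * a ^ 2) with ((lam * a) ^ 2) by ring. apply pow_incr. lra.
  - assert (lam ^ 2 <= 1) by nra. nra.
  - replace (Lam ^ 2 * a ^ 2) with ((Lam * a) ^ 2) by ring. apply pow_incr. lra.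
  - assert (1 <= Lam ^ 2) by nra. nra.
Qed.

Lemma der2_Rpower_comp (ph ph1 : R -> R) ph2 al :
  (forall s, derivable_pt_lim ph s (ph1 s)) -> derivable_pt_lim ph1 0 ph2 -> 0 < ph 0 ->
  der2 (fun s => Rpower (ph s) (- al))
    (al * Rpower (ph 0) (- al - 2) * ((al + 1) * ph1 0 ^ 2 - ph 0 * ph2)).
Proof.
  intros H1 H2 Hpos.
  assert (Hc : continuity_pt ph 0) by (apply derivable_continuous_pt; exists (ph1 0); apply H1).
  destruct (Hc (ph 0) Hpos) as [d [Hd Hd']].
  assert (Hp : forall s, Rabs s < d -> 0 < ph s).
  { intros s Hs. destruct (Req_dec s 0) as [->|E]; auto.
    assert (Rabs (ph s - ph 0) < ph 0).
    { apply (Hd' s). split; [split; [exact I|auto]|]. simpl. unfold Rdist. now rewrite Rminus_0_r. }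
    apply Rabs_def2 in H. lra. }
  exists (fun s => - al * Rpower (ph s) (- al - 1) * ph1 s), d. split; auto.
  assert (HR : forall be s, 0 < ph s ->
    derivable_pt_lim (fun s => Rpower (ph s) be) s (be * Rpower (ph s) (be - 1) * ph1 s)).
  { intros be s Hs. apply (derivable_pt_lim_comp ph (fun x => Rpower x be)); [apply H1|].
    now apply derivable_pt_lim_power. }
  split.
  - intros s Hs. apply HR; auto.
  - replace (al * Rpower (ph 0) (- al - 2) * ((al + 1) * ph1 0 ^ 2 - ph 0 * ph2)) with
      ((- al * ((- al - 1) * Rpower (ph 0) (- al - 1 - 1) * ph1 0)) * ph1 0
        + (- al * Rpower (ph 0) (- al - 1)) * ph2).
    + apply (derivable_pt_lim_mult (fun s => - al * Rpower (ph s) (- al - 1)) ph1); auto.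
      apply (derivable_pt_lim_scal (fun s => Rpower (ph s) (- al - 1))). apply HR; auto.
    + replace (- al - 1 - 1) with (- al - 2) by ring.
      replace (Rpower (ph 0) (- al - 1)) with (Rpower (ph 0) (- al - 2) * ph 0); [ring|].
      rewrite <- (Rpower_1 (ph 0)) at 2 by auto. rewrite <- Rpower_plus. f_equal. ring.
Qed.

Lemma qform_line n B x xi s : symm n B -> qform n B (fun i => x i + s * xi i) =
  qform n B x + 2 * s * dotR n (matvec n B x) xi + s ^ 2 * qform n B xi.
Proof.
  intros HB. unfold qform.
  rewrite (dotR_ext n _ (matvec n B (fun i => x i + s * xi i)) (fun i => x i + s * xi i)
    (fun i => matvec n B x i + s * matvec n B xi i)); auto.
  - rewrite !dotR_plus_l, !dotR_plus_r, !dotR_scal_l, !dotR_scal_r.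
    rewrite (matvec_symm n B x xi HB). rewrite (dotR_comm n xi (matvec n B x)). ring.
  - intros i _. now rewrite matvec_plus, matvec_scal.
Qed.

(** Left translation keeps the line horizontal. Along it q is quadratic and t affine in s, so phi is
    an explicit quartic polynomial whose two derivatives at 0 are read off. *)
Lemma barrier_der2 n B p z xi : symm n B ->
  let al := (2 * INR n + 1) / 4 in
  let w := hmul n (hinv p) z in
  let x := fst w in let t := snd w in
  0 < phiB n B w ->
  der2 (fun s => barrier n B p (hline n z xi s))
    (al * Rpower (phiB n B w) (- al - 2) *
      ((al + 1) * (4 * dotR n (fun i => qform n B x * matvec n B x i + t * Jx n x i) xi) ^ 2 -
       phiB n B w * (8 * dotR n (matvec n B x) xi ^ 2 + 4 * qform n B x * quadf (2 * n) B xi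
                      + 8 * dotR n (Jx n x) xi ^ 2))).
Proof.
  intros HB al w x t Hpos.
  set (q := qform n B x). set (b := dotR n (matvec n B x) xi). set (c := qform n B xi).
  set (j := dotR n (Jx n x) xi).
  rewrite dotR_plus_l, !dotR_scal_l. fold b j. change (quadf (2 * n) B xi) with c.
  set (ph := fun s => (q + 2 * s * b + s ^ 2 * c) ^ 2 + (t + 2 * s * j) ^ 2).
  assert (E : forall s, phiB n B (hmul n (hinv p) (hline n z xi s)) = ph s).
  { intros s. unfold hline. rewrite <- hmul_assoc. fold w. fold (hline n w xi s).
    rewrite hline_eq. unfold phiB; cbn [fst snd]. rewrite qform_line by auto.
    unfold ph, q, b, c, j, x, t. f_equal. ring. }
  assert (E0 : phiB n B w = ph 0).
  { rewrite <- E, hline_0. reflexivity. }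
  apply der2_ext with (fun s => Rpower (ph s) (- al)).
  { intros s. unfold barrier. now rewrite E. }
  rewrite E0 in *.
  set (ph1 := fun s => 2 * (q + 2 * s * b + s ^ 2 * c) * (2 * b + 2 * s * c) + 2 * (t + 2 * s * j) * (2 * j)).
  replace (4 * (q * b + t * j)) with (ph1 0) by (unfold ph1; ring).
  assert (Hl : forall s, derivable_pt_lim (fun s => q + 2 * s * b + s ^ 2 * c) s (2 * b + 2 * s * c)).
  { intros s. replace (2 * b + 2 * s * c) with (0 + (2 * b) * 1 + (c * (INR 2 * s ^ 1))) by (simpl; ring).
    apply derivable_pt_lim_ext with (fun s => (q + (2 * b) * s) + c * s ^ 2); [intros; ring|].
    apply (derivable_pt_lim_plus (fun s => q + (2 * b) * s) (fun s => c * s ^ 2)).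
    - apply (derivable_pt_lim_plus (fun s => q) (fun s => (2 * b) * s)); [apply derivable_pt_lim_const|].
      apply (derivable_pt_lim_scal (fun s => s)), derivable_pt_lim_id.
    - apply (derivable_pt_lim_scal (fun s => s ^ 2)). apply (derivable_pt_lim_pow s 2). }
  assert (Hm : forall d e s, derivable_pt_lim (fun s => d + 2 * s * e) s (2 * e)).
  { intros d e s. replace (2 * e) with (0 + (2 * e) * 1) by ring.
    apply derivable_pt_lim_ext with (fun s => d + (2 * e) * s); [intros; ring|].
    apply (derivable_pt_lim_plus (fun s => d) (fun s => (2 * e) * s)); [apply derivable_pt_lim_const|].
    apply (derivable_pt_lim_scal (fun s => s)), derivable_pt_lim_id. }
  apply der2_Rpower_comp; auto.
  - intros s. unfold ph, ph1.
    apply derivable_pt_lim_ext with (fun s => (q + 2 * s * b + s ^ 2 * c) * (q + 2 * s * b + s ^ 2 * c)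
       + (t + 2 * s * j) * (t + 2 * s * j)); [intros; ring|].
    replace (2 * (q + 2 * s * b + s ^ 2 * c) * (2 * b + 2 * s * c) + 2 * (t + 2 * s * j) * (2 * j)) with
      (((2 * b + 2 * s * c) * (q + 2 * s * b + s ^ 2 * c) + (q + 2 * s * b + s ^ 2 * c) * (2 * b + 2 * s * c))
       + ((2 * j) * (t + 2 * s * j) + (t + 2 * s * j) * (2 * j))) by ring.
    apply (derivable_pt_lim_plus (fun s => (q + 2 * s * b + s ^ 2 * c) * (q + 2 * s * b + s ^ 2 * c))
      (fun s => (t + 2 * s * j) * (t + 2 * s * j))).
    + apply (derivable_pt_lim_mult (fun s => q + 2 * s * b + s ^ 2 * c) (fun s => q + 2 * s * b + s ^ 2 * c)); auto.
    + apply (derivable_pt_lim_mult (fun s => t + 2 * s * j) (fun s => t + 2 * s * j)); auto.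
  - unfold ph1.
    apply derivable_pt_lim_ext with (fun s => 2 * ((q + 2 * s * b + s ^ 2 * c) * (2 * b + 2 * s * c))
      + 2 * ((t + 2 * s * j) * (2 * j))); [intros; ring|].
    replace (8 * b ^ 2 + 4 * q * c + 8 * j ^ 2) with
      (2 * ((2 * b + 2 * 0 * c) * (2 * b + 2 * 0 * c) + (q + 2 * 0 * b + 0 ^ 2 * c) * (2 * c))
       + 2 * ((2 * j) * (2 * j) + (t + 2 * 0 * j) * 0)) by ring.
    apply (derivable_pt_lim_plus (fun s => 2 * ((q + 2 * s * b + s ^ 2 * c) * (2 * b + 2 * s * c)))
      (fun s => 2 * ((t + 2 * s * j) * (2 * j)))).
    + apply (derivable_pt_lim_scal (fun s => (q + 2 * s * b + s ^ 2 * c) * (2 * b + 2 * s * c))).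
      apply (derivable_pt_lim_mult (fun s => q + 2 * s * b + s ^ 2 * c) (fun s => 2 * b + 2 * s * c)); auto.
    + apply (derivable_pt_lim_scal (fun s => (t + 2 * s * j) * (2 * j))).
      apply (derivable_pt_lim_mult (fun s => t + 2 * s * j) (fun s => 2 * j)); [auto|apply derivable_pt_lim_const].
Qed.

Lemma seq_cont_barrier n B K p : (forall z, K z -> 0 < phiB n B (hmul n (hinv p) z)) ->
  seq_cont n K (barrier n B p).
Proof.
  intros Hpos. unfold barrier.
  apply (seq_cont_comp n K (fun x => Rpower x (- ((2 * INR n + 1) / 4)))
    (fun z => phiB n B (hmul n (hinv p) z))).
  - unfold phiB, hmul, hinv; cbn [fst snd]. apply seq_cont_plus; apply seq_cont_pow.
    + unfold qform, dotR, matvec. apply seq_cont_sumR. intros i Hi.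
      apply seq_cont_mult; [apply seq_cont_plus; [apply seq_cont_const|apply seq_cont_x; auto]|].
      apply seq_cont_sumR. intros k Hk. apply seq_cont_mult; [apply seq_cont_const|].
      apply seq_cont_plus; [apply seq_cont_const|apply seq_cont_x; auto].
    + apply seq_cont_plus; [apply seq_cont_plus; [apply seq_cont_const|apply seq_cont_t]|].
      apply seq_cont_mult; [apply seq_cont_const|apply seq_cont_Jdot].
  - intros z Hz. apply derivable_continuous_pt. eexists. apply derivable_pt_lim_power. auto.
Qed.

(** A function that is convex along horizontal lines at every point, with no degeneracy; a small
    multiple of it supplies strictness in [no_interior_min]. *)
Lemma der2_sqdist_line n (c : Point) z xi :
  der2 (fun s => dotR n (fun i => fst (hline n z xi s) i - fst c i) (fun i => fst (hline n z xi s) i - fst c i))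
    (2 * dotR n xi xi).
Proof.
  set (y := fun i => fst z i - fst c i).
  apply der2_ext with (fun s => dotR n y y + 2 * s * dotR n y xi + s ^ 2 * dotR n xi xi).
  { intros s. rewrite (dotR_ext n (fun i => fst (hline n z xi s) i - fst c i) (fun i => fst (hline n z xi s) i - fst c i)
      (fun i => y i + s * xi i) (fun i => y i + s * xi i)).
    - rewrite !dotR_plus_l, !dotR_plus_r, !dotR_scal_l, !dotR_scal_r, (dotR_comm n xi y). ring.
    - intros i _. rewrite hline_eq; cbn [fst]. unfold y. ring.
    - intros i _. rewrite hline_eq; cbn [fst]. unfold y. ring. }
  set (a := dotR n y y). set (b := dotR n y xi). set (e := dotR n xi xi).
  assert (Hm : forall d e s, derivable_pt_lim (fun s => d + e * s) s e).
  { intros d f s. pose proof (derivable_pt_lim_plus (fun s => d) (fun s => f * s) s 0 (f * 1)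
      (derivable_pt_lim_const _ _) (derivable_pt_lim_scal (fun h => h) _ _ _ (derivable_pt_lim_id s))) as Q.
    rewrite Rplus_0_l, Rmult_1_r in Q. exact Q. }
  exists (fun s => 2 * b + 2 * e * s), 1. split; [lra|]. split; [|apply Hm]. intros s _.
  apply derivable_pt_lim_ext with (fun s => (a + (2 * b) * s) + e * s ^ 2); [intros; ring|].
  replace (2 * b + 2 * e * s) with (2 * b + e * (INR 2 * s ^ 1)) by (simpl; ring).
  apply (derivable_pt_lim_plus (fun s => a + (2 * b) * s) (fun s => e * s ^ 2)); [apply Hm|].
  apply (derivable_pt_lim_scal (fun s => s ^ 2)). apply (derivable_pt_lim_pow s 2).
Qed.

(** Closeness is measured on quadratic forms, which is how the errors enter [barrier_form_nonneg];
    symmetry and the lower bound allow A to be factorised. *)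
Definition close_to (n : nat) (lam eps : R) (A0 A : nat -> nat -> R) : Prop :=
  symm n A /\ (forall x, lam * dotR n x x <= dotR n x (matvec n A x)) /\
  (forall v, Rabs (dotR n v (matvec n A v) - dotR n v (matvec n A0 v)) <= eps * dotR n v v).

(** The condition of [barrier_form_nonneg] with alpha = (2n+1)/4: the error does not exceed the
    margin 4. *)
Definition eps_small (n : nat) (lam Lam eps : R) : Prop :=
  0 <= eps /\
  eps * (16 * ((2 * INR n + 1) / 4 + 1) / lam + 16 / lam + 8 * INR n * Lam) <= 4.

(* v solves tr(A D^2_H v) = 0 on [dH c z < rad], the symmetrised horizontal Hessian H being seen through
   second derivatives along horizontal lines. *)
Definition solves (n : nat) (A : Point -> nat -> nat -> R) (c : Point) (rad : R) (v : Point -> R) : Prop :=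
  forall z, inH n z -> dH n c z < rad -> exists H, frob n (A z) H = 0 /\
    forall xi, (forall i, (2 * n <= i)%nat -> xi i = 0) ->
      der2 (fun s => v (hline n z xi s)) (quadf (2 * n) H xi).

Lemma list_gap (l : list Point) (d : Point -> R) h : (forall p, In p l -> h < d p) ->
  exists g, 0 < g /\ forall p, In p l -> h + g <= d p.
Proof.
  induction l as [|p l IH]; intros H.
  - exists 1. split; [lra|]. intros p [].
  - destruct IH as [g [Hg H']]; [intros; apply H; now right|].
    pose proof (H p (or_introl eq_refl)). exists (Rmin g (d p - h)). split; [apply Rmin_glb_lt; lra|].
    pose proof (Rmin_l g (d p - h)). pose proof (Rmin_r g (d p - h)).
    intros p' [<-|Hp]; [lra|]. specialize (H' p' Hp). lra.
Qed.

(** * Comparison of a nonnegative solution with a finite sum of barriers *)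

Section Comparison.
Variables (n : nat) (lam Lam eps : R) (A0 : nat -> nat -> R).
Hypothesis Hn : (1 <= n)%nat.
Hypothesis Hlam : 0 < lam <= 1.
Hypothesis HLam : 1 <= Lam.
Hypothesis HA0 : sympl_spd n lam Lam A0.
Hypothesis Heps : eps_small n lam Lam eps.
Let B := JtAJ n A0.
Let al := (2 * INR n + 1) / 4.

Lemma phiB_pos p z : 0 < dH n p z -> 0 < phiB n B (hmul n (hinv p) z).
Proof.
  intros H. destruct (phiB_bounds n lam Lam A0 (hmul n (hinv p) z) Hlam HLam HA0) as [H1 _].
  eapply Rlt_le_trans; [|exact H1]. fold (dH n p z).
  apply Rmult_lt_0_compat; apply pow_lt; lra.
Qed.

(** L_A of the barrier is written as a sum of second derivatives along the rows of a factor, A = L^t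
    L, the form in which it meets the test at a minimum. Summing [barrier_der2] over the rows
    restores the traces of [barrier_form_nonneg]. *)
Lemma barrier_subsolution A L p z : close_to n lam eps A0 A ->
  (forall i j, (i < 2 * n)%nat -> (j < 2 * n)%nat -> A i j = sumR (2 * n) (fun k => L k i * L k j)) ->
  0 < dH n p z ->
  exists l : nat -> R, (forall k, der2 (fun s => barrier n B p (hline n z (L k) s)) (l k)) /\
    0 <= sumR (2 * n) l.
Proof.
  intros [HA1 [HA2 HA3]] HL Hd. pose proof (phiB_pos p z Hd) as Hphi.
  pose proof (B_symm n lam Lam A0 HA0) as HBs. fold B in HBs.
  eexists. split; [intros k; apply barrier_der2; auto|]. cbv beta zeta. fold al.
  set (w := hmul n (hinv p) z) in *. set (x := fst w). set (q := qform n B x). set (t := snd w).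
  rewrite sumR_scal. apply Rmult_le_pos.
  { apply Rmult_le_pos; [unfold al; pose proof (pos_INR n); lra|left; apply exp_pos]. }
  set (eta := fun i => q * matvec n B x i + t * Jx n x i).
  rewrite (sumR_ext (2 * n) _ (fun k => 16 * (al + 1) * dotR n eta (L k) ^ 2 +
     (- phiB n B w) * (8 * dotR n (matvec n B x) (L k) ^ 2 + 4 * q * quadf (2 * n) B (L k)
                      + 8 * dotR n (Jx n x) (L k) ^ 2))) by (intros; ring).
  rewrite sumR_plus, !sumR_scal, !sumR_plus, !sumR_scal.
  rewrite !(quad_rank_one n A L) by auto. rewrite <- (frob_rank_one n A B L) by auto.
  destruct Heps as [He1 He2].
  pose proof (barrier_form_nonneg n lam Lam A0 (proj1 Hlam) HA0 A eps He1 HA3 al x t eq_refl He2) as F.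
  cbv zeta in F. fold B in F. change (dotR n x (matvec n B x)) with q in F. fold eta in F.
  change (phiB n B w) with (q ^ 2 + t ^ 2). lra.
Qed.

Variables (A : Point -> nat -> nat -> R) (c : Point) (rad h ell M b : R) (v : Point -> R) (S : list Point).
Hypothesis HA : forall z, inH n z -> dH n c z < rad -> close_to n lam eps A0 (A z).
Hypothesis Hv : solves n A c rad v.
Hypothesis Hvc : seq_cont n (cball n c rad) v.
Hypothesis Hv0 : forall z, cball n c rad z -> 0 <= v z.
Hypothesis Hh : 0 < h.
Hypothesis Hrad : 0 < rad.
Hypothesis Hell : 0 < ell.
Hypothesis HM : 0 < M.
Hypothesis Hb : 0 <= b.
Hypothesis HS : forall p z, In p S -> cball n c rad z -> dH n p z <= h -> ell <= v z.
Hypothesis HWM : forall z, cball n c rad z -> (forall p, In p S -> h <= dH n p z) ->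
  sumL (fun p => barrier n B p z) S <= M.
Hypothesis HWb : forall z, cball n c rad z -> dH n c z = rad -> (forall p, In p S -> h <= dH n p z) ->
  sumL (fun p => barrier n B p z) S <= b.

Let W := fun z => sumL (fun p => barrier n B p z) S.
Let K := fun z => cball n c rad z /\ forall p, In p S -> h <= dH n p z.
Let sq := fun z : Point => dotR n (fun i => fst z i - fst c i) (fun i => fst z i - fst c i).

Lemma compact_K : compactH n K.
Proof.
  destruct (compact_cball n c rad) as [[bd H1] H2]. split.
  - exists bd. intros z k [Hz _]. now apply H1.
  - intros zs z Hz Hi C. split; [apply (H2 zs); auto; intros; apply Hz|].
    intros p Hp. apply (Un_cv_limit_ge (fun m => dH n p (zs m))); [|intros m; now apply (Hz m)].
    apply (seq_cont_dH n (fun _ => True)); auto.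
Qed.

Lemma seq_cont_gap eta : seq_cont n K (fun z => v z - ell / M * (W z - b) - eta * sq z).
Proof.
  apply seq_cont_minus; [apply seq_cont_minus|].
  - intros zs z Hz Hz' C. apply (Hvc zs z); auto; [intros m; apply Hz|apply Hz'].
  - apply seq_cont_mult; [apply seq_cont_const|]. apply seq_cont_minus; [|apply seq_cont_const].
    apply seq_cont_sumL. intros p Hp. apply seq_cont_barrier. intros z [_ Hz].
    apply phiB_pos. specialize (Hz p Hp). lra.
  - apply seq_cont_mult; [apply seq_cont_const|]. unfold sq, dotR. apply seq_cont_sumR. intros i Hi.
    apply seq_cont_mult; (apply seq_cont_minus; [apply seq_cont_x; auto|apply seq_cont_const]).
Qed.

(** At such a minimum the second derivatives along all rows of a factor of A would be nonnegative.
    Their sum is tr(A H) = 0, minus a nonnegative multiple of L_A W, minus 2 eta tr A, which is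
    negative. *)
Lemma no_interior_min eta z : 0 < eta -> inH n z -> dH n c z < rad -> (forall p, In p S -> h < dH n p z) ->
  ~ (forall w, K w -> v z - ell / M * (W z - b) - eta * sq z <= v w - ell / M * (W w - b) - eta * sq w).
Proof.
  intros Heta Hz Hc Hp Hmin.
  destruct (HA z Hz Hc) as [HA1 [HA2 HA3]]. destruct (Hv z Hz Hc) as [H [HH1 HH2]].
  destruct (cholesky (2 * n) (A z) lam) as [L [HL0 HL]]; [lra|auto| |].
  { intros xi. rewrite quadf_dot. eapply Rle_trans; [|apply HA2].
    apply Rmult_le_compat_l; [lra|]. apply Req_le, sumR_ext. intros; ring. }
  destruct (list_gap S (fun p => dH n p z) h Hp) as [g [Hg1 Hg2]].
  assert (HB : forall p, exists l : nat -> R, In p S ->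
    (forall k, der2 (fun s => barrier n B p (hline n z (L k) s)) (l k)) /\ 0 <= sumR (2 * n) l).
  { intros p. destruct (classic (In p S)) as [Hin|Hin]; [|exists (fun _ => 0); tauto].
    destruct (barrier_subsolution (A z) L p z (HA z Hz Hc) HL) as [l Hl]; [specialize (Hp p Hin); lra|].
    exists l. auto. }
  destruct (choice _ HB) as [lb Hlb].
  assert (HD : forall k, (k < 2 * n)%nat ->
    0 <= quadf (2 * n) H (L k) + (- (ell / M)) * sumL (fun p => lb p k) S + (- eta) * (2 * dotR n (L k) (L k))).
  { intros k Hk.
    apply (der2_min (fun s => (v (hline n z (L k) s) + (- (ell / M)) * (W (hline n z (L k) s) ))
       + (- eta) * sq (hline n z (L k) s))).
    - apply (der2_plus (fun s => v (hline n z (L k) s) + (- (ell / M)) * (W (hline n z (L k) s)))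
        (fun s => (- eta) * sq (hline n z (L k) s))).
      + apply (der2_plus (fun s => v (hline n z (L k) s)) (fun s => (- (ell / M)) * (W (hline n z (L k) s)))).
        * apply HH2. intros; now apply HL0.
        * apply (der2_scal _ (fun s => W (hline n z (L k) s))).
          apply (der2_sumL (fun p s => barrier n B p (hline n z (L k) s)) (fun p => lb p k)).
          intros p Hin. now apply Hlb.
      + apply (der2_scal _ (fun s => sq (hline n z (L k) s))). apply der2_sqdist_line.
    - set (N := sqrt (dotR n (L k) (L k))). assert (HN : 0 <= N) by apply sqrt_pos.
      set (d := Rmin g (rad - dH n c z)).
      assert (Hd : 0 < d) by (apply Rmin_glb_lt; lra).
      exists (d / (N + 1)). split; [apply Rdiv_lt_0_compat; lra|]. intros s Hs.
      assert (Hdist : dH n z (hline n z (L k) s) <= d).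
      { apply Rsqr_incr_0_var; [|lra]. rewrite !Rsqr_pow2, hline_dist.
        replace (dotR n (L k) (L k)) with (N ^ 2) by (apply pow2_sqrt, dotR_self_nonneg).
        replace (s ^ 2 * N ^ 2) with ((Rabs s * N) ^ 2) by (rewrite Rpow_mult_distr, pow2_abs; ring).
        apply pow_incr. split; [apply Rmult_le_pos; [apply Rabs_pos|auto]|].
        apply (Rmult_lt_compat_r (N + 1)) in Hs; [|lra].
        replace (d / (N + 1) * (N + 1)) with d in Hs by (field; lra).
        pose proof (Rabs_pos s). nra. }
      assert (HK : K (hline n z (L k) s)).
      { split; [split|].
        - apply hline_inH; auto.
        - pose proof (dH_tri n c z (hline n z (L k) s)).
          pose proof (Rmin_r g (rad - dH n c z)). fold d in H1. lra.
        - intros p Hin. pose proof (dH_tri n p (hline n z (L k) s) z). rewrite (dH_sym n (hline n z (L k) s) z) in H0.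
          specialize (Hg2 p Hin). pose proof (Rmin_l g (rad - dH n c z)). fold d in H1. lra. }
      specialize (Hmin _ HK). rewrite hline_0. lra. }
  apply (sumR_le (2 * n) (fun _ => 0)) in HD. rewrite sumR_const in HD.
  rewrite !sumR_plus, !sumR_scal, <- (frob_rank_one n (A z) H L HL), HH1, sumR_sumL in HD.
  assert (HW : 0 <= sumL (fun p => sumR (2 * n) (fun k => lb p k)) S)
    by (apply sumL_nonneg; intros p Hin; now apply (Hlb p Hin)).
  (* The sum is tr A, at least its entry at (0,0), which exists because n >= 1 and is at least
     lam. *)
  assert (HT : lam <= sumR (2 * n) (fun k => dotR n (L k) (L k))).
  { unfold dotR. rewrite sumR_swap.
    eapply Rle_trans; [|apply (sumR_term_le (2 * n) (fun i => sumR (2 * n) (fun k => L k i * L k i)) 0);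
      [intros; apply sumR_nonneg; intros; nra|lia]].
    rewrite <- HL by lia. pose proof (HA2 (fun j => if (j =? 0)%nat then 1 else 0)) as Q.
    unfold dotR, matvec in Q. rewrite !sumR_delta in Q by lia. rewrite Nat.eqb_refl in Q.
    rewrite (sumR_ext (2*n) (fun k => A z 0%nat k * _) (fun k => (if (k =? 0)%nat then 1 else 0) * A z 0%nat k)) in Q by (intros; ring).
    rewrite sumR_delta in Q by lia. lra. }
  assert (0 < ell / M) by (apply Rdiv_lt_0_compat; auto).
  assert (0 <= ell / M * sumL (fun p => sumR (2 * n) (fun k => lb p k)) S) by (apply Rmult_le_pos; lra).
  assert (0 < eta * (2 * sumR (2 * n) (fun k => dotR n (L k) (L k)))) by (apply Rmult_lt_0_compat; lra).
  lra.
Qed.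

(** The multiple ell (W - b)/M is at most 0 on the outer sphere, where v >= 0, and at most ell on
    the spheres of radius h about the poles, where v >= ell. A negative minimum of the difference
    would thus be interior. *)
Lemma comparison z : cball n c rad z -> (forall p, In p S -> h <= dH n p z) ->
  ell * (W z - b) / M <= v z.
Proof.
  intros Hz Hp. destruct (Rle_or_lt (ell * (W z - b) / M) (v z)) as [|C]; auto. exfalso.
  assert (Hsq : forall w, cball n c rad w -> 0 <= sq w <= rad ^ 2).
  { intros w [Hw1 Hw2]. split; [apply dotR_self_nonneg|].
    eapply Rle_trans; [|apply pow_incr; split; [apply dH_nonneg|exact Hw2]].
    eapply Rle_trans; [|apply dH_x]. apply Req_le, sumR_ext. intros; ring. }
  set (F := fun eta w => v w - ell / M * (W w - b) - eta * sq w).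
  set (f0 := ell * (W z - b) / M - v z) in *.
  assert (Hf0 : 0 < f0) by (unfold f0; lra).
  (* Chosen so that eta rad^2 < f0: the strictness term cannot undo the assumed gap f0 anywhere in
     the ball. *)
  set (eta := f0 / (2 * (rad ^ 2 + 1))).
  assert (Hr2 : 0 < rad ^ 2) by (apply pow_lt; auto).
  assert (Heta : 0 < eta) by (apply Rdiv_lt_0_compat; lra).
  assert (Ee : eta * rad ^ 2 < f0).
  { apply Rlt_le_trans with (eta * (2 * (rad ^ 2 + 1))); [apply Rmult_lt_compat_l; lra|].
    unfold eta. apply Req_le. field. lra. }
  destruct (min_attained n K (F eta) z compact_K (seq_cont_gap eta) (conj Hz Hp)) as [y [[Hy1 Hy2] Hmin]].
  assert (Fy : F eta y <= F eta z) by (apply Hmin; split; auto).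
  assert (Fz : F eta z <= - f0).
  { unfold F. pose proof (Hsq z Hz). assert (0 <= eta * sq z) by (apply Rmult_le_pos; lra).
    replace (- f0) with (v z - ell / M * (W z - b)) by (unfold f0; field; lra). lra. }
  assert (Neg : v y < ell / M * (W y - b)).
  { pose proof (Hsq y Hy1). assert (eta * sq y <= eta * rad ^ 2) by (apply Rmult_le_compat_l; lra).
    unfold F in Fy at 1. lra. }
  assert (HeM : 0 < ell / M) by (apply Rdiv_lt_0_compat; auto).
  pose proof (Hv0 y Hy1) as V0.
  destruct (Rle_lt_or_eq_dec _ _ (proj2 Hy1)) as [Lt|Eq].
  2:{ pose proof (HWb y Hy1 Eq Hy2) as Wb. fold (W y) in Wb.
      assert (ell / M * (W y - b) <= ell / M * 0) by (apply Rmult_le_compat_l; lra). lra. }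
  apply (no_interior_min eta y Heta (proj1 Hy1) Lt); [|exact Hmin].
  intros p Hin. destruct (Rle_lt_or_eq_dec _ _ (Hy2 p Hin)) as [|E]; auto. exfalso.
  pose proof (HS p y Hin Hy1 ltac:(lra)) as Q. pose proof (HWM y Hy1 Hy2) as Wm. fold (W y) in Wm.
  assert (ell / M * (W y - b) <= ell / M * M) by (apply Rmult_le_compat_l; lra).
  replace (ell / M * M) with ell in H by (field; lra). lra.
Qed.
End Comparison.

(** * Grids and potentials *)

Lemma sumL_app {T : Type} (f : T -> R) l l' : sumL f (l ++ l') = sumL f l + sumL f l'.
Proof. induction l as [|p l IH]; simpl; [ring|]. simpl in IH. rewrite IH. ring. Qed.

Lemma sumL_flat_map {T U : Type} (f : U -> R) (g : T -> list U) l :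
  sumL f (flat_map g l) = sumL (fun a => sumL f (g a)) l.
Proof. induction l as [|p l IH]; [reflexivity|]. simpl flat_map. rewrite sumL_app, IH. reflexivity. Qed.

Lemma sumL_map {T U : Type} (f : U -> R) (g : T -> U) l : sumL f (map g l) = sumL (fun a => f (g a)) l.
Proof. induction l as [|p l IH]; simpl; auto. now rewrite <- IH. Qed.

Definition lt_ind (a b : R) : R := if Rlt_dec a b then 1 else 0.

Lemma lt_ind_bounds a b : 0 <= lt_ind a b <= 1.
Proof. unfold lt_ind. destruct (Rlt_dec a b); lra. Qed.

Lemma lt_ind_1 a b : a < b -> lt_ind a b = 1.
Proof. unfold lt_ind. destruct (Rlt_dec a b); lra. Qed.

Lemma lt_ind_le a b c d : (a < b -> c < d) -> lt_ind a b <= lt_ind c d.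
Proof. unfold lt_ind. intros H. destruct (Rlt_dec a b); destruct (Rlt_dec c d); try lra; tauto. Qed.

Lemma count_integers y r M : 0 <= r ->
  sumL (fun j => lt_ind (Rabs (INR j - y)) r) (seq 0 M) <= 2 * r + 1.
Proof.
  intros Hr.
  (* The second bound carries the induction: counted integers below M exceed y - r, so there are at
     most M - (y - r) of them, and this is less than 2r when M is counted too. *)
  assert (H : sumL (fun j => lt_ind (Rabs (INR j - y)) r) (seq 0 M) <= 2 * r + 1 /\
    sumL (fun j => lt_ind (Rabs (INR j - y)) r) (seq 0 M) <= Rmax 0 (INR M - (y - r))); [|tauto].
  induction M as [|M [IH1 IH2]].
  - simpl. split; [lra|apply Rmax_l].
  - rewrite seq_S, sumL_app. cbn [plus sumL fold_right]. rewrite Rplus_0_r.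
    set (s := sumL _ (seq 0 M)) in *. rewrite S_INR.
    unfold lt_ind. destruct (Rlt_dec (Rabs (INR M - y)) r) as [C|C].
    + apply Rabs_def2 in C. rewrite Rmax_right in IH2 by lra. rewrite Rmax_right by lra. lra.
    + rewrite Rplus_0_r. split; auto. eapply Rle_trans; [exact IH2|]. apply Rle_max_compat_l. lra.
Qed.

Lemma count_progression h m x r M : 0 < h -> 0 <= r ->
  sumL (fun j => lt_ind (Rabs (h * (INR j - m) - x)) r) (seq 0 M) <= 2 * r / h + 1.
Proof.
  intros Hh Hr. replace (2 * r / h) with (2 * (r / h)) by (field; lra).
  eapply Rle_trans; [|apply (count_integers (m + x / h) (r / h) M)].
  - apply sumL_le. intros j _. apply lt_ind_le. intros H.
    apply (Rmult_lt_reg_l h); auto. replace (h * (r / h)) with r by (field; lra).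
    rewrite <- (Rabs_pos_eq h) at 1 by lra. rewrite <- Rabs_mult.
    replace (h * (INR j - (m + x / h))) with (h * (INR j - m) - x) by (field; lra). auto.
  - apply Rmult_le_pos; [auto|left; now apply Rinv_0_lt_compat].
Qed.

Fixpoint cube (h : R) (m k : nat) : list (nat -> R) :=
  match k with
  | O => (fun _ => 0) :: nil
  | S k' => flat_map (fun a => map (fun j i => if (i =? k')%nat then h * (INR j - INR m) else a i)
                                   (seq 0 (2 * m + 1))) (cube h m k')
  end.

(* Lattice points (h a, h^2 b) with |a_i| <= m and |b| <= m^2: homogeneous for the parabolic dilations. *)
Definition grid (n : nat) (h : R) (m : nat) : list Point :=
  flat_map (fun a => map (fun j => (a, h ^ 2 * (INR j - INR (m * m)))) (seq 0 (2 * (m * m) + 1)))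
    (cube h m (2 * n)).

Definition grid_at (n : nat) (c : Point) (h : R) (m : nat) : list Point := map (hmul n c) (grid n h m).

(** Indicator of a cube written as a product, so that counting factorises over the coordinates. *)
Fixpoint box_ind (k : nat) (x a : nat -> R) (r : R) : R :=
  match k with
  | O => 1
  | S k' => box_ind k' x a r * lt_ind (Rabs (a k' - x k')) r
  end.

Lemma box_ind_bounds k x a r : 0 <= box_ind k x a r <= 1.
Proof.
  induction k as [|k IH]; simpl; [lra|]. pose proof (lt_ind_bounds (Rabs (a k - x k)) r). nra.
Qed.

Lemma box_ind_ext k x a a' r : (forall i, (i < k)%nat -> a i = a' i) -> box_ind k x a r = box_ind k x a' r.
Proof.
  induction k as [|k IH]; intros H; simpl; auto. rewrite IH by (intros; apply H; lia).
  now rewrite H by lia.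
Qed.

Lemma box_ind_1 k x a r : (forall i, (i < k)%nat -> Rabs (a i - x i) < r) -> box_ind k x a r = 1.
Proof.
  induction k as [|k IH]; intros H; simpl; auto. rewrite IH by (intros; apply H; lia).
  rewrite lt_ind_1 by (apply H; lia). ring.
Qed.

Lemma cube_count h m k x r : 0 < h -> 0 <= r ->
  sumL (fun a => box_ind k x a r) (cube h m k) <= (2 * r / h + 1) ^ k.
Proof.
  intros Hh Hr. assert (Hq : 0 <= 2 * r / h) by (apply Rmult_le_pos; [lra|left; now apply Rinv_0_lt_compat]).
  induction k as [|k IH]; [simpl; lra|].
  cbn [cube]. rewrite sumL_flat_map. cbn [pow].
  apply Rle_trans with (sumL (fun a => (2 * r / h + 1) * box_ind k x a r) (cube h m k)).
  - apply sumL_le. intros a _. rewrite sumL_map.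
    rewrite (sumL_ext _ (fun j => box_ind k x a r * lt_ind (Rabs (h * (INR j - INR m) - x k)) r)).
    + rewrite sumL_scal, Rmult_comm. apply Rmult_le_compat_r; [apply box_ind_bounds|].
      now apply count_progression.
    + intros j _. cbn [box_ind]. rewrite Nat.eqb_refl. f_equal. apply box_ind_ext.
      intros i Hi. destruct (Nat.eqb_spec i k); [lia|auto].
  - rewrite sumL_scal. apply Rmult_le_compat_l; lra.
Qed.

(** After translation, the horizontal part a of a counted point lies in a cube of half-side r. For
    fixed a the shear only moves the centre of the t-interval, whose half-length stays r^2. Since h
    <= r, the 2n horizontal factors are at most 3 r/h each and the vertical one at most 3
    (r/h)^2. *)
Lemma grid_at_count n c h m z r : 0 < h -> h <= r ->
  sumL (fun p => lt_ind (dH n p z) r) (grid_at n c h m) <= 3 ^ (2 * n + 1) * (r / h) ^ (2 * n + 2).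
Proof.
  intros Hh Hr. unfold grid_at. rewrite sumL_map.
  set (w := hmul n (hinv c) z).
  assert (Hz : z = hmul n c w) by (unfold w; now rewrite <- hmul_assoc, hmul_inv_r, hmul_one_l).
  assert (H1 : 1 <= r / h).
  { apply (Rmult_le_reg_r h); auto. unfold Rdiv. rewrite Rmult_assoc, Rinv_l; lra. }
  assert (H2 : 0 <= r ^ 2) by apply pow2_ge_0.
  apply Rle_trans with ((2 * r / h + 1) ^ (2 * n) * (2 * r ^ 2 / h ^ 2 + 1)).
  - unfold grid. rewrite sumL_flat_map.
    apply Rle_trans with (sumL (fun a => (2 * r ^ 2 / h ^ 2 + 1) * box_ind (2 * n) (fst w) a r) (cube h m (2 * n))).
    + apply sumL_le. intros a _. rewrite sumL_map.
      apply Rle_trans with (sumL (fun j => box_ind (2 * n) (fst w) a r *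
         lt_ind (Rabs (h ^ 2 * (INR j - INR (m * m)) - (snd w - 2 * dotR n (Jx n a) (fst w)))) (r ^ 2))
         (seq 0 (2 * (m * m) + 1))).
      * apply sumL_le. intros j _. rewrite Hz, dH_left.
        set (p := (a, h ^ 2 * (INR j - INR (m * m))) : Point).
        unfold lt_ind at 1. destruct (Rlt_dec (dH n p w) r) as [C|C].
        -- rewrite box_ind_1, lt_ind_1; [lra| |].
           ++ pose proof (dH_t n p w) as T. pose proof (dH_nonneg n p w).
              assert (dH n p w ^ 2 < r ^ 2) by (rewrite <- !Rsqr_pow2; apply Rsqr_incrst_1; lra).
              unfold p in T at 1 2; cbn [fst snd] in T. rewrite Rabs_minus_sym.
              replace (snd w - 2 * dotR n (Jx n a) (fst w) - h ^ 2 * (INR j - INR (m * m))) with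
                (snd w - h ^ 2 * (INR j - INR (m * m)) - 2 * dotR n (Jx n a) (fst w)) by ring. lra.
           ++ intros i Hi. pose proof (dH_x_coord n p w i Hi) as X.
              rewrite Rabs_minus_sym. unfold p in X at 1; cbn [fst] in X. lra.
        -- apply Rmult_le_pos; [apply box_ind_bounds|apply lt_ind_bounds].
      * rewrite sumL_scal, Rmult_comm. apply Rmult_le_compat_r; [apply box_ind_bounds|].
        apply count_progression; [apply pow_lt; lra|auto].
    + rewrite sumL_scal, Rmult_comm. apply Rmult_le_compat_r.
      * assert (0 <= 2 * r ^ 2 / h ^ 2); [|lra].
        apply Rmult_le_pos; [lra|left; apply Rinv_0_lt_compat, pow_lt; lra].
      * apply cube_count; lra.
  - replace (3 ^ (2 * n + 1) * (r / h) ^ (2 * n + 2)) with ((3 * (r / h)) ^ (2 * n) * (3 * (r / h) ^ 2))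
      by (rewrite Rpow_mult_distr, !pow_add; ring).
    apply Rmult_le_compat.
    + apply pow_le. unfold Rdiv in *. nra.
    + assert (0 <= 2 * r ^ 2 / h ^ 2); [|lra].
      apply Rmult_le_pos; [lra|left; apply Rinv_0_lt_compat, pow_lt; lra].
    + apply pow_incr. unfold Rdiv in *. nra.
    + replace (2 * r ^ 2 / h ^ 2) with (2 * (r / h) ^ 2) by (field; lra). nra.
Qed.

Lemma length_cube h m k : INR (length (cube h m k)) = (2 * INR m + 1) ^ k.
Proof.
  rewrite <- (Rmult_1_r (INR _)), <- sumL_const. induction k as [|k IH]; [simpl; ring|].
  cbn [cube pow]. rewrite sumL_flat_map.
  rewrite (sumL_ext _ (fun _ => (2 * INR m + 1) * 1)).
  - rewrite sumL_scal, IH. reflexivity.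
  - intros a _. rewrite sumL_const, length_map, length_seq, plus_INR, mult_INR. simpl. ring.
Qed.

Lemma length_grid_at n c h m : INR m ^ (2 * n + 2) <= INR (length (grid_at n c h m)).
Proof.
  unfold grid_at. rewrite length_map. unfold grid.
  rewrite <- (Rmult_1_r (INR (length _))), <- sumL_const, sumL_flat_map.
  rewrite (sumL_ext _ (fun _ => 2 * INR m ^ 2 + 1)).
  - rewrite sumL_const, length_cube, pow_add. pose proof (pos_INR m).
    apply Rmult_le_compat; try (apply pow_le; lra); [apply pow_incr; lra|].
    pose proof (pow2_ge_0 (INR m)). lra.
  - intros a _. rewrite sumL_const, length_map, length_seq, plus_INR, !mult_INR. simpl. ring.
Qed.

Lemma abs_progression h m j : 0 <= h -> (j < 2 * m + 1)%nat -> Rabs (h * (INR j - INR m)) <= h * INR m.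
Proof.
  intros Hh Hj. rewrite Rabs_mult, (Rabs_pos_eq h) by auto. apply Rmult_le_compat_l; auto.
  assert (INR j <= INR (2 * m)) by (apply le_INR; lia). rewrite mult_INR in H. simpl in H.
  pose proof (pos_INR j). apply Rabs_le. lra.
Qed.

Lemma cube_coord h m k a : 0 <= h -> In a (cube h m k) ->
  (forall i, Rabs (a i) <= h * INR m) /\ (forall i, (k <= i)%nat -> a i = 0).
Proof.
  intros Hh. revert a. induction k as [|k IH]; intros a Ha.
  - destruct Ha as [<-|[]]. split; auto. intros _. rewrite Rabs_R0. apply Rmult_le_pos; [auto|apply pos_INR].
  - cbn [cube] in Ha. apply in_flat_map in Ha. destruct Ha as [a' [Ha' Hin]].
    apply in_map_iff in Hin. destruct Hin as [j [<- Hj]]. apply in_seq in Hj.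
    destruct (IH a' Ha') as [I1 I2]. split.
    + intros i. destruct (i =? k)%nat; auto. apply abs_progression; auto. lia.
    + intros i Hi. destruct (Nat.eqb_spec i k); [lia|]. apply I2; lia.
Qed.

(** The factor 2n + 1 is crude: rho^4 is at most (4n^2 + 1)(h m)^4. *)
Lemma grid_at_in n c h m p : 0 <= h -> inH n c -> In p (grid_at n c h m) ->
  inH n p /\ dH n c p <= (2 * INR n + 1) * (h * INR m).
Proof.
  intros Hh Hc Hp. unfold grid_at in Hp. apply in_map_iff in Hp. destruct Hp as [w [<- Hw]].
  unfold grid in Hw. apply in_flat_map in Hw. destruct Hw as [a [Ha Hw]].
  apply in_map_iff in Hw. destruct Hw as [j [<- Hj]]. apply in_seq in Hj.
  destruct (cube_coord h m (2 * n) a Hh Ha) as [H1 H2].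
  split.
  - apply inH_mul; auto.
  - rewrite dH_mul_r. pose proof (pos_INR n) as Pn. pose proof (pos_INR m) as Pm.
    assert (P : 0 <= h * INR m) by (apply Rmult_le_pos; auto).
    apply pow4_le; [apply Rmult_le_pos; lra|]. rewrite rho_pow4. cbn [fst snd].
    assert (D : dotR n a a <= 2 * INR n * (h * INR m) ^ 2).
    { replace (2 * INR n) with (INR (2 * n)) by (rewrite mult_INR; simpl; ring).
      rewrite <- sumR_const. apply sumR_le. intros i _. rewrite <- Rsqr_pow2.
      change (a i * a i) with (Rsqr (a i)). rewrite Rsqr_abs. apply Rsqr_incr_1; auto. apply Rabs_pos. }
    assert (E : Rabs (h ^ 2 * (INR j - INR (m * m))) <= (h * INR m) ^ 2).
    { replace ((h * INR m) ^ 2) with (h ^ 2 * INR (m * m)) by (rewrite mult_INR; ring).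
      apply abs_progression; [apply pow2_ge_0|lia]. }
    set (y := (h * INR m) ^ 2) in *. set (t := h ^ 2 * _) in *.
    assert (Y : 0 <= y) by apply pow2_ge_0. pose proof (dotR_self_nonneg n a).
    apply Rle_trans with ((2 * INR n * y) ^ 2 + y ^ 2).
    + apply Rplus_le_compat; [apply pow_incr; auto|].
      rewrite <- pow2_abs. apply pow_incr. split; [apply Rabs_pos|auto].
    + rewrite (Rpow_mult_distr (2 * INR n + 1)). replace ((h * INR m) ^ 4) with (y ^ 2) by (unfold y; ring).
      replace ((2 * INR n * y) ^ 2 + y ^ 2) with ((4 * INR n ^ 2 + 1) * y ^ 2) by ring.
      apply Rmult_le_compat_r; [apply pow2_ge_0|].
      replace ((2 * INR n + 1) ^ 4) with ((4 * INR n ^ 2 + 4 * INR n + 1) ^ 2) by ring. nra.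
Qed.

(* The counting bound says that normalised counting measure on E is at most Q-dimensional, Q = 2n+2, so
   that its potential of order Q-1 is bounded: sum over dyadic shells. *)
Lemma potential_bound n (E : list Point) z h C0 D : 0 < h -> h <= D ->
  (forall r, h <= r -> sumL (fun p => lt_ind (dH n p z) r) E <= C0 * (r / h) ^ (2 * n + 2)) ->
  (forall p, In p E -> h <= dH n p z <= D) ->
  sumL (fun p => (/ dH n p z) ^ (2 * n + 1)) E <= C0 * 2 ^ (2 * n + 3) * D / h ^ (2 * n + 2).
Proof.
  intros Hh HD Hcount HS.
  assert (HC0 : 0 <= C0).
  { specialize (Hcount h (Rle_refl h)). replace (h / h) with 1 in Hcount by (field; lra).
    rewrite pow1, Rmult_1_r in Hcount. eapply Rle_trans; [|exact Hcount].
    apply sumL_nonneg. intros; apply lt_ind_bounds. }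
  (* The shell between 2^k h and 2^(k+1) h contributes at most (2^k h)^(1-Q) C0 2^((k+1)Q), which
     equals the bound already reached at k; adding it doubles that bound. *)
  assert (Hk : forall k, sumL (fun p => lt_ind (dH n p z) (2 ^ k * h) * (/ dH n p z) ^ (2 * n + 1)) E
     <= C0 * 2 ^ (2 * n + 2) * (/ h) ^ (2 * n + 1) * 2 ^ k).
  { assert (P : 0 < (/ h) ^ (2 * n + 1)) by (apply pow_lt, Rinv_0_lt_compat; auto).
    induction k as [|k IH].
    - rewrite (sumL_ext _ (fun _ => 0)).
      + rewrite sumL_const, Rmult_0_r. repeat apply Rmult_le_pos; try lra. apply pow_le; lra.
      + intros p Hp. unfold lt_ind. destruct (Rlt_dec (dH n p z) (2 ^ 0 * h)) as [C|C]; [|ring].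
        specialize (HS p Hp). simpl in C. lra.
    - assert (P2 : 0 < 2 ^ k) by (apply pow_lt; lra).
      assert (P3 : 1 <= 2 ^ k) by (apply pow_R1_Rle; lra).
      apply Rle_trans with (sumL (fun p => lt_ind (dH n p z) (2 ^ k * h) * (/ dH n p z) ^ (2 * n + 1)
          + (/ (2 ^ k * h)) ^ (2 * n + 1) * lt_ind (dH n p z) (2 ^ S k * h)) E).
      + apply sumL_le. intros p Hp. destruct (HS p Hp) as [H1 H2].
        assert (0 <= (/ (2 ^ k * h)) ^ (2 * n + 1)) by (apply pow_le; left; apply Rinv_0_lt_compat; nra).
        unfold lt_ind. destruct (Rlt_dec (dH n p z) (2 ^ S k * h)) as [C|C];
          destruct (Rlt_dec (dH n p z) (2 ^ k * h)) as [C'|C'].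
        * lra.
        * assert ((/ dH n p z) ^ (2 * n + 1) <= (/ (2 ^ k * h)) ^ (2 * n + 1)); [|lra].
          apply pow_incr. split; [left; apply Rinv_0_lt_compat; lra|].
          apply Rinv_le_contravar; [nra|lra].
        * cbn [pow] in C. exfalso. nra.
        * lra.
      + rewrite sumL_plus, sumL_scal.
        assert (H : sumL (fun p => lt_ind (dH n p z) (2 ^ S k * h)) E <= C0 * (2 ^ S k) ^ (2 * n + 2)).
        { eapply Rle_trans; [apply Hcount|].
          - cbn [pow]. nra.
          - replace (2 ^ S k * h / h) with (2 ^ S k) by (field; lra). lra. }
        apply (Rmult_le_compat_l ((/ (2 ^ k * h)) ^ (2 * n + 1))) in H;
          [|apply pow_le; left; apply Rinv_0_lt_compat; nra].
        replace ((/ (2 ^ k * h)) ^ (2 * n + 1) * (C0 * (2 ^ S k) ^ (2 * n + 2))) with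
          (C0 * 2 ^ (2 * n + 2) * (/ h) ^ (2 * n + 1) * 2 ^ k) in H.
        * cbn [pow] in *. lra.
        * rewrite Rinv_mult. cbn [pow]. rewrite !Rpow_mult_distr.
          replace (2 * n + 2)%nat with ((2 * n + 1) + 1)%nat at 3 by lia.
          rewrite (pow_add (2 ^ k) (2 * n + 1) 1), pow_1.
          replace ((/ 2 ^ k) ^ (2 * n + 1) * (/ h) ^ (2 * n + 1) * (C0 * (2 ^ (2 * n + 2) * ((2 ^ k) ^ (2 * n + 1) * 2 ^ k))))
           with (((/ 2 ^ k) ^ (2 * n + 1) * (2 ^ k) ^ (2 * n + 1)) * (C0 * 2 ^ (2 * n + 2) * (/ h) ^ (2 * n + 1) * 2 ^ k)) by ring.
          rewrite <- Rpow_mult_distr, Rinv_l by lra. rewrite pow1. ring. }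
  (* The first dyadic radius beyond D captures every point and costs at most a factor 2. *)
  assert (Hx : exists k, D < 2 ^ k * h /\ 2 ^ k * h <= 2 * D).
  { assert (U : exists k, D < 2 ^ k * h).
    { destruct (Pow_x_infinity 2 ltac:(rewrite Rabs_pos_eq; lra) (D / h + 1)) as [N HN].
      exists N. specialize (HN N (le_n N)). rewrite Rabs_pos_eq in HN by (apply pow_le; lra).
      apply Rle_lt_trans with ((D / h) * h); [apply Req_le; field; lra|]. apply Rmult_lt_compat_r; lra. }
    destruct U as [k0 Hk0]. revert Hk0. induction k0 as [|k0 IH]; intros Hk0.
    - simpl in Hk0. lra.
    - destruct (Rlt_or_le D (2 ^ k0 * h)) as [C|C]; auto.
      exists (S k0). split; auto. cbn [pow]. lra. }
  destruct Hx as [k [Hk1 Hk2]]. specialize (Hk k).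
  rewrite (sumL_ext _ (fun p => (/ dH n p z) ^ (2 * n + 1))) in Hk.
  - eapply Rle_trans; [exact Hk|].
    replace (C0 * 2 ^ (2 * n + 3) * D / h ^ (2 * n + 2)) with
      (C0 * 2 ^ (2 * n + 2) * (/ h) ^ (2 * n + 1) * (2 * D / h)).
    + apply Rmult_le_compat_l.
      * repeat apply Rmult_le_pos; auto; apply pow_le; [lra|left; now apply Rinv_0_lt_compat].
      * apply (Rmult_le_reg_r h); auto. replace (2 * D / h * h) with (2 * D) by (field; lra). auto.
    + replace (2 * n + 3)%nat with (S (2 * n + 2)) by lia.
      replace (2 * n + 2)%nat with (S (2 * n + 1)) at 3 by lia. cbn [pow]. rewrite pow_inv.
      field. split; [|lra]. apply pow_nonzero. lra.
  - intros p Hp. rewrite lt_ind_1; [ring|]. specialize (HS p Hp). lra.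
Qed.

(** * The growth lemma *)

Lemma Rpower_neg_le x y a : 0 < x -> x <= y -> 0 <= a -> Rpower y (- a) <= Rpower x (- a).
Proof.
  intros Hx Hxy Ha. rewrite !Rpower_Ropp. apply Rinv_le_contravar; [apply exp_pos|].
  apply Rle_Rpower_l; lra.
Qed.

Lemma Rpower_gauge n lam d : 0 < lam -> 0 < d ->
  Rpower (lam ^ 2 * d ^ 4) (- ((2 * INR n + 1) / 4)) =
  Rpower (lam ^ 2) (- ((2 * INR n + 1) / 4)) * (/ d) ^ (2 * n + 1).
Proof.
  intros Hl Hd. rewrite <- Rpower_mult_distr by (apply pow_lt; auto). f_equal.
  rewrite <- (Rpower_pow 4 d), Rpower_mult by auto.
  replace (INR 4 * - ((2 * INR n + 1) / 4)) with (- INR (2 * n + 1))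
    by (rewrite plus_INR, mult_INR; simpl; field).
  rewrite Rpower_Ropp, Rpower_pow, pow_inv by auto. reflexivity.
Qed.

Lemma barrier_bounds n lam Lam A0 p z : 0 < lam <= 1 -> 1 <= Lam -> sympl_spd n lam Lam A0 -> 0 < dH n p z ->
  Rpower (Lam ^ 2) (- ((2 * INR n + 1) / 4)) * (/ dH n p z) ^ (2 * n + 1) <= barrier n (JtAJ n A0) p z
  <= Rpower (lam ^ 2) (- ((2 * INR n + 1) / 4)) * (/ dH n p z) ^ (2 * n + 1).
Proof.
  intros Hl HL HA Hd.
  destruct (phiB_bounds n lam Lam A0 (hmul n (hinv p) z) Hl HL HA) as [H1 H2]. fold (dH n p z) in H1, H2.
  assert (P : 0 < lam ^ 2 * dH n p z ^ 4) by (apply Rmult_lt_0_compat; apply pow_lt; lra).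
  assert (Q : 0 <= (2 * INR n + 1) / 4) by (pose proof (pos_INR n); lra).
  rewrite <- !Rpower_gauge by lra. split; apply Rpower_neg_le; auto; lra.
Qed.

Definition count_const (n : nat) : R := 3 ^ (2 * n + 1).
(** At lam this is the upper, at Lam the lower constant comparing the barrier with d^(1-Q). *)
Definition barrier_coef (n : nat) (lam : R) : R := Rpower (lam ^ 2) (- ((2 * INR n + 1) / 4)).
(** Chosen so that (K - 1)/2 = 1 + 2 ku/kl, where ku and kl are the upper and lower barrier
    constants: the potential on the outer sphere is then at most half its lower bound on the inner
    ball. *)
Definition growth_radius (n : nat) (lam Lam : R) : R := 3 + 4 * barrier_coef n lam / barrier_coef n Lam.
(** The two entries serve the two cases of [growth]: a point z closer than h to E, and one at
    distance at least h from all of E. *)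
Definition growth_const (n : nat) (lam Lam : R) : R :=
  Rmin (/ (count_const n * 2 ^ (2 * n + 2)))
       (barrier_coef n Lam / (2 ^ (2 * n + 2) * barrier_coef n lam * count_const n * 2 ^ (2 * n + 3) * (growth_radius n lam Lam + 1))).

Lemma barrier_coef_pos n lam : 0 < barrier_coef n lam.
Proof. apply exp_pos. Qed.

Lemma count_const_pos n : 0 < count_const n.
Proof. apply pow_lt; lra. Qed.

Lemma growth_radius_ge n lam Lam : 3 <= growth_radius n lam Lam.
Proof.
  unfold growth_radius. pose proof (barrier_coef_pos n lam). pose proof (barrier_coef_pos n Lam).
  assert (0 < 4 * barrier_coef n lam / barrier_coef n Lam) by (apply Rdiv_lt_0_compat; lra). lra.
Qed.

Lemma growth_const_pos n lam Lam : 0 < growth_const n lam Lam.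
Proof.
  pose proof (barrier_coef_pos n lam). pose proof (barrier_coef_pos n Lam). pose proof (count_const_pos n).
  pose proof (growth_radius_ge n lam Lam).
  apply Rmin_glb_lt.
  - apply Rinv_0_lt_compat, Rmult_lt_0_compat; auto. apply pow_lt; lra.
  - apply Rdiv_lt_0_compat; auto. repeat apply Rmult_lt_0_compat; auto; try lra; apply pow_lt; lra.
Qed.

Lemma pow_ge_self x k : 1 <= x -> (1 <= k)%nat -> x <= x ^ k.
Proof.
  intros Hx Hk. destruct k as [|k]; [lia|]. simpl. assert (1 <= x ^ k) by (apply pow_R1_Rle; auto). nra.
Qed.

(* Comparison with the truncated potential of normalised counting measure on E yields the linear dependence
   on the measure of E; no covering argument is needed. *)
Lemma growth n lam Lam eps A0 A c rho0 h ell v E :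
  (1 <= n)%nat -> 0 < lam <= 1 -> 1 <= Lam -> sympl_spd n lam Lam A0 -> eps_small n lam Lam eps ->
  0 < h -> h <= rho0 -> 0 < ell ->
  (forall z, inH n z -> dH n c z < growth_radius n lam Lam * rho0 -> close_to n lam eps A0 (A z)) ->
  solves n A c (growth_radius n lam Lam * rho0) v ->
  seq_cont n (cball n c (growth_radius n lam Lam * rho0)) v ->
  (forall z, cball n c (growth_radius n lam Lam * rho0) z -> 0 <= v z) ->
  (forall p, In p E -> dH n c p <= rho0) ->
  (forall z r, h <= r -> sumL (fun p => lt_ind (dH n p z) r) E <= count_const n * (r / h) ^ (2 * n + 2)) ->
  (forall p z, In p E -> cball n c (growth_radius n lam Lam * rho0) z -> dH n p z <= h -> ell <= v z) ->
  forall z, cball n c rho0 z -> growth_const n lam Lam * ell * INR (length E) * (h / rho0) ^ (2 * n + 2) <= v z.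
Proof.
  intros Hn Hl HL HA0 Heps Hh Hhr Hell HA Hv Hvc Hv0 HE Hcount HS z Hz.
  set (K := growth_radius n lam Lam) in *. set (N := INR (length E)).
  pose proof (growth_radius_ge n lam Lam) as HK. fold K in HK.
  pose proof (barrier_coef_pos n lam) as Hku. pose proof (barrier_coef_pos n Lam) as Hkl.
  pose proof (count_const_pos n) as HC0. pose proof (growth_const_pos n lam Lam) as Hc1.
  set (ku := barrier_coef n lam) in *. set (kl := barrier_coef n Lam) in *. set (C0 := count_const n) in *.
  assert (Hr : 0 < rho0) by lra.
  assert (HN : 0 <= N) by apply pos_INR.
  assert (Hzc : cball n c (K * rho0) z) by (destruct Hz; split; auto; nra).
  set (th := (h / rho0) ^ (2 * n + 2)).
  assert (Hth : 0 < th) by (apply pow_lt, Rdiv_lt_0_compat; auto).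
  (* The potential is available only at distance at least h from E. Nearer, v z >= ell holds by
     hypothesis, and it remains to bound the relative number of points. *)
  destruct (classic (forall p, In p E -> h <= dH n p z)) as [Hfar|Hnear].
  2:{ assert (Hex : exists p, In p E /\ dH n p z < h).
      { apply NNPP. intros C. apply Hnear. intros p Hp. destruct (Rle_or_lt h (dH n p z)); auto.
        exfalso; apply C; eauto. }
      destruct Hex as [p [Hp Hd]]. pose proof (HS p z Hp Hzc ltac:(lra)) as Q.
      eapply Rle_trans; [|exact Q].
      (* The radius 2 rho0 rather than rho0 makes the strict inequality in [lt_ind] hold for all of
         E. *)
      assert (Hcnt : N <= C0 * (2 * rho0 / h) ^ (2 * n + 2)).
      { eapply Rle_trans; [|apply (Hcount c); lra]. unfold N. rewrite <- (Rmult_1_r (INR _)), <- sumL_const.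
        apply sumL_le. intros p' Hp'. rewrite lt_ind_1; [lra|]. rewrite dH_sym. specialize (HE p' Hp'). lra. }
      assert (N * th <= C0 * 2 ^ (2 * n + 2)).
      { apply Rle_trans with (C0 * (2 * rho0 / h) ^ (2 * n + 2) * th); [apply Rmult_le_compat_r; lra|].
        unfold th. rewrite Rmult_assoc, <- Rpow_mult_distr.
        replace (2 * rho0 / h * (h / rho0)) with 2 by (field; lra). lra. }
      assert (HP : 0 < C0 * 2 ^ (2 * n + 2)) by (apply Rmult_lt_0_compat; auto; apply pow_lt; lra).
      assert (Hc : growth_const n lam Lam * (C0 * 2 ^ (2 * n + 2)) <= 1).
      { apply Rle_trans with (/ (C0 * 2 ^ (2 * n + 2)) * (C0 * 2 ^ (2 * n + 2))).
        - apply Rmult_le_compat_r; [lra|apply Rmin_l].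
        - rewrite Rinv_l; lra. }
      apply Rle_trans with (ell * (growth_const n lam Lam * (N * th))); [apply Req_le; ring|].
      rewrite <- (Rmult_1_r ell) at 2. apply Rmult_le_compat_l; [lra|].
      eapply Rle_trans; [|exact Hc]. apply Rmult_le_compat_l; lra. }
  set (s := (2 * n + 1)%nat).
  (* Points of E lie at distance at most (K+1) rho0 from any point of the large ball and at least
     (K-1) rho0 from its boundary sphere. *)
  set (M := ku * (C0 * 2 ^ (2 * n + 3) * ((K + 1) * rho0) / h ^ (2 * n + 2))).
  set (b := N * (ku * (/ ((K - 1) * rho0)) ^ s)).
  set (W := fun z => sumL (fun p => barrier n (JtAJ n A0) p z) E).
  assert (HM : 0 < M).
  { unfold M. apply Rmult_lt_0_compat; auto. apply Rdiv_lt_0_compat; [|apply pow_lt; auto].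
    repeat apply Rmult_lt_0_compat; auto; try lra. apply pow_lt; lra. }
  assert (HKr : 0 < (K - 1) * rho0) by (apply Rmult_lt_0_compat; lra).
  assert (Hb : 0 <= b).
  { unfold b. repeat apply Rmult_le_pos; auto; try lra. apply pow_le. left. now apply Rinv_0_lt_compat. }
  assert (HW : forall y, (forall p, In p E -> h <= dH n p y) -> W y <= ku * sumL (fun p => (/ dH n p y) ^ s) E).
  { intros y Hy. rewrite <- sumL_scal. apply sumL_le. intros p Hp.
    apply (barrier_bounds n lam Lam A0 p y); auto. specialize (Hy p Hp). lra. }
  assert (HWl : N * kl * (/ (2 * rho0)) ^ s <= W z).
  { unfold N. rewrite Rmult_assoc, <- sumL_const. apply sumL_le. intros p Hp. pose proof (Hfar p Hp).
    eapply Rle_trans; [|apply (barrier_bounds n lam Lam A0 p z); auto; lra].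
    apply Rmult_le_compat_l; [unfold kl, barrier_coef; left; apply exp_pos|].
    apply pow_incr. split; [left; apply Rinv_0_lt_compat; lra|]. apply Rinv_le_contravar; [lra|].
    pose proof (dH_tri n p c z). rewrite (dH_sym n p c) in H0. specialize (HE p Hp). destruct Hz. lra. }
  assert (Hb2 : 2 * b <= N * kl * (/ (2 * rho0)) ^ s).
  { unfold b. replace (2 * (N * (ku * (/ ((K - 1) * rho0)) ^ s))) with (N * (2 * ku * (/ ((K - 1) * rho0)) ^ s)) by ring.
    rewrite (Rmult_assoc N kl). apply Rmult_le_compat_l; auto.
    (* The outer distance (K-1) rho0 is T times the inner one 2 rho0. As T >= 1, the power T^(Q-1)
       is at least T, which already beats the ratio 2 ku/kl. *)
    set (T := 1 + 2 * ku / kl).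
    assert (HT1 : 0 < 2 * ku / kl) by (apply Rdiv_lt_0_compat; lra).
    assert (HT : T <= T ^ s) by (apply pow_ge_self; [unfold T; lra|unfold s; lia]).
    replace ((K - 1) * rho0) with (T * (2 * rho0)) by (unfold K, growth_radius, T; fold ku kl; field; lra).
    rewrite Rinv_mult, Rpow_mult_distr, <- Rmult_assoc.
    apply Rmult_le_compat_r; [apply pow_le; left; apply Rinv_0_lt_compat; lra|].
    rewrite pow_inv. assert (HTp : 0 < T ^ s) by (apply pow_lt; unfold T; lra).
    apply (Rmult_le_reg_r (T ^ s)); auto. rewrite Rmult_assoc, Rinv_l by lra.
    apply Rle_trans with (kl * T); [|apply Rmult_le_compat_l; lra].
    unfold T. rewrite Rmult_plus_distr_l. replace (kl * (2 * ku / kl)) with (2 * ku) by (field; lra). lra. }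
  assert (Hcmp : ell * (W z - b) / M <= v z).
  { apply (comparison n lam Lam eps A0 Hn Hl HL HA0 Heps A c (K * rho0) h ell M b v E); auto; try nra.
    - intros y Hy Hy2. eapply Rle_trans; [apply HW; auto|]. unfold M.
      apply Rmult_le_compat_l; [lra|]. unfold s. apply potential_bound; auto.
      + nra.
      + intros p Hp. split; auto. pose proof (dH_tri n p c y). rewrite (dH_sym n p c) in H.
        specialize (HE p Hp). destruct Hy. nra.
    - intros y Hy Hyr Hy2. eapply Rle_trans; [apply HW; auto|]. unfold b, N.
      rewrite (Rmult_comm (INR _)), Rmult_assoc, (Rmult_comm _ (INR _)), <- sumL_const.
      apply Rmult_le_compat_l; [lra|].
      apply sumL_le. intros p Hp. apply pow_incr.
      specialize (Hy2 p Hp). split; [left; apply Rinv_0_lt_compat; lra|].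
      apply Rinv_le_contravar; auto. pose proof (dH_tri n c p y). specialize (HE p Hp). lra. }
  eapply Rle_trans; [|exact Hcmp].
  apply Rle_trans with (ell * (N * kl * (/ (2 * rho0)) ^ s / 2) / M).
  2:{ unfold Rdiv at 1 3. apply Rmult_le_compat_r; [left; now apply Rinv_0_lt_compat|].
      apply Rmult_le_compat_l; lra. }
  apply Rle_trans with (kl / (2 ^ (2 * n + 2) * ku * C0 * 2 ^ (2 * n + 3) * (K + 1)) * ell * N * th).
  - apply Rmult_le_compat_r; [lra|]. apply Rmult_le_compat_r; auto. apply Rmult_le_compat_r; [lra|].
    apply Rmin_r.
  - apply Req_le. unfold th, M, s. rewrite pow_inv, Rpow_mult_distr. unfold Rdiv.
    rewrite (Rpow_mult_distr h), pow_inv. replace (2 * n + 2)%nat with (S (2 * n + 1)) by lia. cbn [pow].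
    assert (0 < 2 ^ (2 * n + 1)) by (apply pow_lt; lra).
    assert (0 < 2 ^ (2 * n + 3)) by (apply pow_lt; lra).
    assert (0 < rho0 ^ (2 * n + 1)) by (apply pow_lt; lra).
    assert (0 < h ^ (2 * n + 1)) by (apply pow_lt; lra).
    field. repeat split; lra.
Qed.

(** * Radius of a ball of bounded measure *)

Fixpoint prodR (N : nat) (f : nat -> R) : R :=
  match N with O => 1 | S k => prodR k f * f k end.

Lemma box_vol_prodR n a b : box_vol n a b = prodR (S (2 * n)) (fun k => b k - a k).
Proof.
  assert (H : forall N, (fix prodv (N : nat) : R :=
     match N with O => 1 | S k => prodv k * (b k - a k) end) N = prodR N (fun k => b k - a k)).
  { induction N as [|N IH]; [reflexivity|]. cbn [prodR]. now rewrite <- IH. }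
  exact (H (S (2 * n))).
Qed.

Lemma prodR_ext N f g : (forall k, (k < N)%nat -> f k = g k) -> prodR N f = prodR N g.
Proof.
  induction N as [|N IH]; intros H; simpl; auto. rewrite IH by (intros; apply H; lia). now rewrite H by lia.
Qed.

Lemma prodR_nonneg N f : (forall k, (k < N)%nat -> 0 <= f k) -> 0 <= prodR N f.
Proof.
  induction N as [|N IH]; intros H; simpl; [lra|].
  apply Rmult_le_pos; [apply IH; intros; apply H; lia|apply H; lia].
Qed.

Lemma prodR_pos N f : (forall k, (k < N)%nat -> 0 < f k) -> 0 < prodR N f.
Proof.
  induction N as [|N IH]; intros H; simpl; [lra|].
  apply Rmult_lt_0_compat; [apply IH; intros; apply H; lia|apply H; lia].
Qed.

Lemma prodR_le N f g : (forall k, (k < N)%nat -> 0 <= f k <= g k) -> prodR N f <= prodR N g.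
Proof.
  induction N as [|N IH]; intros H; simpl; [lra|].
  apply Rmult_le_compat; [apply prodR_nonneg; intros; apply H; lia|apply H; lia
    |apply IH; intros; apply H; lia|apply H; lia].
Qed.

Lemma prodR_const N c : prodR N (fun _ => c) = c ^ N.
Proof. induction N as [|N IH]; simpl; [auto|]. rewrite IH. ring. Qed.

Lemma prodR_split_factor N f g e k : (k < N)%nat ->
  (forall i, (i < N)%nat -> i <> k -> f i = e i /\ g i = e i) ->
  (forall i, (i < N)%nat -> 0 <= e i) -> f k + g k <= e k -> prodR N f + prodR N g <= prodR N e.
Proof.
  induction N as [|N IH]; intros Hk H He Hs; [lia|]. cbn [prodR].
  destruct (Nat.eq_dec k N) as [->|E].
  - rewrite (prodR_ext N f e), (prodR_ext N g e) by (intros; apply H; lia).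
    rewrite <- Rmult_plus_distr_l. apply Rmult_le_compat_l; auto. apply prodR_nonneg. intros; apply He; lia.
  - destruct (H N) as [-> ->]; [lia|lia|]. rewrite <- Rmult_plus_distr_r.
    apply Rmult_le_compat_r; [apply He; lia|]. apply IH; auto; try lia.
Qed.

Lemma prodR_scale_factor N f e k c : (k < N)%nat ->
  (forall i, (i < N)%nat -> i <> k -> f i = e i) -> f k = c * e k -> prodR N f = c * prodR N e.
Proof.
  induction N as [|N IH]; intros Hk H Hs; [lia|]. cbn [prodR].
  destruct (Nat.eq_dec k N) as [->|E].
  - rewrite (prodR_ext N f e) by (intros; apply H; lia). rewrite Hs. ring.
  - rewrite H by lia. rewrite IH; auto; try lia. ring.
Qed.

Lemma prodR_enlarge N f e : 0 < e -> exists d, 0 < d /\ prodR N (fun k => f k + 2 * d) <= prodR N f + e.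
Proof.
  intros He.
  assert (Hc : continuity_pt (fun d => prodR N (fun k => f k + 2 * d)) 0).
  { induction N as [|N IH]; cbn [prodR].
    - apply continuity_pt_const. intros x y; reflexivity.
    - apply (continuity_pt_mult (fun d => prodR N (fun k => f k + 2 * d)) (fun d => f N + 2 * d)); auto.
      apply derivable_continuous_pt. reg. }
  destruct (Hc e He) as [d [Hd Hd']]. exists (d / 2). split; [lra|].
  assert (Q : Rabs (prodR N (fun k => f k + 2 * (d / 2)) - prodR N (fun k => f k + 2 * 0)) < e).
  { apply (Hd' (d / 2)). split; [split; [exact I|lra]|]. simpl. unfold Rdist.
    rewrite Rabs_pos_eq; lra. }
  rewrite (prodR_ext N (fun k => f k + 2 * 0) f) in Q by (intros; ring).
  apply Rabs_def2 in Q. lra.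
Qed.

(** * Bisecting a box relative to a countable family of boxes *)

Section Bisection.
Variables (D : nat) (ca cb : nat -> nat -> R).

Let overlap (j : nat) (a b : nat -> R) : R :=
  prodR D (fun k => Rmax 0 (Rmin (cb j k) (b k) - Rmax (ca j k) (a k))).
Let vol (a b : nat -> R) : R := prodR D (fun k => b k - a k).

(** The family, counted with multiplicity, fills at most the fraction theta of the box; bounding all
    partial sums expresses this for the infinite sum. *)
Definition underfilled (theta : R) (a b : nat -> R) : Prop :=
  forall N, sumR N (fun j => overlap j a b) <= theta * vol a b.

Lemma overlap_nonneg j a b : 0 <= overlap j a b.
Proof. apply prodR_nonneg. intros; apply Rmax_l. Qed.

Lemma sum_overlap_mono a b N M : (N <= M)%nat ->
  sumR N (fun j => overlap j a b) <= sumR M (fun j => overlap j a b).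
Proof.
  intros H. induction H as [|M H IH]; [lra|]. cbn [sumR]. pose proof (overlap_nonneg M a b). lra.
Qed.

Definition upd (a : nat -> R) (k : nat) (x : R) : nat -> R := fun i => if (i =? k)%nat then x else a i.

Lemma upd_eq a k x : upd a k x k = x.
Proof. unfold upd. now rewrite Nat.eqb_refl. Qed.

Lemma upd_neq a k x i : i <> k -> upd a k x i = a i.
Proof. intros H. unfold upd. destruct (Nat.eqb_spec i k); [lia|auto]. Qed.

(** The overlaps with the two halves add up to at most the overlap with the whole. If both halves
    failed, at indices N1 and N2, the partial sum at their maximum would exceed theta times the
    whole volume. *)
Lemma underfilled_half theta a b k : (k < D)%nat -> (forall i, (i < D)%nat -> a i < b i) ->
  underfilled theta a b ->
  underfilled theta a (upd b k ((a k + b k) / 2)) \/ underfilled theta (upd a k ((a k + b k) / 2)) b.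
Proof.
  intros Hk Hab HU. set (m := (a k + b k) / 2). apply NNPP. intros C.
  apply not_or_and in C. destruct C as [C1 C2].
  apply not_all_ex_not in C1. apply not_all_ex_not in C2.
  destruct C1 as [N1 C1], C2 as [N2 C2]. apply Rnot_le_lt in C1. apply Rnot_le_lt in C2.
  pose proof (sum_overlap_mono a (upd b k m) N1 (max N1 N2) ltac:(lia)).
  pose proof (sum_overlap_mono (upd a k m) b N2 (max N1 N2) ltac:(lia)).
  specialize (HU (max N1 N2)). set (N := max N1 N2) in *.
  specialize (Hab k Hk).
  assert (V1 : vol a (upd b k m) = / 2 * vol a b).
  { apply (prodR_scale_factor D _ _ k); auto.
    - intros i _ Hi. now rewrite upd_neq.
    - rewrite upd_eq. unfold m. field. }
  assert (V2 : vol (upd a k m) b = / 2 * vol a b).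
  { apply (prodR_scale_factor D _ _ k); auto.
    - intros i _ Hi. now rewrite upd_neq.
    - rewrite upd_eq. unfold m. field. }
  rewrite V1 in C1. rewrite V2 in C2.
  assert (S : sumR N (fun j => overlap j a (upd b k m)) + sumR N (fun j => overlap j (upd a k m) b) <=
    sumR N (fun j => overlap j a b)).
  { rewrite <- sumR_plus. apply sumR_le. intros j _.
    apply (prodR_split_factor D _ _ _ k); auto.
    - intros i _ Hi. rewrite !upd_neq by auto. auto.
    - intros; apply Rmax_l.
    - rewrite !upd_eq. assert (a k <= m <= b k) by (unfold m; lra).
      unfold Rmax, Rmin. repeat destruct Rle_dec; lra. }
  lra.
Qed.

Lemma underfilled_refine1 theta k q : (k < D)%nat -> forall a b, (forall i, (i < D)%nat -> a i < b i) ->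
  underfilled theta a b -> exists a' b', underfilled theta a' b' /\
    (forall i, i <> k -> a' i = a i /\ b' i = b i) /\
    a k <= a' k /\ b' k <= b k /\ b' k - a' k = (b k - a k) / 2 ^ q.
Proof.
  intros Hk. induction q as [|q IH]; intros a b Hab HU.
  - exists a, b. repeat split; auto; try lra; simpl; field.
  - pose proof (Hab k Hk) as Hk'. set (m := (a k + b k) / 2).
    assert (P : 2 ^ q <> 0) by (apply pow_nonzero; lra).
    destruct (underfilled_half theta a b k Hk Hab HU) as [H|H]; fold m in H.
    + destruct (IH a (upd b k m)) as [a' [b' [H1 [H2 [H3 [H4 H5]]]]]]; auto.
      { intros i Hi. unfold upd. destruct (Nat.eqb_spec i k) as [->|]; auto. unfold m. lra. }
      rewrite upd_eq in *. exists a', b'. split; auto. split; [|split; [|split]]; auto.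
      * intros i Hi. destruct (H2 i Hi) as [E1 E2]. rewrite upd_neq in E2; auto.
      * unfold m in H4. lra.
      * rewrite H5. unfold m. cbn [pow]. field. auto.
    + destruct (IH (upd a k m) b) as [a' [b' [H1 [H2 [H3 [H4 H5]]]]]]; auto.
      { intros i Hi. unfold upd. destruct (Nat.eqb_spec i k) as [->|]; auto. unfold m. lra. }
      rewrite upd_eq in *. exists a', b'. split; auto. split; [|split; [|split]]; auto.
      * intros i Hi. destruct (H2 i Hi) as [E1 E2]. rewrite upd_neq in E1; auto.
      * unfold m in H3. lra.
      * rewrite H5. unfold m. cbn [pow]. field. auto.
Qed.

(** Only the first K directions are halved: K = 2n leaves the t-side intact, as the sheared box in
    [ball_radius_bound] demands. *)
Lemma underfilled_refine theta q K : (K <= D)%nat -> forall a b, (forall i, (i < D)%nat -> a i < b i) ->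
  underfilled theta a b -> exists a' b', underfilled theta a' b' /\
    (forall i, (K <= i)%nat -> a' i = a i /\ b' i = b i) /\
    (forall i, (i < K)%nat -> a i <= a' i /\ b' i <= b i /\ b' i - a' i = (b i - a i) / 2 ^ q).
Proof.
  intros HK a b Hab HU. induction K as [|K IH].
  - exists a, b. repeat split; auto; lia.
  - destruct IH as [a1 [b1 [H1 [H2 H3]]]]; [lia|].
    assert (P : 0 < 2 ^ q) by (apply pow_lt; lra).
    destruct (underfilled_refine1 theta K q ltac:(lia) a1 b1) as [a2 [b2 [G1 [G2 [G3 [G4 G5]]]]]]; auto.
    { intros i Hi. destruct (Nat.lt_ge_cases i K) as [C|C].
      - destruct (H3 i C) as [_ [_ E]]. specialize (Hab i Hi).
        assert (0 < (b i - a i) / 2 ^ q) by (apply Rdiv_lt_0_compat; lra). lra.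
      - destruct (H2 i C) as [-> ->]. auto. }
    destruct (H2 K (le_n _)) as [E1 E2]. rewrite E1 in *. rewrite E2 in *.
    exists a2, b2. split; auto. split.
    + intros i Hi. destruct (G2 i ltac:(lia)) as [-> ->]. apply H2; lia.
    + intros i Hi. destruct (Nat.eq_dec i K) as [->|E]; [auto|].
      destruct (G2 i E) as [-> ->]. apply H3; lia.
Qed.

Lemma overlap_full j a b : (forall k, (k < D)%nat -> a k <= b k /\ ca j k <= a k /\ b k <= cb j k) ->
  overlap j a b = vol a b.
Proof.
  intros H. apply prodR_ext. intros k Hk. destruct (H k Hk) as [H1 [H2 H3]].
  rewrite Rmin_right, (Rmax_right (ca j k)), Rmax_right by lra. reflexivity.
Qed.

Lemma overlap_le_vol j a b : (forall k, (k < D)%nat -> ca j k <= cb j k) ->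
  overlap j a b <= prodR D (fun k => cb j k - ca j k).
Proof.
  intros H. apply prodR_le. intros k Hk. specialize (H k Hk). split; [apply Rmax_l|].
  apply Rmax_lub; [lra|]. pose proof (Rmin_l (cb j k) (b k)). pose proof (Rmax_l (ca j k) (a k)). lra.
Qed.

Lemma overlap_mono j a b a' b' : (forall k, (k < D)%nat -> a k <= a' k /\ b' k <= b k) ->
  overlap j a' b' <= overlap j a b.
Proof.
  intros H. apply prodR_le. intros k Hk. destruct (H k Hk). split; [apply Rmax_l|].
  apply Rle_max_compat_l. unfold Rmax, Rmin. repeat destruct Rle_dec; lra.
Qed.
End Bisection.

Lemma conv_uniform n zs z e : conv n zs z -> 0 < e ->
  exists N, forall m k, (N <= m)%nat -> (k <= 2 * n)%nat -> Rabs (coord n (zs m) k - coord n z k) < e.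
Proof.
  intros C He.
  assert (H : forall K, (K <= S (2 * n))%nat -> exists N, forall m k, (N <= m)%nat -> (k < K)%nat ->
    Rabs (coord n (zs m) k - coord n z k) < e).
  { induction K as [|K IH]; intros HK; [exists 0%nat; intros; lia|].
    destruct IH as [N1 H1]; [lia|]. destruct (C K ltac:(lia) e He) as [N2 H2].
    exists (max N1 N2). intros m k Hm Hk. destruct (Nat.eq_dec k K) as [->|E].
    - apply (H2 m); lia.
    - apply H1; lia. }
  destruct (H (S (2 * n)) (le_n _)) as [N HN]. exists N. intros; apply HN; lia.
Qed.

Lemma half_pow_small w d : 0 < d -> exists N, forall m, (N <= m)%nat -> w / 2 ^ m < d.
Proof.
  intros Hd. destruct (Pow_x_infinity 2 ltac:(rewrite Rabs_pos_eq; lra) (Rabs w / d + 1)) as [N HN].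
  exists N. intros m Hm. specialize (HN m Hm). rewrite Rabs_pos_eq in HN by (apply pow_le; lra).
  assert (P : 0 < 2 ^ m) by (apply pow_lt; lra).
  apply (Rmult_lt_reg_r (2 ^ m)); auto. unfold Rdiv at 1. rewrite Rmult_assoc, Rinv_l, Rmult_1_r by lra.
  pose proof (Rle_abs w). apply Rle_lt_trans with (d * (Rabs w / d)); [field_simplify; lra|].
  apply Rmult_lt_compat_l; lra.
Qed.

(* No box can be underfilled by a cover of it with open boxes: a point of it around which subboxes shrink
   while staying underfilled lies in one of the open boxes. *)
Lemma cover_not_underfilled n ca cb a b theta E : theta < 1 ->
  (forall i, (i <= 2 * n)%nat -> a i < b i) ->
  (forall z, inH n z -> (forall k, (k <= 2 * n)%nat -> a k <= coord n z k <= b k) -> E z) ->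
  (forall z, E z -> exists j, forall k, (k <= 2 * n)%nat -> ca j k < coord n z k < cb j k) ->
  ~ underfilled (S (2 * n)) ca cb theta a b.
Proof.
  intros Hth Hab HE Hcov HU.
  (* The refinement is restarted for each q, so the subboxes need not be nested; compactness
     supplies a limit of their lower corners. *)
  assert (H : forall q : nat, exists ab : (nat -> R) * (nat -> R),
    underfilled (S (2 * n)) ca cb theta (fst ab) (snd ab) /\
    forall i, (i <= 2 * n)%nat -> a i <= fst ab i /\ snd ab i <= b i /\ snd ab i - fst ab i = (b i - a i) / 2 ^ q).
  { intros q. destruct (underfilled_refine (S (2 * n)) ca cb theta q (S (2 * n)) (le_n _) a b)
      as [a' [b' [H1 [_ H2]]]]; auto; [intros; apply Hab; lia|].
    exists (a', b'). split; auto. intros; apply H2; lia. }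
  destruct (choice _ H) as [ab Hab'].
  set (zs := fun q => ((fun i => if (i <? 2 * n)%nat then fst (ab q) i else 0), fst (ab q) (2 * n)%nat) : Point).
  assert (Hzs : forall q k, (k <= 2 * n)%nat -> coord n (zs q) k = fst (ab q) k).
  { intros q k Hk. destruct (Nat.eq_dec k (2 * n)) as [->|Ek].
    - now rewrite coord_t.
    - rewrite coord_lo by lia. unfold zs; cbn [fst]. destruct (Nat.ltb_spec k (2 * n)); [auto|lia]. }
  assert (Hw : forall q k, (k <= 2 * n)%nat -> 0 < snd (ab q) k - fst (ab q) k).
  { intros q k Hk. destruct (Hab' q) as [_ Q]. destruct (Q k Hk) as [_ [_ ->]].
    apply Rdiv_lt_0_compat; [specialize (Hab k Hk); lra|apply pow_lt; lra]. }
  assert (Hin : forall q k, (k <= 2 * n)%nat -> a k <= coord n (zs q) k <= b k).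
  { intros q k Hk. rewrite Hzs by auto. destruct (Hab' q) as [_ Q]. destruct (Q k Hk) as [Q1 [Q2 _]].
    specialize (Hw q k Hk). lra. }
  destruct (point_subseq n zs (sumR (S (2 * n)) (fun k => Rabs (a k) + Rabs (b k)))) as [sg [z [S1 [S2 S3]]]].
  { intros m k Hk. specialize (Hin m k Hk).
    eapply Rle_trans; [|apply (sumR_term_le (S (2 * n)) (fun k => Rabs (a k) + Rabs (b k)) k); [|lia]].
    - unfold Rabs. repeat destruct Rcase_abs; lra.
    - intros i _. pose proof (Rabs_pos (a i)). pose proof (Rabs_pos (b i)). lra. }
  assert (Ez : E z).
  { apply HE; auto. intros k Hk. split.
    - apply (Un_cv_limit_ge (fun m => coord n (zs (sg m)) k)); [now apply S3|]. intros; now apply Hin.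
    - apply (Un_cv_limit_le (fun m => coord n (zs (sg m)) k)); [now apply S3|]. intros; now apply Hin. }
  destruct (Hcov z Ez) as [j Hj].
  (* A margin d to all faces of the open box. Once the corner is within d/2 and the sides are
     shorter than d/2, the subbox lies wholly inside, and one overlap already equals its volume. *)
  assert (Hgap : forall K, (K <= S (2 * n))%nat -> exists d, 0 < d /\ forall k, (k < K)%nat ->
    ca j k + d <= coord n z k <= cb j k - d).
  { induction K as [|K IH]; intros HK; [exists 1; split; [lra|intros; lia]|].
    destruct IH as [d [Hd IHd]]; [lia|]. destruct (Hj K ltac:(lia)) as [J1 J2].
    set (g := Rmin (coord n z K - ca j K) (cb j K - coord n z K)).
    assert (0 < g) by (apply Rmin_glb_lt; lra).
    pose proof (Rmin_l (coord n z K - ca j K) (cb j K - coord n z K)).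
    pose proof (Rmin_r (coord n z K - ca j K) (cb j K - coord n z K)). fold g in H1, H2.
    exists (Rmin d g). split; [now apply Rmin_glb_lt|]. intros k Hk.
    pose proof (Rmin_l d g). pose proof (Rmin_r d g).
    destruct (Nat.eq_dec k K) as [->|Ek]; [lra|]. specialize (IHd k ltac:(lia)). lra. }
  destruct (Hgap (S (2 * n)) (le_n _)) as [d [Hd Hgd]].
  destruct (conv_uniform n _ z (d / 2) S3 ltac:(lra)) as [N1 HN1].
  destruct (half_pow_small (sumR (S (2 * n)) (fun k => b k - a k)) (d / 2) ltac:(lra)) as [N2 HN2].
  set (m := max N1 N2). set (q := sg m).
  destruct (Hab' q) as [U Q].
  assert (OF : prodR (S (2 * n)) (fun k => Rmax 0 (Rmin (cb j k) (snd (ab q) k) - Rmax (ca j k) (fst (ab q) k)))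
    = prodR (S (2 * n)) (fun k => snd (ab q) k - fst (ab q) k)).
  { apply (overlap_full (S (2 * n)) ca cb j). intros k Hk. specialize (Hw q k ltac:(lia)).
    specialize (Hgd k Hk). specialize (HN1 m k ltac:(lia) ltac:(lia)). fold q in HN1. rewrite Hzs in HN1 by lia.
    apply Rabs_def2 in HN1. destruct (Q k ltac:(lia)) as [_ [_ Q3]].
    specialize (HN2 q ltac:(unfold q; specialize (S1 m); lia)).
    assert (B : b k - a k <= sumR (S (2 * n)) (fun k => b k - a k)).
    { apply (sumR_term_le (S (2 * n)) (fun k => b k - a k)); auto. intros i Hi. specialize (Hab i ltac:(lia)). lra. }
    assert (B2 : (b k - a k) / 2 ^ q <= sumR (S (2 * n)) (fun k => b k - a k) / 2 ^ q).
    { apply Rmult_le_compat_r; auto. left. apply Rinv_0_lt_compat, pow_lt. lra. }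
    lra. }
  specialize (U (S j)).
  pose proof (sumR_term_le (S j) (fun j => prodR (S (2 * n))
    (fun k => Rmax 0 (Rmin (cb j k) (snd (ab q) k) - Rmax (ca j k) (fst (ab q) k)))) j) as T.
  cbv beta in T. specialize (T ltac:(intros; apply prodR_nonneg; intros; apply Rmax_l) ltac:(lia)).
  rewrite OF in T.
  assert (V : 0 < prodR (S (2 * n)) (fun k => snd (ab q) k - fst (ab q) k)) by (apply prodR_pos; intros; apply Hw; lia).
  assert (theta * prodR (S (2 * n)) (fun k => snd (ab q) k - fst (ab q) k) <
    1 * prodR (S (2 * n)) (fun k => snd (ab q) k - fst (ab q) k)) by (apply Rmult_lt_compat_r; auto).
  lra.
Qed.

Lemma sumR_sum_f N f : sumR (S N) f = sum_f_R0 f N.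
Proof. induction N as [|N IH]; [simpl; ring|]. cbn [sumR sum_f_R0]. now rewrite <- IH. Qed.

Lemma sum_half_pow N : sumR N (fun j => / 2 ^ S j) <= 1.
Proof.
  assert (H : sumR N (fun j => / 2 ^ S j) = 1 - / 2 ^ N).
  { induction N as [|N IH]; [simpl; field|]. cbn [sumR]. rewrite IH. cbn [pow]. field.
    apply pow_nonzero; lra. }
  rewrite H. assert (0 < / 2 ^ N) by (apply Rinv_0_lt_compat, pow_lt; lra). lra.
Qed.

(** A closed cover of total volume below m + 1 exists since m is an infimum; opening up the j-th box
    costs at most 2^(-j-1), hence m + 2 in total. *)
Lemma open_box_cover n E m : lebesgue_measure_is n E m -> exists ca cb : nat -> nat -> R,
  (forall j k, (k <= 2 * n)%nat -> ca j k < cb j k) /\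
  (forall z, E z -> exists j, forall k, (k <= 2 * n)%nat -> ca j k < coord n z k < cb j k) /\
  forall N, sumR N (fun j => prodR (S (2 * n)) (fun k => cb j k - ca j k)) <= m + 2.
Proof.
  intros [_ Hm].
  assert (Hs : exists s a b, s < m + 1 /\ box_cover n E a b /\ infinite_sum (fun j => box_vol n (a j) (b j)) s).
  { apply NNPP. intros C. assert (m + 1 <= m); [|lra]. apply Hm. intros s [a [b Hab]].
    destruct (Rle_or_lt (m + 1) s) as [|C']; auto. exfalso. apply C. exists s, a, b. tauto. }
  destruct Hs as [s [a [b [Hs [[Hab Hcov] Hsum]]]]].
  assert (Hd : forall j : nat, exists d, 0 < d /\
    prodR (S (2 * n)) (fun k => b j k - a j k + 2 * d) <= prodR (S (2 * n)) (fun k => b j k - a j k) + / 2 ^ S j).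
  { intros j. apply prodR_enlarge. apply Rinv_0_lt_compat, pow_lt. lra. }
  destruct (choice _ Hd) as [d Hd'].
  exists (fun j k => a j k - d j), (fun j k => b j k + d j). split; [|split].
  - intros j k Hk. specialize (Hab j k Hk). destruct (Hd' j). lra.
  - intros z Hz. destruct (Hcov z Hz) as [j Hj]. exists j. intros k Hk. specialize (Hj k Hk).
    destruct (Hd' j). lra.
  - intros N.
    apply Rle_trans with (sumR N (fun j => box_vol n (a j) (b j) + / 2 ^ S j)).
    + apply sumR_le. intros j _. destruct (Hd' j) as [_ H]. rewrite box_vol_prodR.
      rewrite (prodR_ext _ (fun k => b j k + d j - (a j k - d j)) (fun k => b j k - a j k + 2 * d j)); [exact H|].
      intros; ring.
    + rewrite sumR_plus. pose proof (sum_half_pow N).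
      assert (Hpos : forall j, 0 <= box_vol n (a j) (b j)).
      { intros j. rewrite box_vol_prodR. apply prodR_nonneg. intros k Hk. specialize (Hab j k ltac:(lia)). lra. }
      assert (sumR N (fun j => box_vol n (a j) (b j)) <= s); [|lra].
      apply Rle_trans with (sumR (S N) (fun j => box_vol n (a j) (b j))).
      * cbn [sumR]. specialize (Hpos N). lra.
      * rewrite sumR_sum_f. apply sum_incr; auto.
Qed.

Lemma dot_abs_le n y x e : (forall i, (i < 2 * n)%nat -> Rabs (x i) <= e) ->
  Rabs (dotR n y x) <= sumR (2 * n) (fun i => Rabs (y i)) * e.
Proof.
  intros H. eapply Rle_trans; [apply sumR_abs|]. rewrite <- sumR_scal_r.
  apply sumR_le. intros i Hi. rewrite Rabs_mult. apply Rmult_le_compat_l; [apply Rabs_pos|auto].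
Qed.

(* The ball around c contains a sheared box; cutting its x-projection finely enough makes the shear
   negligible, so that some small axis-parallel box inside the ball would be underfilled. *)
Lemma ball_radius_bound n m E c r : (1 <= n)%nat -> lebesgue_measure_is n E m -> inH n c -> 0 < r ->
  (forall z, ballH n c r z -> E z) -> r <= 1 + 2 * (Rabs m + 2) * INR n ^ (2 * n).
Proof.
  intros Hn HE Hc Hr Hball.
  destruct (Rle_or_lt r (1 + 2 * (Rabs m + 2) * INR n ^ (2 * n))) as [|Hbig]; auto. exfalso.
  destruct (open_box_cover n E m HE) as [ca [cb [Hcacb [Hcov Hsum]]]].
  assert (Hn1 : 1 <= INR n) by (apply (le_INR 1); auto).
  assert (Hnp : 0 < INR n ^ (2 * n)) by (apply pow_lt; lra).
  pose proof (Rabs_pos m) as Pm. pose proof (Rle_abs m) as Lm.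
  set (V := Rabs m + 2) in *. assert (HV : 0 < V) by (unfold V; lra).
  (* With this half-side the 2n horizontal coordinates contribute at most r^2/(2n) <= r^2/2 to |x -
     c|^2. *)
  set (sg := r / (2 * INR n)). assert (Hsg : 0 < sg) by (apply Rdiv_lt_0_compat; lra).
  set (J := sumR (2 * n) (fun i => Rabs (Jx n (fst c) i))).
  assert (HJ : 0 <= J) by (apply sumR_nonneg; intros; apply Rabs_pos).
  (* Tall enough to contain the interval tau +- r^2/4 wherever the horizontal subbox ends up. *)
  set (T := Rabs (snd c) + 2 * (J * sg) + r ^ 2).
  assert (Hr2 : 0 < r ^ 2) by (apply pow_lt; auto).
  assert (HT : 0 < T).
  { unfold T. pose proof (Rabs_pos (snd c)). assert (0 <= J * sg) by (apply Rmult_le_pos; lra). lra. }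
  set (a0 := fun i => if (i <? 2 * n)%nat then fst c i - sg else - T).
  set (b0 := fun i => if (i <? 2 * n)%nat then fst c i + sg else T).
  assert (Hx0 : forall i, (i < 2 * n)%nat -> a0 i = fst c i - sg /\ b0 i = fst c i + sg).
  { intros i Hi. unfold a0, b0. destruct (Nat.ltb_spec i (2 * n)); [auto|lia]. }
  assert (Ht0 : a0 (2 * n)%nat = - T /\ b0 (2 * n)%nat = T).
  { unfold a0, b0. rewrite Nat.ltb_irrefl. auto. }
  set (X := (2 * sg) ^ (2 * n)). assert (HX : 0 < X) by (apply pow_lt; lra).
  assert (Hvol0 : prodR (S (2 * n)) (fun k => b0 k - a0 k) = X * (2 * T)).
  { cbn [prodR]. destruct Ht0 as [-> ->]. unfold X. rewrite <- prodR_const. f_equal; [|ring].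
    apply prodR_ext. intros k Hk. destruct (Hx0 k Hk) as [-> ->]. ring. }
  set (th0 := V / (X * (2 * T))).
  assert (U0 : underfilled (S (2 * n)) ca cb th0 a0 b0).
  { intros N. rewrite Hvol0. unfold th0. replace (V / (X * (2 * T)) * (X * (2 * T))) with V by (field; lra).
    eapply Rle_trans; [|eapply Rle_trans; [apply (Hsum N)|unfold V; lra]].
    apply sumR_le. intros j _. apply (overlap_le_vol (S (2 * n)) ca cb j). intros k Hk.
    specialize (Hcacb j k ltac:(lia)). lra. }
  (* After q halvings the side e satisfies 8 J e <= r^2, so the shear 2<Jc,x> varies by at most
     r^2/4 over the horizontal subbox. *)
  destruct (half_pow_small (2 * sg * (8 * J + 1)) (r ^ 2) Hr2) as [q Hq]. specialize (Hq q (le_n _)).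
  assert (P2 : 0 < 2 ^ q) by (apply pow_lt; lra).
  destruct (underfilled_refine (S (2 * n)) ca cb th0 q (2 * n) ltac:(lia) a0 b0) as [a1 [b1 [U1 [F1 G1]]]]; auto.
  { intros i Hi. destruct (Nat.eq_dec i (2 * n)) as [->|Ei].
    - destruct Ht0 as [-> ->]. lra.
    - destruct (Hx0 i ltac:(lia)) as [-> ->]. lra. }
  set (e := 2 * sg / 2 ^ q). assert (He : 0 < e) by (apply Rdiv_lt_0_compat; lra).
  assert (Hw1 : forall i, (i < 2 * n)%nat -> fst c i - sg <= a1 i /\ b1 i <= fst c i + sg /\ b1 i - a1 i = e).
  { intros i Hi. destruct (G1 i Hi) as [A1 [A2 A3]]. destruct (Hx0 i Hi) as [E1 E2].
    rewrite E1 in *. rewrite E2 in *. repeat split; auto. rewrite A3. unfold e. f_equal. ring. }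
  assert (HeJ : 8 * J * e <= r ^ 2).
  { apply Rle_trans with (2 * sg * (8 * J + 1) / 2 ^ q); [|lra]. unfold e.
    replace (8 * J * (2 * sg / 2 ^ q)) with (2 * sg * (8 * J) / 2 ^ q) by (field; lra).
    apply Rmult_le_compat_r; [left; now apply Rinv_0_lt_compat|]. nra. }
  set (tau := snd c + 2 * dotR n (Jx n (fst c)) a1).
  assert (Hdiff : forall x, (forall i, (i < 2 * n)%nat -> a1 i <= x i <= b1 i) ->
    Rabs (2 * dotR n (Jx n (fst c)) x - 2 * dotR n (Jx n (fst c)) a1) <= r ^ 2 / 4).
  { intros x Hx. replace (2 * dotR n (Jx n (fst c)) x - 2 * dotR n (Jx n (fst c)) a1) with
      (2 * dotR n (Jx n (fst c)) (fun i => x i + -1 * a1 i)) by (rewrite dotR_plus_r, dotR_scal_r; ring).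
    rewrite Rabs_mult, Rabs_pos_eq by lra.
    pose proof (dot_abs_le n (Jx n (fst c)) (fun i => x i + -1 * a1 i) e) as Q. fold J in Q.
    assert (Rabs (dotR n (Jx n (fst c)) (fun i => x i + -1 * a1 i)) <= J * e); [|lra].
    apply Q. intros i Hi. specialize (Hx i Hi). destruct (Hw1 i Hi) as [_ [_ W]]. apply Rabs_le. lra. }
  assert (Htau : Rabs tau <= Rabs (snd c) + 2 * (J * sg)).
  { unfold tau. replace (dotR n (Jx n (fst c)) a1) with (dotR n (Jx n (fst c)) (fun i => a1 i + -1 * fst c i))
      by (rewrite dotR_plus_r, dotR_scal_r, dot_Jx_self; ring).
    eapply Rle_trans; [apply Rabs_triang|]. rewrite Rabs_mult, (Rabs_pos_eq 2) by lra.
    pose proof (dot_abs_le n (Jx n (fst c)) (fun i => a1 i + -1 * fst c i) sg) as Q. fold J in Q.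
    assert (Rabs (dotR n (Jx n (fst c)) (fun i => a1 i + -1 * fst c i)) <= J * sg); [|lra].
    apply Q. intros i Hi. destruct (Hw1 i Hi) as [W1 [W2 W3]]. apply Rabs_le. lra. }
  apply Rabs_le_inv in Htau.
  set (a2 := upd a1 (2 * n) (tau - r ^ 2 / 4)). set (b2 := upd b1 (2 * n) (tau + r ^ 2 / 4)).
  destruct (F1 (2 * n)%nat (le_n _)) as [Fa Fb]. destruct Ht0 as [Ta Tb]. rewrite Ta in Fa. rewrite Tb in Fb.
  assert (Hvol1 : prodR (S (2 * n)) (fun k => b1 k - a1 k) = e ^ (2 * n) * (2 * T)).
  { cbn [prodR]. rewrite Fa, Fb, <- (prodR_const (2 * n) e). f_equal; [|ring].
    apply prodR_ext. intros k Hk. now destruct (Hw1 k Hk) as [_ [_ ->]]. }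
  assert (Hvol2 : prodR (S (2 * n)) (fun k => b2 k - a2 k) = e ^ (2 * n) * (r ^ 2 / 2)).
  { cbn [prodR]. unfold a2, b2. rewrite !upd_eq, <- (prodR_const (2 * n) e). f_equal; [|field].
    apply prodR_ext. intros k Hk. rewrite !upd_neq by lia. now destruct (Hw1 k Hk) as [_ [_ ->]]. }
  (* Cutting the vertical side from 2T down to r^2/2 lowers the overlaps, so the filling fraction
     grows at most by the ratio of the sides. T cancels, leaving a fraction of order V/r^Q. *)
  set (th := th0 * (2 * T) / (r ^ 2 / 2)).
  assert (U2 : underfilled (S (2 * n)) ca cb th a2 b2).
  { intros N. rewrite Hvol2. unfold th.
    replace (th0 * (2 * T) / (r ^ 2 / 2) * (e ^ (2 * n) * (r ^ 2 / 2))) with (th0 * (e ^ (2 * n) * (2 * T)))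
      by (field; lra).
    rewrite <- Hvol1. eapply Rle_trans; [|apply (U1 N)]. apply sumR_le. intros j _.
    apply (overlap_mono (S (2 * n)) ca cb j). intros k Hk. unfold a2, b2.
    destruct (Nat.eq_dec k (2 * n)) as [->|Ek].
    - rewrite !upd_eq, Fa, Fb. unfold T. lra.
    - rewrite !upd_neq by auto. lra. }
  revert U2. apply (cover_not_underfilled n ca cb a2 b2 th E); auto.
  - assert (Hrn : X = r ^ (2 * n) / INR n ^ (2 * n)).
    { unfold X, sg. replace (2 * (r / (2 * INR n))) with (r * / INR n) by (field; lra).
      now rewrite Rpow_mult_distr, pow_inv. }
    assert (Eth : th = 2 * V * INR n ^ (2 * n) / (r ^ 2 * r ^ (2 * n))).
    { unfold th, th0. rewrite Hrn. field.
      repeat split; try lra; apply pow_nonzero; lra. }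
    rewrite Eth. assert (Hr1 : 1 < r) by (assert (0 < V * INR n ^ (2 * n)) by (apply Rmult_lt_0_compat; auto); lra).
    assert (R1 : r <= r ^ 2) by nra.
    assert (R2 : 1 <= r ^ (2 * n)) by (apply pow_R1_Rle; lra).
    (* Keeping only the first power of r from r^Q yields the linear, non-sharp bound on the
       radius. *)
    assert (R3 : r <= r ^ 2 * r ^ (2 * n)) by nra.
    apply (Rmult_lt_reg_r (r ^ 2 * r ^ (2 * n))); [lra|].
    unfold Rdiv. rewrite Rmult_assoc, Rinv_l by lra. lra.
  - intros i Hi. unfold a2, b2. destruct (Nat.eq_dec i (2 * n)) as [->|Ei].
    + rewrite !upd_eq. lra.
    + rewrite !upd_neq by auto. destruct (Hw1 i ltac:(lia)) as [_ [_ W]]. lra.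
  - intros z Hz Hzk. apply Hball. split; auto.
    assert (Hzx : forall i, (i < 2 * n)%nat -> a1 i <= fst z i <= b1 i).
    { intros i Hi. specialize (Hzk i ltac:(lia)). rewrite coord_lo in Hzk by auto.
      unfold a2, b2 in Hzk. rewrite !upd_neq in Hzk by lia. auto. }
    pose proof (Hzk (2 * n)%nat (le_n _)) as Hzt. rewrite coord_t in Hzt. unfold a2, b2 in Hzt. rewrite !upd_eq in Hzt.
    specialize (Hdiff (fst z) Hzx). apply Rabs_le_inv in Hdiff. unfold tau in Hzt.
    apply pow4_lt; [lra|]. rewrite dH_coord.
    assert (S1 : sumR (2 * n) (fun i => (fst z i - fst c i) ^ 2) <= r ^ 2 / 2).
    { apply Rle_trans with (sumR (2 * n) (fun _ => sg ^ 2)).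
      - apply sumR_le. intros i Hi. destruct (Hw1 i Hi) as [W1 [W2 _]]. specialize (Hzx i Hi).
        apply pow_maj_Rabs. apply Rabs_le. lra.
      - rewrite sumR_const, mult_INR. unfold sg. simpl INR.
        replace ((1 + 1) * INR n * (r / (2 * INR n)) ^ 2) with (r ^ 2 / 2 * / INR n) by (field; lra).
        rewrite <- (Rmult_1_r (r ^ 2 / 2)) at 2. apply Rmult_le_compat_l; [lra|].
        rewrite <- Rinv_1. apply Rinv_le_contravar; lra. }
    assert (S0 : 0 <= sumR (2 * n) (fun i => (fst z i - fst c i) ^ 2)) by (apply sumR_nonneg; intros; apply pow2_ge_0).
    set (y := snd z - snd c - 2 * dotR n (Jx n (fst c)) (fst z)).
    assert (Hy : - (r ^ 2 / 2) <= y <= r ^ 2 / 2) by (unfold y; lra).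
    assert (y ^ 2 <= (r ^ 2 / 2) ^ 2) by (apply pow_maj_Rabs, Rabs_le; lra).
    assert (sumR (2 * n) (fun i => (fst z i - fst c i) ^ 2) ^ 2 <= (r ^ 2 / 2) ^ 2) by (apply pow_incr; lra).
    replace (r ^ 4) with (4 * (r ^ 2 / 2) ^ 2) by field.
    assert (0 < (r ^ 2 / 2) ^ 2) by (apply pow_lt; lra). lra.
Qed.

(** * The Harnack inequality *)

Lemma sumL_filter_le {T : Type} (f : T -> R) q l : (forall p, In p l -> 0 <= f p) ->
  sumL f (filter q l) <= sumL f l.
Proof.
  induction l as [|p l IH]; intros H; [simpl; lra|]. simpl filter.
  assert (I : sumL f (filter q l) <= sumL f l) by (apply IH; intros; apply H; now right).
  specialize (H p (or_introl eq_refl)). destruct (q p); simpl; simpl in I; lra.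
Qed.

Lemma bernoulli_sub x k : 0 <= x <= 1 -> 1 - INR k * x <= (1 - x) ^ k.
Proof.
  intros Hx. induction k as [|k IH]; [simpl; lra|]. rewrite S_INR. cbn [pow].
  pose proof (pos_INR k). apply Rle_trans with ((1 - x) * (1 - INR k * x)); [nra|].
  apply Rmult_le_compat_l; lra.
Qed.

Lemma solves_reflect n A c rad c' rad' u k : solves n A c rad u ->
  (forall z, dH n c' z < rad' -> dH n c z < rad) -> solves n A c' rad' (fun z => k - u z).
Proof.
  intros H Hsub z Hz Hd. destruct (H z Hz (Hsub z Hd)) as [M [H1 H2]].
  exists (fun i j => - M i j). split.
  - transitivity (- frob n (A z) M); [|rewrite H1; ring]. unfold frob. rewrite <- sumR_opp.
    apply sumR_ext. intros i _. rewrite <- sumR_opp. apply sumR_ext. intros; ring.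
  - intros xi Hxi. apply der2_ext with (fun s => k + -1 * u (hline n z xi s)); [intros; ring|].
    replace (quadf (2 * n) (fun i j => - M i j) xi) with (0 + -1 * quadf (2 * n) M xi).
    + apply (der2_plus (fun _ => k)); [apply der2_const|]. apply der2_scal. auto.
    + unfold quadf. rewrite Rplus_0_l, <- sumR_scal. apply sumR_ext. intros i _.
      rewrite (sumR_ext (2 * n) (fun j => - M i j * xi j) (fun j => -1 * (M i j * xi j))) by (intros; ring).
      rewrite sumR_scal. ring.
Qed.

(** Lower bound for (number of grid points)(h/rho1)^Q: there are at least m^Q points and h m =
    rho1/(2n+1). *)
Definition grid_density (n : nat) : R := (/ (2 * INR n + 1)) ^ (2 * n + 2).
(** The eta for which growth applied to (1 + eta) a - u leaves u < a/2 on at most half of the grid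
    density. *)
Definition slack (n : nat) (lam Lam : R) : R := growth_const n lam Lam * grid_density n / 8.
(** The theta with Q theta = eta/(1 + eta), so that Bernoulli gives (1 - theta)^Q >= 1/(1 + eta). *)
Definition shrink (n : nat) (lam Lam : R) : R :=
  slack n lam Lam / (INR (2 * n + 2) * (1 + slack n lam Lam)).
(** The quotient of u(z) <= a (delta/r)^Q by the lower bound c (a/4)(c0/2)(rho1/(2r))^Q for u(w),
    where rho1 = theta delta/K and c0 is [grid_density]. *)
Definition harnack_const (n : nat) (lam Lam : R) : R :=
  8 / (growth_const n lam Lam * grid_density n) * (2 * growth_radius n lam Lam / shrink n lam Lam) ^ (2 * n + 2).

Section Harnack.
Variables (n : nat) (lam Lam eps : R) (A0 : nat -> nat -> R) (A : Point -> nat -> nat -> R).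
Variables (z0 : Point) (r : R) (u : Point -> R).
Hypothesis Hn : (1 <= n)%nat.
Hypothesis Hl : 0 < lam <= 1.
Hypothesis HL : 1 <= Lam.
Hypothesis HA0 : sympl_spd n lam Lam A0.
Hypothesis Heps : eps_small n lam Lam eps.
Hypothesis Hz0 : inH n z0.
Hypothesis Hr : 0 < r.
Let K := growth_radius n lam Lam.
Let Q := (2 * n + 2)%nat.
Hypothesis HA : forall z, cball n z0 (K * (2 * r)) z -> close_to n lam eps A0 (A z).
Hypothesis Hu : solves n A z0 (K * (2 * r)) u.
Hypothesis Huc : seq_cont n (cball n z0 (K * (2 * r))) u.
Hypothesis Hu0 : forall z, cball n z0 (K * (2 * r)) z -> 0 <= u z.

Let c := growth_const n lam Lam.
Let eta := slack n lam Lam.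
Let theta := shrink n lam Lam.

Lemma constants_pos : 0 < c /\ 0 < grid_density n /\ 0 < eta /\ 0 < theta /\ INR Q * theta = eta / (1 + eta) /\ theta < 1.
Proof.
  assert (Hc : 0 < c) by apply growth_const_pos.
  assert (Hc0 : 0 < grid_density n).
  { apply pow_lt, Rinv_0_lt_compat. pose proof (pos_INR n). lra. }
  assert (He : 0 < eta).
  { unfold eta, slack. fold c. apply Rdiv_lt_0_compat; [now apply Rmult_lt_0_compat|lra]. }
  assert (HQ : 1 <= INR Q) by (apply (le_INR 1); unfold Q; lia).
  assert (Eq : INR Q * theta = eta / (1 + eta)).
  { unfold theta, shrink. fold eta. fold Q. field. lra. }
  assert (Ht : 0 < theta).
  { unfold theta, shrink. fold eta. fold Q. apply Rdiv_lt_0_compat; auto. apply Rmult_lt_0_compat; lra. }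
  repeat split; auto.
  assert (eta / (1 + eta) < 1).
  { apply (Rmult_lt_reg_r (1 + eta)); [lra|]. unfold Rdiv. rewrite Rmult_assoc, Rinv_l; lra. }
  nra.
Qed.

(* z1 maximises (2r - d(z0,.))^Q u, so that u <= (1 + eta) u(z1) on the ball of radius theta * delta around
   z1. Growth applied to (1 + eta) a - u there shows that u >= a/2 on half of the grid points of a smaller
   ball; growth applied to u carries this back to w. *)
Lemma harnack_ball z w : cball n z0 r z -> cball n z0 r w -> u z <= harnack_const n lam Lam * u w.
Proof.
  intros Hz Hw.
  destruct constants_pos as [Hc [Hc0 [He [Ht [HQt Ht1]]]]].
  pose proof (growth_radius_ge n lam Lam) as HK. fold K in HK.
  assert (HC : 0 < harnack_const n lam Lam).
  { unfold harnack_const. fold c K theta. apply Rmult_lt_0_compat.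
    - apply Rdiv_lt_0_compat; [lra|now apply Rmult_lt_0_compat].
    - apply pow_lt, Rdiv_lt_0_compat; lra. }
  assert (Hsub : forall s y, s <= K * (2 * r) -> cball n z0 s y -> cball n z0 (K * (2 * r)) y)
    by (intros s y Hs [H1 H2]; split; auto; lra).
  assert (HrK : 2 * r <= K * (2 * r)) by nra.
  assert (Hw0 : 0 <= u w) by (apply Hu0, (Hsub r); [lra|auto]).
  (* With u(z) > 0 the weighted maximum is positive, which forces both a > 0 and delta > 0. *)
  destruct (Rle_or_lt (u z) 0) as [|Huz].
  { apply Rle_trans with 0; auto. apply Rmult_le_pos; lra. }
  set (F := fun y => (2 * r - dH n z0 y) ^ Q * u y).
  destruct (max_attained n (cball n z0 (2 * r)) F z) as [z1 [Hz1 Hmax]].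
  { apply compact_cball. }
  { apply seq_cont_mult.
    - apply seq_cont_pow, seq_cont_minus; [apply seq_cont_const|apply seq_cont_dH].
    - intros zs y H1 H2 H3. apply Huc; auto; [intros; apply (Hsub (2 * r)); auto|apply (Hsub (2 * r)); auto]. }
  { destruct Hz; split; auto; lra. }
  set (a := u z1). set (del := 2 * r - dH n z0 z1).
  assert (Hrz : r ^ Q * u z <= del ^ Q * a).
  { apply Rle_trans with (F z); [|apply Hmax; destruct Hz; split; auto; lra].
    unfold F. apply Rmult_le_compat_r; [lra|]. apply pow_incr. destruct Hz. lra. }
  assert (Hpos : 0 < r ^ Q * u z) by (apply Rmult_lt_0_compat; auto; apply pow_lt; auto).
  destruct Hz1 as [Hz1H Hz1d].
  assert (Ha : 0 < a).
  { assert (0 <= del ^ Q) by (apply pow_le; unfold del; lra). nra. }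
  assert (Hdel : 0 < del).
  { destruct (Rle_lt_or_eq_dec 0 del) as [|E]; [unfold del; lra|auto|].
    rewrite <- E in Hrz. rewrite pow_ne_zero in Hrz by (unfold Q; lia). lra. }
  assert (Hdel2 : del <= 2 * r) by (unfold del; pose proof (dH_nonneg n z0 z1); lra).
  assert (Hnear : forall y, inH n y -> dH n z1 y <= theta * del ->
     cball n z0 (2 * r) y /\ u y <= (1 + eta) * a).
  { intros y Hy Hd. pose proof (dH_tri n z0 z1 y) as Tri.
    assert (D1 : (1 - theta) * del <= 2 * r - dH n z0 y) by (unfold del in *; lra).
    assert (D0 : 0 < (1 - theta) * del) by (apply Rmult_lt_0_compat; lra).
    assert (Hyb : cball n z0 (2 * r) y) by (split; auto; lra).
    split; auto. pose proof (Hu0 y (Hsub _ y HrK Hyb)) as Uy.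
    assert (E1 : ((1 - theta) * del) ^ Q * u y <= del ^ Q * a).
    { apply Rle_trans with (F y); [|now apply Hmax]. unfold F. apply Rmult_le_compat_r; auto.
      apply pow_incr. lra. }
    rewrite Rpow_mult_distr in E1.
    assert (Pd : 0 < del ^ Q) by (apply pow_lt; auto).
    assert (E2 : (1 - theta) ^ Q * u y <= a) by (apply (Rmult_le_reg_l (del ^ Q)); auto; nra).
    pose proof (bernoulli_sub theta Q ltac:(lra)) as E3. rewrite HQt in E3.
    replace (1 - eta / (1 + eta)) with (/ (1 + eta)) in E3 by (field; lra).
    assert (E4 : / (1 + eta) * u y <= a).
    { eapply Rle_trans; [|exact E2]. apply Rmult_le_compat_r; auto. }
    apply (Rmult_le_compat_l (1 + eta)) in E4; [|lra].
    rewrite <- Rmult_assoc, Rinv_r, Rmult_1_l in E4 by lra. lra. }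
  (* The large ball of [growth] around z1 then has radius theta delta, just where u <= (1 + eta) a
     is known. *)
  set (rho1 := theta * del / K).
  assert (HKrho : K * rho1 = theta * del) by (unfold rho1; field; lra).
  assert (Hrho : 0 < rho1) by (apply Rdiv_lt_0_compat; [apply Rmult_lt_0_compat; lra|lra]).
  assert (Htd : theta * del < del) by nra.
  assert (Hrho2 : rho1 <= theta * del) by (rewrite <- HKrho; nra).
  (* An oscillation below a/4 at scale h turns u >= a/2 at a grid point into u >= a/4 on its h-ball,
     and u < a/2 into (1 + eta) a - u >= a/4. *)
  destruct (unif_cont n (cball n z0 (K * (2 * r))) u (a / 4) (compact_cball _ _ _) Huc ltac:(lra))
    as [h0 [Hh0 Hunif]].
  destruct (INR_unbounded (rho1 / h0)) as [m Hm].
  assert (Hn0 : 0 <= INR n) by apply pos_INR.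
  assert (Hm1 : 1 <= INR m).
  { assert (0 < rho1 / h0) by (apply Rdiv_lt_0_compat; auto).
    assert (0 < m)%nat by (apply INR_lt; simpl; lra). apply (le_INR 1); lia. }
  (* The grid of m steps then fits into the ball of radius rho1, and m > rho1/h0 gives h <= h0. *)
  set (h := rho1 / ((2 * INR n + 1) * INR m)).
  assert (Hden : 1 <= (2 * INR n + 1) * INR m) by nra.
  assert (Hh : 0 < h) by (apply Rdiv_lt_0_compat; lra).
  assert (Hhden : h * ((2 * INR n + 1) * INR m) = rho1) by (unfold h; field; lra).
  assert (Hhrho : h <= rho1) by nra.
  assert (Hhh0 : h <= h0).
  { assert (rho1 < INR m * h0).
    { apply (Rmult_lt_compat_r h0) in Hm; auto. replace (rho1 / h0 * h0) with rho1 in Hm by (field; lra). lra. }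
    assert (H2 : INR m * h <= rho1) by nra.
    apply (Rmult_le_reg_l (INR m)); lra. }
  set (G := grid_at n z1 h m).
  assert (HG : forall p, In p G -> inH n p /\ dH n z1 p <= rho1).
  { intros p Hp. destruct (grid_at_in n z1 h m p ltac:(lra) Hz1H Hp) as [G1 G2]. split; auto.
    replace ((2 * INR n + 1) * (h * INR m)) with rho1 in G2 by (rewrite <- Hhden; ring). auto. }
  set (q := fun p => if Rle_dec (a / 2) (u p) then true else false).
  set (S1 := filter q G). set (S2 := filter (fun p => negb (q p)) G).
  assert (Hlen : INR (length S1) + INR (length S2) = INR (length G)).
  { rewrite <- plus_INR. f_equal. apply filter_length. }
  assert (Hcount : forall q' y s, h <= s ->
    sumL (fun p => lt_ind (dH n p y) s) (filter q' G) <= count_const n * (s / h) ^ (2 * n + 2)).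
  { intros q' y s Hs. eapply Rle_trans; [apply sumL_filter_le; intros; apply lt_ind_bounds|].
    apply grid_at_count; auto. }
  assert (HGb : forall p, In p G -> cball n z0 (2 * r) p).
  { intros p Hp. destruct (HG p Hp) as [G1 G2]. apply Hnear; auto. lra. }
  assert (T1 : c * (a / 4) * INR (length S1) * (h / (2 * r)) ^ Q <= u w).
  { apply (growth n lam Lam eps A0 A z0 (2 * r) h (a / 4) u S1); auto; try lra.
    - intros y Hy Hd. apply HA. split; auto. unfold K. lra.
    - intros p Hp. apply filter_In in Hp. now apply HGb.
    - apply Hcount.
    - intros p y Hp Hy Hd. apply filter_In in Hp. destruct Hp as [Hp Hq]. unfold q in Hq.
      destruct (Rle_dec (a / 2) (u p)) as [C|]; [|discriminate].
      pose proof (Hunif p y (Hsub _ _ HrK (HGb p Hp)) Hy ltac:(lra)) as U. apply Rabs_def2 in U. lra.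
    - destruct Hw; split; auto; lra. }
  assert (Hsub1 : forall y, cball n z1 (K * rho1) y -> cball n z0 (2 * r) y /\ u y <= (1 + eta) * a).
  { intros y [Hy1 Hy2]. rewrite HKrho in Hy2. now apply Hnear. }
  assert (T2 : c * (a / 4) * INR (length S2) * (h / rho1) ^ Q <= (1 + eta) * a - u z1).
  { apply (growth n lam Lam eps A0 A z1 rho1 h (a / 4) (fun y => (1 + eta) * a - u y) S2); auto; try lra.
    - intros y Hy Hd. apply HA. apply (Hsub (2 * r)); auto. apply Hsub1. split; auto. unfold K. lra.
    - apply (solves_reflect n A z0 (K * (2 * r))); auto. intros y Hd. fold K in Hd.
      pose proof (dH_tri n z0 z1 y). unfold del in *. lra.
    - apply seq_cont_minus; [apply seq_cont_const|]. intros zs y H1 H2 H3.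
      apply Huc; auto; [intros k; apply (Hsub (2 * r)); auto; now apply Hsub1|].
      apply (Hsub (2 * r)); auto; now apply Hsub1.
    - intros y Hy. destruct (Hsub1 y Hy). lra.
    - intros p Hp. apply filter_In in Hp. now apply HG.
    - apply Hcount.
    - intros p y Hp Hy Hd. apply filter_In in Hp. destruct Hp as [Hp Hq]. unfold q in Hq.
      destruct (Rle_dec (a / 2) (u p)) as [|C]; [discriminate|]. apply Rnot_le_lt in C.
      destruct (Hsub1 y Hy) as [Hyb _].
      pose proof (Hunif p y (Hsub _ _ HrK (HGb p Hp)) (Hsub _ _ HrK Hyb) ltac:(lra)) as U. apply Rabs_def2 in U.
      assert (0 < eta * a) by (apply Rmult_lt_0_compat; auto). lra.
    - split; auto. rewrite dH_refl. lra. }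
  set (th := (h / rho1) ^ Q) in *.
  assert (Hth : 0 < th) by (apply pow_lt, Rdiv_lt_0_compat; auto).
  (* At z1 itself the reflected function is only eta a, which caps the number of grid points with u
     < a/2. *)
  assert (N2 : INR (length S2) * th <= grid_density n / 2).
  { fold a in T2. replace ((1 + eta) * a - a) with (eta * a) in T2 by ring.
    assert (Pca : 0 < c * (a / 4)) by (apply Rmult_lt_0_compat; lra).
    apply (Rmult_le_reg_l (c * (a / 4))); auto.
    apply Rle_trans with (eta * a); [lra|]. unfold eta, slack. fold c. lra. }
  assert (N0 : grid_density n <= INR (length G) * th).
  { apply Rle_trans with (INR m ^ Q * th).
    - apply Req_le. unfold th. rewrite <- Rpow_mult_distr. unfold grid_density. fold Q. f_equal.
      unfold h. field. lra.
    - apply Rmult_le_compat_r; [lra|]. apply length_grid_at. }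
  assert (N1 : grid_density n / 2 <= INR (length S1) * th).
  { rewrite <- Hlen, Rmult_plus_distr_r in N0. lra. }
  assert (T3 : c * (a / 4) * (grid_density n / 2) * (rho1 / (2 * r)) ^ Q <= u w).
  { eapply Rle_trans; [|exact T1].
    replace ((h / (2 * r)) ^ Q) with (th * (rho1 / (2 * r)) ^ Q)
      by (unfold th; rewrite <- Rpow_mult_distr; f_equal; field; lra).
    assert (0 < (rho1 / (2 * r)) ^ Q) by (apply pow_lt, Rdiv_lt_0_compat; lra).
    rewrite <- Rmult_assoc. apply Rmult_le_compat_r; [lra|]. rewrite (Rmult_assoc _ _ th).
    apply Rmult_le_compat_l; auto. left. apply Rmult_lt_0_compat; lra. }
  apply (Rmult_le_compat_l (harnack_const n lam Lam)) in T3; [|lra].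
  eapply Rle_trans; [|exact T3]. unfold harnack_const. fold c K theta Q.
  (* The maximality of z1, normalised: its factor (delta/r)^Q is the one produced by the density of
     [S1]. *)
  assert (Hfin : u z <= a * (del / r) ^ Q).
  { apply (Rmult_le_reg_l (r ^ Q)); [apply pow_lt; auto|]. eapply Rle_trans; [exact Hrz|].
    apply Req_le. unfold Rdiv. rewrite Rpow_mult_distr, pow_inv. field. apply pow_nonzero. lra. }
  eapply Rle_trans; [exact Hfin|]. apply Req_le.
  replace (8 / (c * grid_density n) * (2 * K / theta) ^ Q * (c * (a / 4) * (grid_density n / 2) * (rho1 / (2 * r)) ^ Q)) with
    (a * ((2 * K / theta) ^ Q * (rho1 / (2 * r)) ^ Q)) by (field; lra).
  rewrite <- Rpow_mult_distr. f_equal. f_equal. unfold rho1. field. lra.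
Qed.
End Harnack.

(** * Freezing the coefficients at the centre, and the choice of the constants *)

Lemma dot_le_normv n v w e : 0 <= e -> normv n w <= e * normv n v -> Rabs (dotR n v w) <= e * dotR n v v.
Proof.
  intros He H. pose proof (dotR_self_nonneg n v) as Hv. pose proof (dotR_self_nonneg n w) as Hw.
  assert (Ev : normv n v ^ 2 = dotR n v v) by (apply pow2_sqrt; auto).
  assert (Ew : normv n w ^ 2 = dotR n w w) by (apply pow2_sqrt; auto).
  assert (P1 : 0 <= normv n v) by apply sqrt_pos. assert (P2 : 0 <= normv n w) by apply sqrt_pos.
  pose proof (CS_dot n v w) as C. rewrite <- Ev, <- Ew in C. rewrite <- Ev.
  apply Rsqr_incr_0_var; [|apply Rmult_le_pos; [auto|apply pow2_ge_0]].
  rewrite <- Rsqr_abs, !Rsqr_pow2. eapply Rle_trans; [exact C|].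
  replace ((e * normv n v ^ 2) ^ 2) with (normv n v ^ 2 * (e * normv n v) ^ 2) by ring.
  apply Rmult_le_compat_l; [apply pow2_ge_0|]. apply pow_incr. auto.
Qed.

(** By Cauchy-Schwarz, the operator-norm modulus of continuity bounds the quadratic form of A(z) -
    A(z0). *)
Lemma close_to_of_modulus n lam Lam Om om A z0 z e eps : in_Mn n lam Lam Om A -> in_C n Om om A ->
  Om z0 -> Om z -> 0 < e < 1 -> ballH n z0 e z -> 0 <= eps -> om e <= eps -> close_to n lam eps (A z0) (A z).
Proof.
  intros HM HC Hz0 Hz He Hb Hep Hom. destruct (HM z Hz) as [H1 [_ H2]].
  split; [exact H1|]. split; [intros x; apply H2|]. intros v.
  replace (dotR n v (matvec n (A z) v) - dotR n v (matvec n (A z0) v)) with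
    (dotR n v (matvec n (fun i j => A z i j - A z0 i j) v)).
  - apply dot_le_normv; auto. eapply Rle_trans; [apply (HC z0 Hz0 e He z Hb Hz v)|].
    apply Rmult_le_compat_r; [apply sqrt_pos|auto].
  - replace (matvec n (fun i j => A z i j - A z0 i j) v)
      with (fun i => matvec n (A z) v i + -1 * matvec n (A z0) v i).
    + rewrite dotR_plus_r, dotR_scal_r. ring.
    + extensionality i. unfold matvec. rewrite <- sumR_scal, <- sumR_plus. apply sumR_ext. intros; ring.
Qed.

Theorem theorem5p2 :
  forall (n : nat) (lam Lam : R) (om : R -> R) (m : R),
    (1 <= n)%nat ->
    0 < lam -> lam <= 1 -> 1 <= Lam -> modulus om ->
  exists C K : R,
    forall (Om : Point -> Prop) (A : Point -> nat -> nat -> R),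
      open_H n Om -> lebesgue_measure_is n Om m ->
      in_Mn n lam Lam Om A -> symplectic n Om A -> in_C n Om om A ->
    forall (u : Point -> R) (Du : nat -> Point -> R) (D2u : nat -> nat -> Point -> R)
           (P : nat -> nat -> Point -> R),
      C2_on n Om u Du D2u -> XDeriv_on n Om Du P ->
    forall (z0 : Point) (r : R),
      Om z0 -> 0 < r ->
      (forall z, ballH n z0 (K * r) z -> Om z) ->
      (forall z, ballH n z0 (K * r) z -> 0 <= u z /\ LA n A P z = 0) ->
      forall z w, ballH n z0 r z -> ballH n z0 r w -> u z <= C * u w.
Proof.
  intros n lam Lam om m Hn Hl0 Hl1 HL Hom.
  set (X := 16 * ((2 * INR n + 1) / 4 + 1) / lam + 16 / lam + 8 * INR n * Lam).
  pose proof (pos_INR n) as Pn.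
  assert (HX : 0 <= X).
  { unfold X. assert (0 <= 16 * ((2 * INR n + 1) / 4 + 1) / lam)
      by (apply Rmult_le_pos; [lra|left; now apply Rinv_0_lt_compat]).
    assert (0 <= 16 / lam) by (apply Rmult_le_pos; [lra|left; now apply Rinv_0_lt_compat]).
    assert (0 <= 8 * INR n * Lam) by (apply Rmult_le_pos; lra). lra. }
  (* X is the coefficient of eps in [eps_small]; the added 1 avoids a separate argument that X is
     nonzero. *)
  set (eps := 4 / (X + 1)). assert (Hep : 0 < eps) by (apply Rdiv_lt_0_compat; lra).
  assert (Hsmall : eps_small n lam Lam eps).
  { split; [lra|]. fold X. unfold eps. apply (Rmult_le_reg_r (X + 1)); [lra|].
    replace (4 / (X + 1) * X * (X + 1)) with (4 * X) by (field; lra). lra. }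
  destruct Hom as [_ [_ [_ Hlim]]]. destruct (Hlim eps Hep) as [d [Hd Hdlim]].
  (* Below d, so that the modulus at e is less than eps, and below 1, where the modulus is
     defined. *)
  set (e := Rmin d 1 / 2).
  assert (He : 0 < e /\ e < d /\ e < 1).
  { assert (0 < Rmin d 1) by (apply Rmin_glb_lt; lra).
    pose proof (Rmin_l d 1). pose proof (Rmin_r d 1). unfold e. lra. }
  pose proof (Hdlim e ltac:(lra) ltac:(lra)) as Home.
  pose proof (growth_radius_ge n lam Lam) as HK. set (K := growth_radius n lam Lam) in *.
  set (R0 := 1 + 2 * (Rabs m + 2) * INR n ^ (2 * n)).
  assert (HR0 : 0 < R0).
  { assert (0 <= INR n ^ (2 * n)) by (apply pow_le; auto). pose proof (Rabs_pos m).
    assert (0 <= 2 * (Rabs m + 2) * INR n ^ (2 * n)) by (apply Rmult_le_pos; lra). unfold R0. lra. }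
  assert (HKe : 0 < 2 * K * R0 / e) by (apply Rdiv_lt_0_compat; [repeat apply Rmult_lt_0_compat|]; lra).
  (* The part 2K + 1 makes the given ball contain the closed ball of radius 2Kr required by
     [harnack_ball]; the part 2K R0/e turns the radius bound on the given ball into 2Kr < e. *)
  exists (harnack_const n lam Lam), (2 * K + 1 + 2 * K * R0 / e).
  intros Om A HOm Hmeas HM HS HC u Du D2u P HC2 HP z0 r Hz0 Hr Hball Hsol z w Hz Hw.
  set (KK := 2 * K + 1 + 2 * K * R0 / e) in *.
  pose proof (proj1 HOm z0 Hz0) as Hz0H.
  assert (Hrad : KK * r <= R0).
  { apply (ball_radius_bound n m Om z0); auto. apply Rmult_lt_0_compat; [unfold KK; lra|auto]. }
  assert (Hre : K * (2 * r) < e).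
  { apply (Rmult_lt_reg_r (R0 / e)); [now apply Rdiv_lt_0_compat|].
    replace (e * (R0 / e)) with R0 by (field; lra).
    apply Rlt_le_trans with (KK * r); auto. unfold KK.
    assert (0 < (2 * K + 1) * r) by (apply Rmult_lt_0_compat; lra).
    replace (K * (2 * r) * (R0 / e)) with (2 * K * R0 / e * r) by (field; lra). lra. }
  assert (HKr : K * (2 * r) < KK * r).
  { unfold KK. assert (0 < (1 + 2 * K * R0 / e) * r) by (apply Rmult_lt_0_compat; lra). lra. }
  assert (Hin : forall y, cball n z0 (K * (2 * r)) y -> ballH n z0 (KK * r) y)
    by (intros y [Hy1 Hy2]; split; auto; lra).
  destruct (HM z0 Hz0) as [Hsym [_ Hbd]].
  apply (harnack_ball n lam Lam eps (A z0) A z0 r u); auto; fold K.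
  - constructor; auto.
    + intros x. apply Hbd.
    + intros x. apply Hbd.
    + intros i j Hi Hj. exact (HS z0 Hz0 i j Hi Hj).
  - intros y Hy. apply (close_to_of_modulus n lam Lam Om om A z0 y e eps); auto; try lra.
    destruct Hy; split; auto; lra.
  - intros y Hy Hyd. assert (Hyc : cball n z0 (K * (2 * r)) y) by (split; auto; lra).
    exists (symXX n P y). split.
    + exact (proj2 (Hsol y (Hin y Hyc))).
    + intros xi Hxi. apply (C2_der2_hline n Om u Du D2u P); auto.
  - apply (continuous_on_seq_cont n Om); [apply HC2|]. auto.
  - intros y Hy. apply (Hsol y); auto.
  - destruct Hz; split; auto; lra.
  - destruct Hw; split; auto; lra.
Qed.
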